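(* Let $k\ge1$. Let $V_0,\dots,V_k$ and $W_0,\dots,W_k$ be complex Banach spaces, each equipped with an admissible system of rectangular matrix norms, and let $\Omega^{(j)}\subseteq V_{j,\mathrm{nc}}$, $j=0,\dots,k$, be open nc sets. Suppose that for $j=0,\dots,k$ the nc function $$F_j\in\mathcal T^{k+1}(\Omega^{(0)},\dots,\Omega^{(j-1)},\Omega^{(j)},\Omega^{(j)},\Omega^{(j+1)},\dots,\Omega^{(k)};W_{0,\mathrm{nc}},\dots,W_{j,\mathrm{nc}},V_{j,\mathrm{nc}},W_{j+1,\mathrm{nc}},\dots,W_{k,\mathrm{nc}})$$ is analytic. Then there exists an analytic nc function $f\in\mathcal T^k(\Omega^{(0)},\dots,\Omega^{(k)};W_{0,\mathrm{nc}},\dots,W_{k,\mathrm{nc}})$ such that ${}_j\Delta f=F_j$ for $j=0,\dots,k$, if and only if ${}_i\Delta F_j={}_{j+1}\Delta F_i$ for all $0\le i\le j\le k$. Further, $f$ is uniquely determined up to a $k$-linear mapping: if $\tilde f$ is another such function, then there is a $k$-linear mapping $c:W_1\times\cdots\times W_k\to W_0$ such that $\tilde f(X^0,\dots,X^k)(Z^1,\dots,Z^k)=f(X^0,\dots,X^k)(Z^1,\dots,Z^k)+C(Z^1,\dots,Z^k)$, where for $X^j\in\Omega^{(j)}_{n_j}$, $Z^j\in W_j^{n_{j-1}\times n_j}$, the $(\alpha_0,\alpha_k)$ entry of $C(Z^1,\dots,Z^k)\in W_0^{n_0\times n_k}$ is $\sum_{\alpha_1=1}^{n_1}\cdots\s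um_{\alpha_{k-1}=1}^{n_{k-1}}c(Z^1_{\alpha_0,\alpha_1},\dots,Z^k_{\alpha_{k-1},\alpha_k})$.
   Context: The ground ring is $R=\mathbb C$. For a complex vector space $V$, $V_{\mathrm{nc}}=\bigsqcup_{n\ge1}V^{n\times n}$. A subset $\Omega\subseteq V_{\mathrm{nc}}$ is an nc set if $X\oplus Y\in\Omega$ (block diagonal sum) whenever $X,Y\in\Omega$; $\Omega_n=\Omega\cap V^{n\times n}$. An admissible system of rectangular matrix norms on a Banach space $W$: norms on all $W^{p\times q}$, $p,q\in\mathbb N$, such that for all $s_1,\dots,s_m\in\mathbb N$, $s=s_1+\dots+s_m$, the block injections $W^{s_\alpha\times s_\beta}\to W^{s\times s}$, $A\mapsto E_\alpha AE_\beta^\top$, and block projections $W^{s\times s}\to W^{s_\alpha\times s_\beta}$, $A\mapsto E_\alpha^\top AE_\beta$, are bounded, where $E_\alpha\in\mathbb C^{s\times s_\alpha}$ is the block column with $I_{s_\alpha}$ in the $\alpha$-th block and zeros elsewhere. An nc set $\Omega\subseteq V_{\mathrm{nc}}$ is open if $\Omega_n$ is open in $V^{n\times n}$ for every $n$. (Open nc sets are right admissible: for $X\in\Omega_n$, $Y\in\Omega_m$, $Z\in V^{n\times m}$ there is a nonzero $r\in\mathbb C$ with $\begin{bmatrix}X&rZ\\ 0&Y\end{bmatrix}\in\Omega_{n+m}$.) nc functions of order $k\ge1$ (here $\Omega^{(j)}\subseteq V_{j,\mathrm{nc}}$, and $N_0,\dots,N_k$ are complex vector spaces): $f\in\mathcal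 T^k(\Omega^{(0)},\dots,\Omega^{(k)};N_{0,\mathrm{nc}},\dots,N_{k,\mathrm{nc}})$ means that for $X^j\in\Omega^{(j)}_{n_j}$, $f(X^0,\dots,X^k):N_1^{n_0\times n_1}\times\cdots\times N_k^{n_{k-1}\times n_k}\to N_0^{n_0\times n_k}$ is $k$-linear, and $f$ respects intertwinings (equivalently, direct sums and similarities): for complex matrices $T$ and all arguments of appropriate sizes, (i) $TX^0=\tilde X^0T$ implies $Tf(X^0,X^1,\dots,X^k)(Z^1,\dots,Z^k)=f(\tilde X^0,X^1,\dots,X^k)(TZ^1,Z^2,\dots,Z^k)$; (ii) for $0<j<k$, $TX^j=\tilde X^jT$ implies $f(\dots,X^j,\dots)(Z^1,\dots,Z^jT,Z^{j+1},\dots,Z^k)=f(\dots,\tilde X^j,\dots)(Z^1,\dots,Z^j,TZ^{j+1},\dots,Z^k)$; (iii) $TX^k=\tilde X^kT$ implies $f(\dots,X^k)(Z^1,\dots,Z^{k-1},Z^kT)=f(\dots,\tilde X^k)(Z^1,\dots,Z^k)T$. Difference-differential operators. For $f$ of order $k\ge1$ and $0\le j\le k$, ${}_j\Delta f$ is the nc function of order $k+1$ in which the $j$-th point argument is replaced by two points $X^j_1,X^j_2\in\Omega^{(j)}$ and a matrix argument $Z$ over $V_j$ is inserted after $Z^j$; writing $P=\begin{bmatrix}X^j_1&Z\\ 0&X^j_2\end{bmatrix}$, it is determined by ${}_0\Delta f(X^0_1,X^0_2,X^1,\dots,X^k)(Z,Z^1,\dots,Z^k)=\begin{bmatrix}I&0\end{bmatrix}f(P,X^1,\dots,X^k)\left(\begin{bmatrix}0\\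 Z^1\end{bmatrix},Z^2,\dots,Z^k\right)$; for $0<j<k$, ${}_j\Delta f(X^0,\dots,X^j_1,X^j_2,\dots,X^k)(Z^1,\dots,Z^j,Z,Z^{j+1},\dots,Z^k)=f(X^0,\dots,P,\dots,X^k)\left(Z^1,\dots,Z^{j-1},\begin{bmatrix}Z^j&0\end{bmatrix},\begin{bmatrix}0\\ Z^{j+1}\end{bmatrix},Z^{j+2},\dots,Z^k\right)$; ${}_k\Delta f(X^0,\dots,X^{k-1},X^k_1,X^k_2)(Z^1,\dots,Z^k,Z)=f(X^0,\dots,X^{k-1},P)(Z^1,\dots,Z^{k-1},\begin{bmatrix}Z^k&0\end{bmatrix})\begin{bmatrix}0\\ I\end{bmatrix}$. These are used when $P\in\Omega^{(j)}$; for general $Z$ one replaces $Z$ by $rZ$ with $r\ne0$ such that the block matrix lies in $\Omega^{(j)}$ and divides the result by $r$ (this is independent of $r$ and linear in $Z$). The operators ${}_i\Delta$ on functions of order $k+1$ are defined in the same way. Analyticity. For an $\ell$-linear map $\omega$ between normed spaces, $\|\omega\|_{\mathcal L^\ell}=\sup_{\|W^1\|=\dots=\|W^\ell\|=1}\|\omega(W^1,\dots,W^\ell)\|$. An nc function $f$ of order $\ell$ on $\Omega^{(0)}\times\cdots\times\Omega^{(\ell)}$ is: locally bounded if for all $n_0,\dots,n_\ell$ and $Y^j\in\Omega^{(j)}_{n_j}$ there exist $\delta_j>0$ with $\sup_{\|X^j-Y^j\|<\delta_j,\ j=0,\dots,\ell}\|f(X^0,\dots,X^\ell)\|_{\mathcal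 L^\ell}<\infty$; Gateaux differentiable if for all $Y^j\in\Omega^{(j)}_{n_j}$, $Z^j\in V_j^{n_j\times n_j}$ the derivative $\frac{d}{dt}f(Y^0+tZ^0,\dots,Y^\ell+tZ^\ell)|_{t=0}$ exists in the norm $\|\cdot\|_{\mathcal L^\ell}$; analytic if it is locally bounded and Gateaux differentiable. (Here the sets and spaces are those in the list appropriate to the function; for $F_j$, $\ell=k+1$, the set $\Omega^{(j)}$ is repeated and the $(j+1)$-st matrix argument is over $V_j$.) *)

(* Defs.v *)
From HB Require Import structures.
From mathcomp Require Import all_boot all_order all_algebra.
From mathcomp Require Import all_classical all_reals all_analysis.
From mathcomp Require Import complex.

Set Implicit Arguments.
Unset Strict Implicit.
Unset Printing Implicit Defensive.

Import Order.TTheory GRing.Theory Num.Theory numFieldNormedType.Exports.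
Local Open Scope classical_set_scope.
Local Open Scope complex_scope.
Local Open Scope ring_scope.

(* MathComp and MathComp-Analysis; the ground field C is R[i], for R : realType. *)

(* Matrices over a complex vector space [V]: MathComp gives ['M[V]_(p, q)] its
   additive group, but not the actions of scalars and of scalar matrices. *)
Section MatrixActions.
Variables (C : pzRingType) (V : lmodType C).

Definition scmx p q (a : C) (X : 'M[V]_(p, q)) : 'M[V]_(p, q) :=
  \matrix_(i, j) (a *: X i j).

Definition lmx p q r (T : 'M[C]_(p, q)) (X : 'M[V]_(q, r)) : 'M[V]_(p, r) :=
  \matrix_(i, j) \sum_l T i l *: X l j.

Definition rmx p q r (X : 'M[V]_(p, q)) (T : 'M[C]_(q, r)) : 'M[V]_(p, r) :=
  \matrix_(i, j) \sum_l T l j *: X i l.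
End MatrixActions.

(* The block column [E_a]: the identity of size [s a] in block [a], 0 in the
   other blocks. [pid_mx (s a)] is the identity when [i = a]; writing it this
   way avoids a cast between the sizes [s i] and [s a]. *)
Definition blockcol (C : pzRingType) m (s : 'I_m -> nat) (a : 'I_m) :
    'M[C]_(\sum_i s i, s a) :=
  \mxcol_(i < m) (if i == a then pid_mx (s a) else 0 : 'M[C]_(s i, s a)).

Section Spaces.
Variable R : realType.

(* Sizes are positive, so the values of [N] on empty matrices are irrelevant.
   W^{1x1} is identified with W, including its norm. *)
Record admissible (W : completeNormedModType R[i])
    (N : forall p q, 'M[W]_(p, q) -> R) : Prop := Admissible {
  adm_definite : forall p q (A : 'M[W]_(p, q)), (0 < p)%N -> (0 < q)%N ->
    N p q A = 0 -> A = 0;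
  adm_scale : forall p q (a : R[i]) (A : 'M[W]_(p, q)),
    (0 < p)%N -> (0 < q)%N -> (N p q (scmx a A))%:C = `|a| * (N p q A)%:C;
  adm_triangle : forall p q (A B : 'M[W]_(p, q)), (0 < p)%N -> (0 < q)%N ->
    N p q (A + B) <= N p q A + N p q B;
  adm_one : forall w : W, (N 1%N 1%N (const_mx w))%:C = `|w|;
  adm_injection : forall m (s : 'I_m -> nat) (a b : 'I_m),
    (forall i, (0 < s i)%N) ->
    exists K : R, forall A : 'M[W]_(s a, s b),
      N _ _ (lmx (blockcol _ s a) (rmx A (blockcol _ s b)^T)) <= K * N _ _ A;
  adm_projection : forall m (s : 'I_m -> nat) (a b : 'I_m),
    (forall i, (0 < s i)%N) ->
    exists K : R, forall A : 'M[W]_(\sum_i s i, \sum_i s i),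
      N _ _ (lmx (blockcol _ s a)^T (rmx A (blockcol _ s b))) <= K * N _ _ A
}.

Record admspace := AdmSpace {
  carrier :> completeNormedModType R[i];
  mnorm : forall p q, 'M[carrier]_(p, q) -> R;
  mnormP : admissible mnorm
}.

(* V_nc is the disjoint union over n >= 1, so the component at n = 0 is empty. *)
Record open_ncset (V : admspace) := OpenNcset {
  ncdom :> forall n, set 'M[V]_n;
  ncdom_size : forall n (X : 'M[V]_n), ncdom X -> (0 < n)%N;
  ncdom_dsum : forall n m (X : 'M[V]_n) (Y : 'M[V]_m),
    ncdom X -> ncdom Y -> ncdom (block_mx X 0 0 Y);
  ncdom_open : forall n (X : 'M[V]_n), ncdom X ->
    exists2 e : R, 0 < e & forall Y : 'M[V]_n, mnorm (Y - X) < e -> ncdom Y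
}.

(* The signature of T^k(Om_0, .., Om_k; N_0, .., N_k) is a head slot
   (V_0, Om_0, N_0) together with a list of k slots (V_i, Om_i, N_i). For
   i >= 1, N_i is the space of the entries of the argument Z^i; N_0 is the space
   of the entries of the value. *)
Record slot := Slot {
  spt : admspace;
  sdom : open_ncset spt;
  sarg : admspace
}.

(* Heterogeneous tuples indexed by [s = [:: s_1; ..; s_k]]: the sizes
   (n_1, .., n_k), the points (X^1, .., X^k), and, given n_0 = m, the arguments
   (Z^1, .., Z^k) with Z^i of size n_{i-1} x n_i. [lastsize m s n] is n_k. *)
Fixpoint sizes (s : seq slot) : Type :=
  if s is _ :: s' then (nat * sizes s')%type else unit.

Fixpoint points (s : seq slot) : sizes s -> Type :=
  match s with
  | [::] => fun _ => unit
  | t :: s' => fun n => ('M[spt t]_n.1 * points n.2)%type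
  end.

Fixpoint args (m : nat) (s : seq slot) : sizes s -> Type :=
  match s with
  | [::] => fun _ => unit
  | t :: s' => fun n => ('M[sarg t]_(m, n.1) * args n.1 n.2)%type
  end.

Fixpoint lastsize (m : nat) (s : seq slot) : sizes s -> nat :=
  match s with
  | [::] => fun _ => m
  | t :: s' => fun n => lastsize n.1 n.2
  end.

Fixpoint in_dom (s : seq slot) : forall n : sizes s, points n -> Prop :=
  match s return forall n : sizes s, points n -> Prop with
  | [::] => fun _ _ => True
  | t :: s' => fun n X => sdom t _ X.1 /\ @in_dom s' n.2 X.2
  end.

(* What remains of a function of order [size s] once its leading points, the
   last of size [m], and the arguments between them have been fixed. *)
Definition tailmap (N : admspace) (p m : nat) (s : seq slot) : Type :=
  forall n : sizes s, points n -> args m n -> 'M[N]_(p, lastsize m n).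

(* [f n0 X0 n X Z] is f(X^0, .., X^k)(Z^1, .., Z^k). The map is total, but only
   its values at points of the domains are ever considered. *)
Definition ncmap (s0 : slot) (s : seq slot) : Type :=
  forall n0, 'M[spt s0]_n0 -> tailmap (sarg s0) n0 n0 s.

Definition nc_eq s0 s (f g : ncmap s0 s) : Prop :=
  forall n0 (X0 : 'M[spt s0]_n0) (n : sizes s) (X : points n) (Z : args n0 n),
    sdom s0 _ X0 -> in_dom X -> f n0 X0 n X Z = g n0 X0 n X Z.

Definition ncmap_cast s0 s s' (e : s = s') (f : ncmap s0 s) : ncmap s0 s' :=
  eq_rect s (ncmap s0) f s' e.

Fixpoint multilinear (N : admspace) p q (m : nat) (s : seq slot) :
    forall n : sizes s, (args m n -> 'M[N]_(p, q)) -> Prop :=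
  match s return forall n : sizes s, (args m n -> 'M[N]_(p, q)) -> Prop with
  | [::] => fun _ _ => True
  | t :: s' => fun n w =>
      (forall (a : R[i]) (Z Z' : 'M[sarg t]_(m, n.1)) (Zs : args n.1 n.2),
         w (scmx a Z + Z', Zs) = scmx a (w (Z, Zs)) + w (Z', Zs)) /\
      (forall Z : 'M[sarg t]_(m, n.1), @multilinear N p q n.1 s' n.2 (fun Zs => w (Z, Zs)))
  end.

(* Condition (i). For order 0 it reads T f(X) = f(X') T. *)
Definition intertwines_head s0 s : ncmap s0 s -> Prop :=
  match s return ncmap s0 s -> Prop with
  | [::] => fun f =>
      forall n0 n0' (X : 'M[spt s0]_n0) (X' : 'M[spt s0]_n0')
             (T : 'M[R[i]]_(n0', n0)),
        sdom s0 _ X -> sdom s0 _ X' -> lmx T X = rmx X' T ->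
        lmx T (f n0 X tt tt tt) = rmx (f n0' X' tt tt tt) T
  | t :: s' => fun f =>
      forall n0 n0' (X : 'M[spt s0]_n0) (X' : 'M[spt s0]_n0')
             (T : 'M[R[i]]_(n0', n0))
             (n : sizes (t :: s')) (Xs : points n) (Zs : args n0 n),
        sdom s0 _ X -> sdom s0 _ X' -> in_dom Xs -> lmx T X = rmx X' T ->
        lmx T (f n0 X n Xs Zs) = f n0' X' n Xs (lmx T Zs.1, Zs.2)
  end.

(* Conditions (ii) and (iii), at the first remaining point and then,
   recursively, at the later ones. *)
Fixpoint intertwines_tail (N : admspace) p m (s : seq slot) :
    tailmap N p m s -> Prop :=
  match s return tailmap N p m s -> Prop with
  | [::] => fun _ => True
  | t :: s' => fun g =>
      match s' return tailmap N p m (t :: s') -> Prop with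
      | [::] => fun g =>
          forall n n' (X : 'M[spt t]_n) (X' : 'M[spt t]_n')
                 (T : 'M[R[i]]_(n', n)) (Z : 'M[sarg t]_(m, n')),
            sdom t _ X -> sdom t _ X' -> lmx T X = rmx X' T ->
            g (n, tt) (X, tt) (rmx Z T, tt) =
            rmx (g (n', tt) (X', tt) (Z, tt)) T
      | t2 :: s2 => fun g =>
          forall n n' (X : 'M[spt t]_n) (X' : 'M[spt t]_n')
                 (T : 'M[R[i]]_(n', n)) (Z : 'M[sarg t]_(m, n'))
                 (ns : sizes (t2 :: s2)) (Xs : points ns) (Zs : args n ns),
            sdom t _ X -> sdom t _ X' -> in_dom Xs -> lmx T X = rmx X' T ->
            g (n, ns) (X, Xs) (rmx Z T, Zs) =
            g (n', ns) (X', Xs) (Z, (lmx T Zs.1, Zs.2))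
      end g /\
      (forall n (X : 'M[spt t]_n) (Z : 'M[sarg t]_(m, n)), sdom t _ X ->
         @intertwines_tail N p n s'
           (fun ns Xs Zs => g (n, ns) (X, Xs) (Z, Zs)))
  end.

Record nc_function s0 s (f : ncmap s0 s) : Prop := NcFunction {
  nc_multilinear : forall n0 (X0 : 'M[spt s0]_n0) (n : sizes s) (X : points n),
    sdom s0 _ X0 -> in_dom X -> multilinear (f n0 X0 n X);
  nc_intertwines_head : intertwines_head f;
  nc_intertwines_tail : forall n0 (X0 : 'M[spt s0]_n0),
    sdom s0 _ X0 -> intertwines_tail (f n0 X0)
}.

(* Duplicate the point of index [j] (index 0 being the head slot [t]): a second
   point of the same set is inserted after it, with an argument over V_j. *)
Definition dupslot (t : slot) : slot := Slot (sdom t) (spt t).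

Fixpoint dup (t : slot) (s : seq slot) (j : nat) {struct j} : seq slot :=
  match j with
  | 0%N => dupslot t :: s
  | j'.+1 => if s is t' :: s' then t' :: dup t' s' j' else [::]
  end.

(* The scalar r used to move the block matrix into the domain. *)
Definition block_radius (V : admspace) (Om : open_ncset V) n m
    (X : 'M[V]_n) (Y : 'M[V]_m) (Z : 'M[V]_(n, m)) : R[i] :=
  xget 1 [set r : R[i] | r != 0 /\ Om _ (block_mx X (scmx r Z) 0 Y)].

(* (j+1) Delta, seen on the tail [t :: s] = [:: s_1; ..; s_k] with the point of the
   head slot fixed: the point of index [j] of this tail (from 0) is split. *)
Fixpoint Delta_tail (N : admspace) p (j : nat) (t : slot) (s : seq slot)
    (m : nat) : tailmap N p m (t :: s) -> tailmap N p m (t :: dup t s j) :=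
  match j return tailmap N p m (t :: s) -> tailmap N p m (t :: dup t s j) with
  | 0%N =>
      match s return
        tailmap N p m (t :: s) -> tailmap N p m [:: t, dupslot t & s] with
      | [::] => fun g n X Z =>
          let r := block_radius (sdom t) X.1 X.2.1 Z.2.1 in
          let P := block_mx X.1 (scmx r Z.2.1) 0 X.2.1 in
          scmx r^-1
            (rmx (g ((n.1 + n.2.1)%N, tt) (P, tt) (row_mx Z.1 0, tt))
                 (col_mx 0 1%:M))
      | t2 :: s2 => fun g n X Z =>
          let r := block_radius (sdom t) X.1 X.2.1 Z.2.1 in
          let P := block_mx X.1 (scmx r Z.2.1) 0 X.2.1 in
          scmx r^-1
            (g ((n.1 + n.2.1)%N, n.2.2) (P, X.2.2)
               (row_mx Z.1 0, (col_mx 0 Z.2.2.1, Z.2.2.2)))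
      end
  | j'.+1 =>
      match s return
        tailmap N p m (t :: s) -> tailmap N p m (t :: dup t s j'.+1) with
      | [::] => id
      | t2 :: s2 => fun g n X Z =>
          @Delta_tail N p j' t2 s2 n.1
            (fun ns Xs Zs => g (n.1, ns) (X.1, Xs) (Z.1, Zs)) n.2 X.2 Z.2
      end
  end.

Definition Delta_head s0 s : ncmap s0 s -> ncmap s0 (dup s0 s 0) :=
  match s return ncmap s0 s -> ncmap s0 (dupslot s0 :: s) with
  | [::] => fun f n0 X0 n X Z =>
      let r := block_radius (sdom s0) X0 X.1 Z.1 in
      let P := block_mx X0 (scmx r Z.1) 0 X.1 in
      scmx r^-1
        (lmx (row_mx 1%:M 0) (rmx (f (n0 + n.1)%N P tt tt tt) (col_mx 0 1%:M)))
  | t :: s' => fun f n0 X0 n X Z =>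
      let r := block_radius (sdom s0) X0 X.1 Z.1 in
      let P := block_mx X0 (scmx r Z.1) 0 X.1 in
      scmx r^-1
        (lmx (row_mx 1%:M 0)
             (f (n0 + n.1)%N P n.2 X.2 (col_mx 0 Z.2.1, Z.2.2)))
  end.

(* [Delta j f] is the function j Delta f, for [j <= size s]. *)
Definition Delta (j : nat) s0 s (f : ncmap s0 s) : ncmap s0 (dup s0 s j) :=
  match j return ncmap s0 (dup s0 s j) with
  | 0%N => Delta_head f
  | j'.+1 =>
      match s return ncmap s0 s -> ncmap s0 (dup s0 s j'.+1) with
      | [::] => id
      | t :: s' => fun f n0 X0 =>
          @Delta_tail (sarg s0) n0 j' t s' n0 (f n0 X0)
      end f
  end.

(* The signatures of i Delta F_j and (j+1) Delta F_i agree when i <= j, but are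
   convertible only for concrete i and j; whence the cast in the statement. *)
Lemma dup_comm (t : slot) (s : seq slot) (i j : nat) : (i <= j)%N ->
  dup t (dup t s j) i = dup t (dup t s i) j.+1.
Proof.
elim: i j t s => [|i IH] [|j] t s le_ij.
- exact: erefl.
- exact: erefl.
- by [].
- case: s => [|t' s']; first exact: erefl.
  exact: (f_equal (cons t') (IH j t' s' le_ij)).
Defined.

Fixpoint unit_args (m : nat) (s : seq slot) :
    forall n : sizes s, args m n -> Prop :=
  match s return forall n : sizes s, args m n -> Prop with
  | [::] => fun _ _ => True
  | t :: s' => fun n Z => mnorm Z.1 = 1 /\ @unit_args n.1 s' n.2 Z.2
  end.

(* The value 0 is adjoined so that the supremum is 0, and not -oo, when some
   argument space is trivial. *)
Definition opnorm (N : admspace) p q m s (n : sizes s)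
    (w : args m n -> 'M[N]_(p, q)) : \bar R :=
  ereal_sup (0%E |` [set (mnorm (w Z))%:E | Z in @unit_args m s n]).

Fixpoint close_points (d : nat -> R) (s : seq slot) :
    forall n : sizes s, points n -> points n -> Prop :=
  match s return forall n : sizes s, points n -> points n -> Prop with
  | [::] => fun _ _ _ => True
  | t :: s' => fun n X Y =>
      mnorm (X.1 - Y.1) < d 0%N /\ @close_points (fun j => d j.+1) s' n.2 X.2 Y.2
  end.

Definition locally_bounded s0 s (f : ncmap s0 s) : Prop :=
  forall n0 (Y0 : 'M[spt s0]_n0) (n : sizes s) (Y : points n),
    sdom s0 _ Y0 -> in_dom Y ->
    exists d : nat -> R, (forall j, 0 < d j) /\
      exists M : R, forall (X0 : 'M[spt s0]_n0) (X : points n),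
        sdom s0 _ X0 -> in_dom X ->
        mnorm (X0 - Y0) < d 0%N -> close_points (fun j => d j.+1) X Y ->
        (opnorm (f n0 X0 n X) <= M%:E)%E.

(* Y + t Z, pointwise. *)
Fixpoint line (t : R[i]) (s : seq slot) :
    forall n : sizes s, points n -> points n -> points n :=
  match s return forall n : sizes s, points n -> points n -> points n with
  | [::] => fun _ Y _ => Y
  | _ :: s' => fun n Y Z => (Y.1 + scmx t Z.1, @line t s' n.2 Y.2 Z.2)
  end.

Definition gateaux_differentiable s0 s (f : ncmap s0 s) : Prop :=
  forall n0 (Y0 Z0 : 'M[spt s0]_n0) (n : sizes s) (Y Z : points n),
    sdom s0 _ Y0 -> in_dom Y ->
    exists2 D : args n0 n -> 'M[sarg s0]_(n0, lastsize n0 n),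
      multilinear D &
      opnorm (fun W => scmx t^-1 (f n0 (Y0 + scmx t Z0) n (line t Y Z) W
                                  - f n0 Y0 n Y W) - D W)
        @[t --> (0 : (R[i] : numFieldType))^'] --> 0%E.

Definition analytic s0 s (f : ncmap s0 s) : Prop :=
  locally_bounded f /\ gateaux_differentiable f.

Fixpoint vectors (s : seq slot) : Type :=
  if s is t :: s' then (sarg t * vectors s')%type else unit.

Fixpoint vmultilinear (U : admspace) (s : seq slot) : (vectors s -> U) -> Prop :=
  match s return (vectors s -> U) -> Prop with
  | [::] => fun _ => True
  | t :: s' => fun c =>
      (forall (a : R[i]) (w w' : sarg t) (ws : vectors s'),
         c (a *: w + w', ws) = a *: c (w, ws) + c (w', ws)) /\
      (forall w : sarg t, vmultilinear (fun ws => c (w, ws)))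
  end.

(* The (a, b) entry of C(Z^1, .., Z^k), for k >= 1: the sum over
   a_1, .., a_{k-1} of c(Z^1_{a, a_1}, .., Z^k_{a_{k-1}, b}). *)
Fixpoint amplify_entry (U : admspace) (m : nat) (t : slot) (s : seq slot)
    {struct s} :
    (vectors (t :: s) -> U) -> forall n : sizes (t :: s), args m n ->
    'I_m -> 'I_(lastsize m n) -> U :=
  match s return (vectors (t :: s) -> U) ->
    forall n : sizes (t :: s), args m n ->
    'I_m -> 'I_(lastsize m n) -> U with
  | [::] => fun c n Z a b => c (Z.1 a b, tt)
  | t2 :: s2 => fun c n Z a b =>
      \sum_(a1 < n.1)
        @amplify_entry U n.1 t2 s2 (fun ws => c (Z.1 a a1, ws)) n.2 Z.2 a1 b
  end.

(* For k = 0 the constant c is read as the scalar matrix c I. *)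
Definition amplify (U : admspace) m s : (vectors s -> U) ->
    forall n : sizes s, args m n -> 'M[U]_(m, lastsize m n) :=
  match s return (vectors s -> U) ->
    forall n : sizes s, args m n -> 'M[U]_(m, lastsize m n) with
  | [::] => fun c n Z => \matrix_(a, b) (c tt *+ (a == b))
  | t :: s' => fun c n Z => \matrix_(a, b) amplify_entry c Z a b
  end.

End Spaces.

Arguments Delta {R} j {s0 s} f.

(* Main.v *)
Require Import Defs.
From HB Require Import structures.
From mathcomp Require Import all_boot all_order all_algebra.
From mathcomp Require Import all_classical all_reals all_analysis.
From mathcomp Require Import complex ring.

Set Implicit Arguments.
Unset Strict Implicit.
Unset Printing Implicit Defensive.

Import Order.TTheory GRing.Theory Num.Theory numFieldNormedType.Exports.
Local Open Scope classical_set_scope.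
Local Open Scope complex_scope.
Local Open Scope ring_scope.


(** Write D_j(f, F) for the difference formula in the j-th slot:
    f(.., X1, ..)(.., Z, S Z', ..) - f(.., X2, ..)(.., Z S, Z', ..)
      = F(.., X1, X2, ..)(.., Z, X1 S - S X2, Z', ..)
    for all scalar matrices S. For nc functions f and F it is equivalent to
    [Delta j f = F], and it makes f an nc function as soon as F is multilinear.

    Existence: fix base points Y in the domains and put S_a = e_a e_0^T,
    T_a = e_0 e_a^T, so that sum_a S_a T_a = I. The homotopy
    (h F)(X)(Z, Z') = sum_a F(X, Y)(Z, X S_a - S_a Y, T_a Z') satisfies D(h F, F) when F
    is closed, and h F = f - P f when D(f, F), where P f evaluates f at Y on (Z S_a, T_a Z')
    and sums over a. Hence f = sum_j P_0 .. P_(j-1) h_j F_j works; it is built by recursion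
    on the list of slots.

    Uniqueness: a function with vanishing differences equals P_0 .. P_k of itself, that
    is, it is the amplification of its corner value at the base points.

    Analyticity: the admissible norms make scalar matrix multiplications bounded, so local
    bounds of the F_j pass to f through the formula. Telescoping D_j along a line writes
    the difference quotient of f as a sum of values of the F_j at nearby points, which
    converge in norm because the F_j are Lipschitz along lines. *)

(** Points of different sizes have no difference X - Y, and the domains need be neither connected
    nor convex, so there is no path from the base point to X along which to integrate. The
    rectangular matrices S replace paths: X S - S Y compares points of any two sizes. The same S
    absorbs the block matrices P: every point in the formula D_j lies in the domain, so the scalar r
    and its choice disappear once [Delta] has been translated. Taking S = I gives increments, and an
    S that intertwines the two points makes the right side vanish, which is one of the conditions
    (i), (ii), (iii). The formula is linear in the pair (f, F) and is preserved when the first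
    argument or the value is multiplied on the left by a scalar matrix; it can therefore be checked
    summand by summand in h and P, one slot at a time. *)

Section MatrixActionTheory.
Variables (C : comNzRingType) (V : lmodType C).
Implicit Types (p q r : nat) (a b : C).

Lemma scmxA p q a b (X : 'M[V]_(p, q)) : scmx a (scmx b X) = scmx (a * b) X.
Proof. by apply/matrixP => i j; rewrite !mxE scalerA. Qed.
Lemma scmx1 p q (X : 'M[V]_(p, q)) : scmx 1 X = X.
Proof. by apply/matrixP => i j; rewrite !mxE scale1r. Qed.
Lemma scmxDr p q a (X Y : 'M[V]_(p, q)) : scmx a (X + Y) = scmx a X + scmx a Y.
Proof. by apply/matrixP => i j; rewrite !mxE scalerDr. Qed.
Lemma scmxDl p q (X : 'M[V]_(p, q)) a b : scmx (a + b) X = scmx a X + scmx b X.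
Proof. by apply/matrixP => i j; rewrite !mxE scalerDl. Qed.
Lemma scmx0r p q a : scmx a (0 : 'M[V]_(p, q)) = 0.
Proof. by apply/matrixP => i j; rewrite !mxE scaler0. Qed.
Lemma scmx0l p q (X : 'M[V]_(p, q)) : scmx 0 X = 0.
Proof. by apply/matrixP => i j; rewrite !mxE scale0r. Qed.
Lemma scmxNl p q a (X : 'M[V]_(p, q)) : scmx (- a) X = - scmx a X.
Proof. by apply/matrixP => i j; rewrite !mxE scaleNr. Qed.
Lemma scmxNr p q a (X : 'M[V]_(p, q)) : scmx a (- X) = - scmx a X.
Proof. by apply/matrixP => i j; rewrite !mxE scalerN. Qed.
Lemma scmxBr p q a (X Y : 'M[V]_(p, q)) : scmx a (X - Y) = scmx a X - scmx a Y.
Proof. by rewrite scmxDr scmxNr. Qed.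

Lemma lmxA p q r s (S : 'M[C]_(p, q)) (T : 'M[C]_(q, r)) (X : 'M[V]_(r, s)) :
  lmx S (lmx T X) = lmx (S *m T) X.
Proof.
apply/matrixP => i j; rewrite !mxE.
under eq_bigr do rewrite mxE scaler_sumr.
rewrite exchange_big; apply: eq_bigr => l _.
by rewrite mxE scaler_suml; apply: eq_bigr => h _; rewrite scalerA.
Qed.

Lemma rmxA p q r s (S : 'M[C]_(q, r)) (T : 'M[C]_(r, s)) (X : 'M[V]_(p, q)) :
  rmx (rmx X S) T = rmx X (S *m T).
Proof.
apply/matrixP => i j; rewrite !mxE.
under eq_bigr do rewrite mxE scaler_sumr.
rewrite exchange_big; apply: eq_bigr => l _.
by rewrite mxE scaler_suml; apply: eq_bigr => h _; rewrite scalerA mulrC.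
Qed.

Lemma lmx_rmx p q r s (S : 'M[C]_(p, q)) (X : 'M[V]_(q, r)) (T : 'M[C]_(r, s)) :
  lmx S (rmx X T) = rmx (lmx S X) T.
Proof.
apply/matrixP => i j; rewrite !mxE.
under eq_bigr do rewrite mxE scaler_sumr.
rewrite exchange_big; apply: eq_bigr => l _.
rewrite mxE scaler_sumr; apply: eq_bigr => h _.
by rewrite !scalerA mulrC.
Qed.

Lemma lmx1 p q (X : 'M[V]_(p, q)) : lmx 1%:M X = X.
Proof.
apply/matrixP => i j; rewrite mxE (bigD1 i) //= big1 => [|l ne_li].
  by rewrite mxE eqxx scale1r addr0.
by rewrite mxE eq_sym (negbTE ne_li) scale0r.
Qed.

Lemma rmx1 p q (X : 'M[V]_(p, q)) : rmx X 1%:M = X.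
Proof.
apply/matrixP => i j; rewrite mxE (bigD1 j) //= big1 => [|l ne_li].
  by rewrite mxE eqxx scale1r addr0.
by rewrite mxE (negbTE ne_li) scale0r.
Qed.

Lemma lmx_linr p q r (T : 'M[C]_(p, q)) a (X Y : 'M[V]_(q, r)) :
  lmx T (scmx a X + Y) = scmx a (lmx T X) + lmx T Y.
Proof.
apply/matrixP => i j; rewrite !mxE scaler_sumr -big_split.
by apply: eq_bigr => l _; rewrite !mxE scalerDr !scalerA mulrC.
Qed.

Lemma lmx_linl p q r a (S T : 'M[C]_(p, q)) (X : 'M[V]_(q, r)) :
  lmx (a *: S + T) X = scmx a (lmx S X) + lmx T X.
Proof.
apply/matrixP => i j; rewrite !mxE scaler_sumr -big_split.
by apply: eq_bigr => l _; rewrite !mxE scalerDl !scalerA.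
Qed.

Lemma rmx_linl p q r (T : 'M[C]_(q, r)) a (X Y : 'M[V]_(p, q)) :
  rmx (scmx a X + Y) T = scmx a (rmx X T) + rmx Y T.
Proof.
apply/matrixP => i j; rewrite !mxE scaler_sumr -big_split.
by apply: eq_bigr => l _; rewrite !mxE scalerDr !scalerA mulrC.
Qed.

Lemma rmx_linr p q r a (S T : 'M[C]_(q, r)) (X : 'M[V]_(p, q)) :
  rmx X (a *: S + T) = scmx a (rmx X S) + rmx X T.
Proof.
apply/matrixP => i j; rewrite !mxE scaler_sumr -big_split.
by apply: eq_bigr => l _; rewrite !mxE scalerDl !scalerA.
Qed.

Lemma lmx0r p q r (T : 'M[C]_(p, q)) : lmx T (0 : 'M[V]_(q, r)) = 0.
Proof. by apply/matrixP => i j; rewrite !mxE big1 // => l _; rewrite mxE scaler0. Qed.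
Lemma lmx0l p q r (X : 'M[V]_(q, r)) : lmx (0 : 'M[C]_(p, q)) X = 0.
Proof. by apply/matrixP => i j; rewrite !mxE big1 // => l _; rewrite mxE scale0r. Qed.
Lemma rmx0l p q r (T : 'M[C]_(q, r)) : rmx (0 : 'M[V]_(p, q)) T = 0.
Proof. by apply/matrixP => i j; rewrite !mxE big1 // => l _; rewrite mxE scaler0. Qed.
Lemma rmx0r p q r (X : 'M[V]_(p, q)) : rmx X (0 : 'M[C]_(q, r)) = 0.
Proof. by apply/matrixP => i j; rewrite !mxE big1 // => l _; rewrite mxE scale0r. Qed.

Lemma lmxDr p q r (T : 'M[C]_(p, q)) (X Y : 'M[V]_(q, r)) :
  lmx T (X + Y) = lmx T X + lmx T Y.
Proof. by rewrite -{1}(scmx1 X) lmx_linr scmx1. Qed.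
Lemma lmxZr p q r (T : 'M[C]_(p, q)) a (X : 'M[V]_(q, r)) :
  lmx T (scmx a X) = scmx a (lmx T X).
Proof. by rewrite -[scmx a X]addr0 lmx_linr lmx0r addr0. Qed.
Lemma lmxNr p q r (T : 'M[C]_(p, q)) (X : 'M[V]_(q, r)) : lmx T (- X) = - lmx T X.
Proof. by rewrite -[- X]scmx1 scmxNr -scmxNl lmxZr scmxNl scmx1. Qed.
Lemma lmxBr p q r (T : 'M[C]_(p, q)) (X Y : 'M[V]_(q, r)) :
  lmx T (X - Y) = lmx T X - lmx T Y.
Proof. by rewrite lmxDr lmxNr. Qed.
Lemma lmxZl p q r a (T : 'M[C]_(p, q)) (X : 'M[V]_(q, r)) :
  lmx (a *: T) X = scmx a (lmx T X).
Proof. by rewrite -[a *: T]addr0 lmx_linl lmx0l addr0. Qed.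

Lemma rmxDl p q r (T : 'M[C]_(q, r)) (X Y : 'M[V]_(p, q)) :
  rmx (X + Y) T = rmx X T + rmx Y T.
Proof. by rewrite -{1}(scmx1 X) rmx_linl scmx1. Qed.
Lemma rmxZl p q r (T : 'M[C]_(q, r)) a (X : 'M[V]_(p, q)) :
  rmx (scmx a X) T = scmx a (rmx X T).
Proof. by rewrite -[scmx a X]addr0 rmx_linl rmx0l addr0. Qed.
Lemma rmxNl p q r (T : 'M[C]_(q, r)) (X : 'M[V]_(p, q)) : rmx (- X) T = - rmx X T.
Proof. by rewrite -[- X]scmx1 scmxNr -scmxNl rmxZl scmxNl scmx1. Qed.
Lemma rmxBl p q r (T : 'M[C]_(q, r)) (X Y : 'M[V]_(p, q)) :
  rmx (X - Y) T = rmx X T - rmx Y T.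
Proof. by rewrite rmxDl rmxNl. Qed.
Lemma rmxZr p q r a (T : 'M[C]_(q, r)) (X : 'M[V]_(p, q)) :
  rmx X (a *: T) = scmx a (rmx X T).
Proof. by rewrite -[a *: T]addr0 rmx_linr rmx0r addr0. Qed.

Lemma lmx_sumr p q r I (s : seq I) (P : pred I) (T : 'M[C]_(p, q))
    (X : I -> 'M[V]_(q, r)) :
  lmx T (\sum_(i <- s | P i) X i) = \sum_(i <- s | P i) lmx T (X i).
Proof. exact: (big_morph _ (lmxDr T) (lmx0r r T)). Qed.

Lemma lmx_col p1 p2 q r (S : 'M[C]_(p1, q)) (T : 'M[C]_(p2, q)) (X : 'M[V]_(q, r)) :
  lmx (col_mx S T) X = col_mx (lmx S X) (lmx T X).
Proof.
apply/matrixP => i j; rewrite !mxE.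
case: split_ordP => k ->; rewrite mxE; apply: eq_bigr => l _.
  by rewrite col_mxEu.
by rewrite col_mxEd.
Qed.

Lemma rmx_row p q r1 r2 (S : 'M[C]_(q, r1)) (T : 'M[C]_(q, r2)) (X : 'M[V]_(p, q)) :
  rmx X (row_mx S T) = row_mx (rmx X S) (rmx X T).
Proof.
apply/matrixP => i j; rewrite !mxE.
case: split_ordP => k ->; rewrite mxE; apply: eq_bigr => l _.
  by rewrite row_mxEl.
by rewrite row_mxEr.
Qed.

Lemma lmx_block p q1 q2 r1 r2 (S : 'M[C]_(p, q1)) (T : 'M[C]_(p, q2))
    (X : 'M[V]_(q1, r1)) Y Z (U : 'M[V]_(q2, r2)) :
  lmx (row_mx S T) (block_mx X Y Z U) =
  row_mx (lmx S X + lmx T Z) (lmx S Y + lmx T U).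
Proof.
apply/matrixP => i j; rewrite [LHS]mxE big_split_ord /=.
case: (split_ordP j) => k ->.
  rewrite row_mxEl ![in RHS]mxE; congr (_ + _); apply: eq_bigr => l _.
    by rewrite row_mxEl block_mxEul.
  by rewrite row_mxEr block_mxEdl.
rewrite row_mxEr ![in RHS]mxE; congr (_ + _); apply: eq_bigr => l _.
  by rewrite row_mxEl block_mxEur.
by rewrite row_mxEr block_mxEdr.
Qed.

Lemma rmx_block p1 p2 q1 q2 r (S : 'M[C]_(q1, r)) (T : 'M[C]_(q2, r))
    (X : 'M[V]_(p1, q1)) Y Z (U : 'M[V]_(p2, q2)) :
  rmx (block_mx X Y Z U) (col_mx S T) =
  col_mx (rmx X S + rmx Y T) (rmx Z S + rmx U T).
Proof.
apply/matrixP => i j; rewrite [LHS]mxE big_split_ord /=.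
case: (split_ordP i) => k ->.
  rewrite col_mxEu ![in RHS]mxE; congr (_ + _); apply: eq_bigr => l _.
    by rewrite col_mxEu block_mxEul.
  by rewrite col_mxEd block_mxEur.
rewrite col_mxEd ![in RHS]mxE; congr (_ + _); apply: eq_bigr => l _.
  by rewrite col_mxEu block_mxEdl.
by rewrite col_mxEd block_mxEdr.
Qed.

End MatrixActionTheory.

(** * Block inclusions and projections *)

Section Blocks.
Variables (C : comNzRingType) (V : lmodType C).

Definition inl_mx n m : 'M[C]_(n + m, n) := col_mx 1%:M 0.
Definition inr_mx n m : 'M[C]_(n + m, m) := col_mx 0 1%:M.
Definition prl_mx n m : 'M[C]_(n, n + m) := row_mx 1%:M 0.
Definition prr_mx n m : 'M[C]_(m, n + m) := row_mx 0 1%:M.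

Lemma prl_inl n m : prl_mx n m *m inl_mx n m = 1%:M.
Proof. by rewrite mul_row_col mulmx1 mul0mx addr0. Qed.
Lemma prl_inr n m : prl_mx n m *m inr_mx n m = 0.
Proof. by rewrite mul_row_col mulmx0 mul0mx addr0. Qed.
Lemma prr_inr n m : prr_mx n m *m inr_mx n m = 1%:M.
Proof. by rewrite mul_row_col mulmx1 mul0mx add0r. Qed.
Lemma rmx_prl p n m (Z : 'M[V]_(p, n)) : row_mx Z 0 = rmx Z (prl_mx n m).
Proof. by rewrite /prl_mx rmx_row rmx1 rmx0r. Qed.
Lemma lmx_inr p n m (Z : 'M[V]_(m, p)) : col_mx 0 Z = lmx (inr_mx n m) Z.
Proof. by rewrite /inr_mx lmx_col lmx1 lmx0l. Qed.

Variables (n m : nat) (X : 'M[V]_n) (Y : 'M[V]_m) (W : 'M[V]_(n, m)).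
Let P := block_mx X W 0 Y.

(** Among the four canonical maps, [inl_mx] and [prr_mx] intertwine P with its diagonal blocks. The
    other two fail to do so by a term in W, and this defect is the source of W in the difference
    formula. *)
Lemma block_inl : rmx P (inl_mx n m) = lmx (inl_mx n m) X.
Proof. by rewrite rmx_block lmx_col rmx1 !rmx0r rmx0l lmx1 lmx0l !addr0. Qed.
Lemma block_prr : lmx (prr_mx n m) P = rmx Y (prr_mx n m).
Proof. by rewrite lmx_block rmx_row rmx1 !lmx0l rmx0r !lmx1 !add0r. Qed.
Lemma block_inr :
  rmx P (inr_mx n m) = lmx (inl_mx n m) W + lmx (inr_mx n m) Y.
Proof.
by rewrite rmx_block !lmx_col !rmx1 !rmx0r !lmx1 !lmx0l add_col_mx !add0r addr0.
Qed.
Lemma block_prl :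
  lmx (prl_mx n m) P = rmx X (prl_mx n m) + rmx W (prr_mx n m).
Proof.
by rewrite lmx_block !rmx_row !rmx1 !lmx1 !lmx0l !rmx0r add_row_mx !addr0 add0r.
Qed.
End Blocks.

(** * The rank-one matrices S_a and T_a; the size [b.+1] of the base point provides the index 0 *)

Section Corner.
Variables (C : comNzRingType) (b : nat).

Definition colsel n (a : 'I_n) : 'M[C]_(n, b.+1) := delta_mx a ord0.
Definition rowsel n (a : 'I_n) : 'M[C]_(b.+1, n) := delta_mx ord0 a.

Lemma sum_colsel_rowsel n : \sum_(a < n) colsel a *m rowsel a = 1%:M.
Proof.
apply/matrixP => i j; rewrite summxE (bigD1 i) //= big1 => [|a ne_ai].
  by rewrite mul_delta_mx !mxE eqxx /= addr0 eq_sym.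
by rewrite mul_delta_mx mxE eq_sym (negbTE ne_ai).
Qed.
Lemma rowsel_mul n1 n2 (S : 'M[C]_(n1, n2)) a :
  rowsel a *m S = \sum_(c < n2) S a c *: rowsel c.
Proof.
apply/matrixP => i j; rewrite summxE mxE [LHS](bigD1 a) //= [X in _ + X = _]big1 => [|l ne_la].
  rewrite [RHS](bigD1 j) //= [X in _ = _ + X]big1 => [|l ne_lj]; rewrite !mxE ?eqxx ?andbT.
    by rewrite !addr0 mulrC.
  by rewrite [j == l]eq_sym (negbTE ne_lj) andbF mulr0.
by rewrite !mxE (negbTE ne_la) andbF mul0r.
Qed.
Lemma mul_colsel n1 n2 (S : 'M[C]_(n1, n2)) c :
  S *m colsel c = \sum_(a < n1) S a c *: colsel a.
Proof.
apply/matrixP => i j; rewrite summxE mxE [LHS](bigD1 c) //= [X in _ + X = _]big1 => [|l ne_la].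
  rewrite [RHS](bigD1 i) //= [X in _ = _ + X]big1 => [|l ne_lj]; rewrite !mxE ?eqxx //=.
  by rewrite [i == l]eq_sym (negbTE ne_lj) mulr0.
by rewrite !mxE (negbTE ne_la) mulr0.
Qed.
End Corner.

(** * The difference formula in one slot *)

(** What stands to the right of the slot under study, with the matrices that can be moved into it
    from the left. It treats a further argument and the final value alike, so that conditions (ii)
    and (iii) become one law. *)
Record rowmod (C : fieldType) := RowMod {
  rmsort :> nat -> lmodType C;
  ract : forall n' n, rmsort n' -> 'M[C]_(n', n) -> rmsort n;
  ract_linl : forall n' n a (g g' : rmsort n') (T : 'M[C]_(n', n)),
    ract (a *: g + g') T = a *: ract g T + ract g' T;
  ractA : forall n1 n2 n3 (g : rmsort n1) (S : 'M[C]_(n1, n2)) (T : 'M[C]_(n2, n3)),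
    ract (ract g S) T = ract g (S *m T);
  ract1 : forall n (g : rmsort n), ract g 1%:M = g
}.
Arguments ract {C r n' n}.

Section RowModTheory.
Variables (C : fieldType) (E : rowmod C).

Lemma ract0l n' n (T : 'M[C]_(n', n)) : ract (0 : E n') T = 0.
Proof.
have := ract_linl (-1) (0 : E n') 0 T.
by rewrite scaler0 addr0 scaleN1r addNr.
Qed.
Lemma ractDl n' n (g g' : E n') (T : 'M[C]_(n', n)) :
  ract (g + g') T = ract g T + ract g' T.
Proof. by rewrite -{1}(scale1r g) ract_linl scale1r. Qed.
Lemma ractZl n' n a (g : E n') (T : 'M[C]_(n', n)) :
  ract (a *: g) T = a *: ract g T.
Proof. by rewrite -[a *: g]addr0 ract_linl ract0l addr0. Qed.
Lemma ractBl n' n (g g' : E n') (T : 'M[C]_(n', n)) :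
  ract (g - g') T = ract g T - ract g' T.
Proof. by rewrite ractDl -scaleN1r ractZl scaleN1r. Qed.
Lemma ract_suml n' n I (s : seq I) (P : pred I) (g : I -> E n') (T : 'M[C]_(n', n)) :
  ract (\sum_(i <- s | P i) g i) T = \sum_(i <- s | P i) ract (g i) T.
Proof.
by apply: (big_morph (fun h => ract h T)) => [x y|]; [exact: ractDl | exact: ract0l].
Qed.

(* The action need not be additive in the matrix on maps that are not multilinear. *)
Definition rgood n (g : E n) := forall q a (S T : 'M[C]_(n, q)),
  ract g (a *: S + T) = a *: ract g S + ract g T.

Variables (n q : nat) (g : E n).
Hypothesis g_good : rgood g.

Lemma ract0r : ract g (0 : 'M[C]_(n, q)) = 0.
Proof.
have := g_good (-1) (0 : 'M[C]_(n, q)) 0.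
by rewrite scaler0 addr0 scaleN1r addNr.
Qed.
Lemma ractDr (S T : 'M[C]_(n, q)) : ract g (S + T) = ract g S + ract g T.
Proof. by rewrite -{1}(scale1r S) g_good scale1r. Qed.
Lemma ractZr a (S : 'M[C]_(n, q)) : ract g (a *: S) = a *: ract g S.
Proof. by rewrite -[a *: S]addr0 g_good ract0r addr0. Qed.
Lemma ract_sumr I (s : seq I) (P : pred I) (T : I -> 'M[C]_(n, q)) :
  ract g (\sum_(i <- s | P i) T i) = \sum_(i <- s | P i) ract g (T i).
Proof.
by apply: (big_morph (fun h => ract g h)) => [x y|]; [exact: ractDr | exact: ract0r].
Qed.
End RowModTheory.

Section Slinear.
Variables (C : fieldType) (A : lmodType C).

Definition slinear p q (E : lmodType C) (f : 'M[A]_(p, q) -> E) :=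
  forall a Z Z', f (scmx a Z + Z') = a *: f Z + f Z'.

Variables (p q : nat) (E : lmodType C) (f : 'M[A]_(p, q) -> E).
Hypothesis f_lin : slinear f.
Lemma slinear0 : f 0 = 0.
Proof.
by have := f_lin (-1) 0 0; rewrite scmx0r addr0 scaleN1r addNr.
Qed.
Lemma slinearZ a Z : f (scmx a Z) = a *: f Z.
Proof. by rewrite -[scmx a Z]addr0 f_lin slinear0 addr0. Qed.
Lemma slinearD Z Z' : f (Z + Z') = f Z + f Z'.
Proof. by rewrite -{1}(scmx1 Z) f_lin scale1r. Qed.
Lemma slinearB Z Z' : f (Z - Z') = f Z - f Z'.
Proof. by rewrite slinearD -[- Z']scmx1 scmxNr -scmxNl slinearZ scaleN1r. Qed.
Lemma slinear_sum I (s : seq I) (P : pred I) (Z : I -> 'M[A]_(p, q)) :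
  f (\sum_(i <- s | P i) Z i) = \sum_(i <- s | P i) f (Z i).
Proof. by apply: (big_morph f) => [x y|]; [exact: slinearD | exact: slinear0]. Qed.

End Slinear.

Section OneSlot.
Variables (C : fieldType) (V A : lmodType C) (dom : forall n, set 'M[V]_n).
Variables (m : nat).
Implicit Types (E : rowmod C).

Definition srow (E : rowmod C) := forall n, 'M[V]_n -> 'M[A]_(m, n) -> E n.
Definition srow2 (E : rowmod C) := forall n1 n2, 'M[V]_n1 -> 'M[V]_n2 ->
  'M[A]_(m, n1) -> 'M[V]_(n1, n2) -> E n2.

Definition sintw E (f : srow E) := forall n n' (X : 'M[V]_n) (X' : 'M[V]_n')
  (T : 'M[C]_(n', n)) (Z : 'M[A]_(m, n')), dom X -> dom X' ->
  lmx T X = rmx X' T -> f n X (rmx Z T) = ract (f n' X' Z) T.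

Definition sdiff E (f : srow E) (F : srow2 E) :=
  forall n1 n2 (X1 : 'M[V]_n1) (X2 : 'M[V]_n2) (S : 'M[C]_(n1, n2)) Z,
  dom X1 -> dom X2 ->
  ract (f n1 X1 Z) S - f n2 X2 (rmx Z S) = F n1 n2 X1 X2 Z (rmx X1 S - lmx S X2).

(** [sintwl] and [sintwr] are the intertwining conditions of F in the first and in the second copy
    of the split point; W is the argument between the copies. *)
Definition sintwl E (F : srow2 E) :=
  forall n n' n2 (X : 'M[V]_n) (X' : 'M[V]_n') (X2 : 'M[V]_n2)
  (T : 'M[C]_(n', n)) (Z : 'M[A]_(m, n')) (W : 'M[V]_(n, n2)),
  dom X -> dom X' -> dom X2 -> lmx T X = rmx X' T ->
  F n n2 X X2 (rmx Z T) W = F n' n2 X' X2 Z (lmx T W).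

Definition sintwr E (F : srow2 E) :=
  forall n1 n n' (X1 : 'M[V]_n1) (X : 'M[V]_n) (X' : 'M[V]_n')
  (T : 'M[C]_(n', n)) (Z : 'M[A]_(m, n1)) (W : 'M[V]_(n1, n')),
  dom X1 -> dom X -> dom X' -> lmx T X = rmx X' T ->
  F n1 n X1 X Z (rmx W T) = ract (F n1 n' X1 X' Z W) T.

(* With U = inr - r inl S one has P U = U X2, so splitting inr as U + r inl S
   reduces f(P) to f(X1) and f(X2). *)
Lemma sintw_diff E (f : srow E) n1 n2 (X1 : 'M[V]_n1) (X2 : 'M[V]_n2)
    (S : 'M[C]_(n1, n2)) Z (r : C) :
  sintw f -> (forall n X, dom X -> slinear (f n X)) ->
  (forall n X Z, dom X -> rgood (f n X Z)) ->
  dom X1 -> dom X2 -> r != 0 ->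
  dom (block_mx X1 (scmx r (rmx X1 S - lmx S X2)) 0 X2) ->
  ract (f n1 X1 Z) S - f n2 X2 (rmx Z S) =
  r^-1 *: ract (f _ (block_mx X1 (scmx r (rmx X1 S - lmx S X2)) 0 X2)
                    (rmx Z (prl_mx C n1 n2))) (inr_mx C n1 n2).
Proof.
move=> f_int f_lin f_good dX1 dX2 r0; set W := _ - _; set P := block_mx _ _ _ _ => dP.
pose U := inr_mx C n1 n2 - r *: (inl_mx C n1 n2 *m S).
have -> : inr_mx C n1 n2 = r *: (inl_mx C n1 n2 *m S) + U by rewrite addrC subrK.
have PU : lmx U X2 = rmx P U.
  rewrite /U -[inr_mx _ _ _ - _]addrC -scaleNr lmx_linl rmx_linr -rmxA block_inl.
  rewrite block_inr lmxZr /W lmxBr lmx_rmx lmxA scmxBr !scmxNl.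
  by rewrite !addrA addNr add0r.
rewrite f_good // -ractA -(f_int _ _ X1 P) //; last by rewrite block_inl.
rewrite rmxA prl_inl rmx1 -(f_int _ _ X2 P U) // rmxA.
have -> : prl_mx C n1 n2 *m U = (- r) *: S.
  by rewrite mulmxBr prl_inr -scalemxAr mulmxA prl_inl mul1mx sub0r scaleNr.
rewrite rmxZr slinearZ; last exact: f_lin.
by rewrite scaleNr -scalerBr scalerA mulVf // scale1r.
Qed.

(** Apply the difference formula at P and X2 with S = inr. The value at X2 receives Z prl inr = 0,
    and P inr - inr X2 = r inl W. The intertwining of F along inl then brings P back to X1, and
    homogeneity in W cancels r. *)
Lemma sdiff_block E (f : srow E) (F : srow2 E) n1 n2 (X1 : 'M[V]_n1)
    (X2 : 'M[V]_n2) Z W (r : C) :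
  sdiff f F -> sintwl F -> f n2 X2 0 = 0 ->
  F n1 n2 X1 X2 Z (scmx r W) = r *: F n1 n2 X1 X2 Z W ->
  dom X1 -> dom X2 -> r != 0 -> dom (block_mx X1 (scmx r W) 0 X2) ->
  r^-1 *: ract (f _ (block_mx X1 (scmx r W) 0 X2) (rmx Z (prl_mx C n1 n2)))
    (inr_mx C n1 n2) = F n1 n2 X1 X2 Z W.
Proof.
move=> fF F_int f0 Fr dX1 dX2 r0 dP.
have := fF _ _ _ X2 (inr_mx C n1 n2) (rmx Z (prl_mx C n1 n2)) dP dX2.
rewrite rmxA prl_inr rmx0r f0 subr0 block_inr addrK => ->.
rewrite -(F_int _ _ _ X1) ?block_inl // rmxA prl_inl rmx1 Fr scalerA mulVf //.
by rewrite scale1r.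
Qed.

(** An intertwining T makes the inserted argument X' T - T X of F vanish. *)
Lemma sdiff_sintw E (f : srow E) (F : srow2 E) :
  sdiff f F ->
  (forall n1 n2 X1 X2 Z, dom X1 -> dom X2 -> F n1 n2 X1 X2 Z 0 = 0) -> sintw f.
Proof.
move=> fF F0 n n' X X' T Z dX dX' TX.
have /eqP := fF _ _ X' X T Z dX' dX.
by rewrite TX subrr F0 // subr_eq0 eq_sym => /eqP.
Qed.

(* Evaluating the difference formula at P and Q with S = inr prl, and
   multiplying by inr, makes the left side vanish. *)
Lemma sdiff_block_comm E (f : srow E) (F : srow2 E) n1 n2 n3
    (X1 : 'M[V]_n1) (X2 : 'M[V]_n2) (X3 : 'M[V]_n3) Z W1 W2 (r rho : C) :
  sdiff f F -> sintwl F -> sintwr F ->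
  (forall n1 n2 X1 X2 Z, dom X1 -> dom X2 -> slinear (F n1 n2 X1 X2 Z)) ->
  (forall n X, dom X -> slinear (f n X)) ->
  (forall n X Z, dom X -> rgood (f n X Z)) ->
  dom X1 -> dom X2 -> dom X3 -> r != 0 -> rho != 0 ->
  dom (block_mx X1 (scmx r W1) 0 X2) -> dom (block_mx X2 (scmx rho W2) 0 X3) ->
  r^-1 *: F _ _ (block_mx X1 (scmx r W1) 0 X2) X3 (rmx Z (prl_mx C n1 n2))
    (lmx (inr_mx C n1 n2) W2) =
  rho^-1 *: ract (F _ _ X1 (block_mx X2 (scmx rho W2) 0 X3) Z
    (rmx W1 (prl_mx C n2 n3))) (inr_mx C n2 n3).
Proof.
move=> fF Fl Fr F_lin f_lin f_good dX1 dX2 dX3 r0 rho0.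
set P := block_mx X1 _ _ _; set Q := block_mx X2 _ _ _ => dP dQ.
have := fF _ _ P Q (inr_mx C n1 n2 *m prl_mx C n2 n3) (rmx Z (prl_mx C n1 n2)) dP dQ.
rewrite rmxA mulmxA prl_inr mul0mx rmx0r (slinear0 (f_lin _ _ _)) // subr0.
rewrite -rmxA block_inr -lmxA block_prl lmxDr rmxDl lmx_rmx.
(* The terms inr X2 prl of P inr prl and of inr prl Q cancel, leaving r inl W1 prl - rho inr W2
   prr. *)
rewrite opprD addrA addrK.
set WW := (X in F _ _ _ _ _ X) => e.
have {e} : 0 = ract (F _ _ P Q (rmx Z (prl_mx C n1 n2)) WW) (inr_mx C n2 n3).
  by rewrite -e ractA -mulmxA prl_inr mulmx0 ract0r //; apply: f_good.
rewrite {}/WW lmxZr !rmxZl lmxZr slinearB; last exact: F_lin.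
rewrite !slinearZ ?ractBl ?ractZl; [|exact: F_lin..].
rewrite -lmx_rmx -(Fl _ _ _ X1) ?block_inl // rmxA prl_inl rmx1.
rewrite lmx_rmx (Fr _ _ _ P Q X3) ?block_prr // ractA prr_inr ract1 => e.
apply: (scalerI (mulf_neq0 r0 rho0)).
rewrite scalerA mulrAC mulfV // mul1r scalerA mulfK //.
by apply/eqP; rewrite eq_sym -subr_eq0; apply/eqP/esym.
Qed.

Variable b : nat.
Variable Y : 'M[V]_b.+1.
Hypothesis dY : dom Y.

Definition homotopy E (F : srow2 E) : srow E := fun n X Z =>
  \sum_(a < n) ract (F n b.+1 X Y Z (rmx X (colsel C b a) - lmx (colsel C b a) Y))
    (rowsel C b a).

(** The operator P of the overview, K being the function frozen at the base point. *)
Definition spread E (K : 'M[A]_(m, b.+1) -> E b.+1) n (Z : 'M[A]_(m, n)) : E n :=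
  \sum_(a < n) ract (K (rmx Z (colsel C b a))) (rowsel C b a).

(** The sum of the tensors of S_a with T_a is central: both sides expand to the sum of S_ac phi(S_a)
    T_c over a and c. *)
Lemma sum_sel E n1 n2 (phi : 'M[C]_(n1, b.+1) -> E b.+1) (S : 'M[C]_(n1, n2)) :
  (forall a S T, phi (a *: S + T) = a *: phi S + phi T) ->
  (forall T, rgood (phi T)) ->
  \sum_(a < n1) ract (phi (colsel C b a)) (rowsel C b a *m S) =
  \sum_(c < n2) ract (phi (S *m colsel C b c)) (rowsel C b c).
Proof.
move=> phi_lin phi_good.
have phi0 : phi 0 = 0.
  by have := phi_lin (-1) 0 0; rewrite scaler0 addr0 scaleN1r addNr.
have phiD x y : phi (x + y) = phi x + phi y.
  by rewrite -{1}(scale1r x) phi_lin scale1r.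
have phiZ a x : phi (a *: x) = a *: phi x.
  by rewrite -[a *: x]addr0 phi_lin phi0 addr0.
under eq_bigr => a _.
  rewrite rowsel_mul ract_sumr //; under eq_bigr do rewrite ractZr //.
  over.
under [RHS]eq_bigr => c _.
  rewrite mul_colsel (big_morph phi phiD phi0) ract_suml.
  under eq_bigr do rewrite phiZ ractZl.
  over.
by rewrite exchange_big.
Qed.

(** Since [spread K] does not see the point X, this says that P f has zero difference in its
    slot. *)
Lemma spread_natural E (K : 'M[A]_(m, b.+1) -> E b.+1) n1 n2 (S : 'M[C]_(n1, n2)) Z :
  slinear K -> (forall Z, rgood (K Z)) ->
  ract (spread K Z) S = spread K (rmx Z S).
Proof.
move=> K_lin K_good; rewrite /spread ract_suml.
under eq_bigr do rewrite ractA.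
rewrite (sum_sel (phi := fun T => K (rmx Z T))) //.
  by under eq_bigr do rewrite -rmxA.
by move=> a T T'; rewrite rmx_linr K_lin.
Qed.

Lemma sum_ract_sel E n (g : E n) : rgood g ->
  \sum_(a < n) ract (ract g (colsel C b a)) (rowsel C b a) = g.
Proof.
move=> g_good; under eq_bigr do rewrite ractA.
by rewrite -ract_sumr // sum_colsel_rowsel ract1.
Qed.

(** It will be applied to the given F_j in the role of f, with a second difference in the role of F;
    closedness enters the integration of the later slots in this way. *)
Lemma homotopy_sdiff E (f : srow E) (F : srow2 E) n (X : 'M[V]_n) Z :
  sdiff f F -> dom X -> rgood (f n X Z) ->
  homotopy F X Z = f n X Z - spread (f b.+1 Y) Z.
Proof.
move=> fF dX f_good; rewrite -[in RHS](sum_ract_sel f_good) -sumrB.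
by apply: eq_bigr => a _; rewrite -fF // ractBl.
Qed.
End OneSlot.

(* The one-variable Poincare lemma: the two difference formulas for F express
   that F is closed, and the homotopy operator integrates it. *)
Lemma sdiff_homotopy (C : fieldType) (V A : lmodType C)
    (dom : forall n, set 'M[V]_n) (m : nat) (E : rowmod C) b (Y : 'M[V]_b.+1)
    (F : srow2 V A m E)
    (G : forall n1 n2 n3, 'M[V]_n1 -> 'M[V]_n2 -> 'M[V]_n3 ->
       'M[A]_(m, n1) -> 'M[V]_(n1, n2) -> 'M[V]_(n2, n3) -> E n3) :
  dom _ Y ->
  (forall n1 n2 X1 X2 Z, dom n1 X1 -> dom n2 X2 -> slinear (F n1 n2 X1 X2 Z)) ->
  (forall n1 n2 X1 X2 Z W, dom n1 X1 -> dom n2 X2 -> rgood (F n1 n2 X1 X2 Z W)) ->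
  (forall n1 n2 n3 X1 X2 X3 (S : 'M[C]_(n1, n2)) Z W,
     dom n1 X1 -> dom n2 X2 -> dom n3 X3 ->
     F n1 n3 X1 X3 Z (lmx S W) - F n2 n3 X2 X3 (rmx Z S) W =
     G n1 n2 n3 X1 X2 X3 Z (rmx X1 S - lmx S X2) W) ->
  (forall n1 n2 n3 X1 X2 X3 (S : 'M[C]_(n2, n3)) Z W,
     dom n1 X1 -> dom n2 X2 -> dom n3 X3 ->
     ract (F n1 n2 X1 X2 Z W) S - F n1 n3 X1 X3 Z (rmx W S) =
     G n1 n2 n3 X1 X2 X3 Z W (rmx X2 S - lmx S X3)) ->
  sdiff dom (homotopy Y F) F.
Proof.
move=> dY F_lin F_good FG0 FG1 n1 n2 X1 X2 S Z dX1 dX2.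
rewrite /homotopy ract_suml; under eq_bigr do rewrite ractA.
rewrite (sum_sel (phi := fun T => F n1 b.+1 X1 Y Z (rmx X1 T - lmx T Y))); first last.
- by move=> T; apply: F_good.
- move=> a T T'; rewrite rmx_linr lmx_linl opprD addrACA -scmxBr.
  exact: F_lin.
rewrite -sumrB -[RHS](sum_ract_sel b); last exact: F_good.
apply: eq_bigr => a _; rewrite -ractBl; congr ract.
set W := rmx X1 S - lmx S X2.
(* Both formulas produce the same G at X1, X2, Y: [FG1] expands F(X1, X2)(Z, W) S_a, and [FG0]
   trades G for values of F at Y. What remains is W S_a + S (X2 S_a - S_a Y) = X1 S S_a - S S_a
   Y. *)
have /eqP := FG1 _ _ _ X1 X2 Y (colsel C b a) Z W dX1 dX2 dY.
rewrite subr_eq => /eqP ->.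
rewrite -[G _ _ _ _ _ _ _ _ _]FG0 // addrAC; congr (_ - _).
rewrite -slinearD; last exact: F_lin.
congr (F _ _ _ _ _ _).
by rewrite /W rmxBl rmxA lmxBr lmx_rmx lmxA [RHS]addrC addrA subrK.
Qed.

(** An alias that carries [scmx] as its scalar action, so that spaces of maps into matrices become
    modules. *)
Definition vmat (C : pzRingType) (V : lmodType C) p q := 'M[V]_(p, q).
HB.instance Definition _ (C : comNzRingType) (V : lmodType C) p q :=
  GRing.Zmodule.on (vmat V p q).
HB.instance Definition _ (C : comNzRingType) (V : lmodType C) p q :=
  GRing.Zmodule_isLmodule.Build C (vmat V p q)
    (@scmxA C V p q) (@scmx1 C V p q) (@scmxDr C V p q) (@scmxDl C V p q).

(** * Tails of nc functions *)

Section Tails.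
Variables (R : realType) (N : admspace R).
Implicit Types (p m n j : nat) (t : slot R) (s : seq (slot R)).

(* With the remaining points fixed, what remains of a tail after an argument with [n]
   columns is regarded as a row of length [n]: a matrix acts on the next argument from
   the left or, when no argument remains, on the value from the right. *)
Definition trow p s (ns : sizes s) n : lmodType R[i] :=
  args n ns -> vmat N p (lastsize n ns).

Definition tract p s : forall (ns : sizes s) n' n,
    trow p ns n' -> 'M[R[i]]_(n', n) -> trow p ns n :=
  match s return forall (ns : sizes s) n' n,
    trow p ns n' -> 'M[R[i]]_(n', n) -> trow p ns n with
  | [::] => fun ns n' n g T _ => rmx (g tt) T
  | t :: s' => fun ns n' n g T Zs => g (lmx T Zs.1, Zs.2)
  end.

Lemma tract_linl p s (ns : sizes s) n' n a (g g' : trow p ns n') (T : 'M[R[i]]_(n', n)) :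
  tract (a *: g + g') T = a *: tract g T + tract g' T.
Proof.
case: s ns g g' => [|t s] ns g g'; apply/funext => Zs //=.
exact: rmx_linl.
Qed.

Lemma tractA p s (ns : sizes s) n1 n2 n3 (g : trow p ns n1)
    (S : 'M[R[i]]_(n1, n2)) (T : 'M[R[i]]_(n2, n3)) :
  tract (tract g S) T = tract g (S *m T).
Proof.
case: s ns g => [|t s] ns g; apply/funext => Zs //=; first exact: rmxA.
by rewrite lmxA.
Qed.

Lemma tract1 p s (ns : sizes s) n (g : trow p ns n) : tract g 1%:M = g.
Proof.
case: s ns g => [|t s] ns g; apply/funext => Zs /=.
  by case: Zs; rewrite rmx1.
by case: Zs => Z Zs; rewrite lmx1.
Qed.

Definition trowmod p s (ns : sizes s) : rowmod R[i] :=
  RowMod (@tract_linl p s ns) (@tractA p s ns) (@tract1 p s ns).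

Lemma multilinear_rgood p s (ns : sizes s) m (w : args m ns -> 'M[N]_(p, lastsize m ns)) :
  multilinear w -> @rgood _ (trowmod p ns) m w.
Proof.
case: s ns w => [|t s] ns w wM q a S T; apply/funext => Zs /=.
  exact: rmx_linr.
by rewrite lmx_linl wM.1.
Qed.

Definition slotv p m t s (g : tailmap N p m (t :: s)) (ns : sizes s) (Xs : points ns) :
    srow (spt t) (sarg t) m (trowmod p ns) :=
  fun n X Z Zs => g (n, ns) (X, Xs) (Z, Zs).

Definition slotv2 p m t s (G : tailmap N p m [:: t, dupslot t & s])
    (ns : sizes s) (Xs : points ns) n1 n2 (X1 : 'M[spt t]_n1) (X2 : 'M[spt t]_n2)
    (Z : 'M[sarg t]_(m, n1)) (W : 'M[spt t]_(n1, n2)) : trowmod p ns n2 :=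
  fun Zs => G (n1, (n2, ns)) (X1, (X2, Xs)) (Z, (W, Zs)).

Definition tailat p m t s (g : tailmap N p m (t :: s)) n (X : 'M[spt t]_n)
    (Z : 'M[sarg t]_(m, n)) : tailmap N p n s :=
  fun ns Xs Zs => g (n, ns) (X, Xs) (Z, Zs).

Definition teq p m s (g g' : tailmap N p m s) :=
  forall ns (X : points ns) Z, in_dom X -> g ns X Z = g' ns X Z.

Definition tmulti p m s (g : tailmap N p m s) :=
  forall ns (X : points ns), in_dom X -> multilinear (g ns X).

Lemma tmulti_tailat p m t s (g : tailmap N p m (t :: s)) n (X : 'M[spt t]_n) Z :
  tmulti g -> sdom t _ X -> tmulti (tailat g X Z).
Proof. by move=> gM dX ns Xs dXs; case: (gM (n, ns) (X, Xs)) => // _ /(_ Z). Qed.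

Lemma tmulti_slotv p m t s (g : tailmap N p m (t :: s)) ns (Xs : points ns) n
    (X : 'M[spt t]_n) : tmulti g -> sdom t _ X -> in_dom Xs ->
  slinear (slotv g Xs X) /\ (forall Z, rgood (slotv g Xs X Z)).
Proof.
move=> gM dX dXs; case: (gM (n, ns) (X, Xs)) => // gM1 gM2; split.
  by move=> a Z Z'; apply/funext => Zs; apply: gM1.
by move=> Z; apply: multilinear_rgood; apply: gM2.
Qed.

(** In terms of [tract] the laws for an inner slot and for the last slot coincide; no later proof
    has to tell conditions (ii) and (iii) apart. *)
Lemma tintwP p m t s (g : tailmap N p m (t :: s)) :
  intertwines_tail g <->
  (forall ns (Xs : points ns), in_dom Xs -> sintw (sdom t) (slotv g Xs)) /\
  (forall n (X : 'M[spt t]_n) Z, sdom t _ X -> intertwines_tail (tailat g X Z)).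
Proof.
case: s g => [|t2 s] g; (split=> -[g1 g2]; split=> //).
- move=> [] [] _ n n' X X' T Z dX dX' TX; apply/funext => -[].
  exact: g1.
- by move=> n n' X X' T Z dX dX' TX; have /(congr1 (@^~ tt)) := g1 tt tt I n n' X X' T Z dX dX' TX.
- move=> ns Xs dXs n n' X X' T Z dX dX' TX; apply/funext => Zs.
  exact: g1.
- move=> n n' X X' T Z ns Xs Zs dX dX' dXs TX.
  by have /(congr1 (@^~ Zs)) := g1 ns Xs dXs n n' X X' T Z dX dX' TX.
Qed.

Lemma tintw_tailat p m t s (g : tailmap N p m (t :: s)) n (X : 'M[spt t]_n) Z :
  intertwines_tail g -> sdom t _ X -> intertwines_tail (tailat g X Z).
Proof. by move=> /tintwP[_]; apply. Qed.

Lemma tintw_slotv p m t s (g : tailmap N p m (t :: s)) ns (Xs : points ns) :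
  intertwines_tail g -> in_dom Xs -> sintw (sdom t) (slotv g Xs).
Proof. by move=> /tintwP[+ _]; apply. Qed.

(** The difference formula D_j on a tail: the points and arguments of the leading slots are frozen
    one by one until the split slot heads the list. *)
Fixpoint tdiff p j t s m :
    tailmap N p m (t :: s) -> tailmap N p m (t :: dup t s j) -> Prop :=
  match j return tailmap N p m (t :: s) -> tailmap N p m (t :: dup t s j) -> Prop with
  | 0%N => fun g G => forall ns (Xs : points ns), in_dom Xs ->
      sdiff (sdom t) (slotv g Xs) (@slotv2 p m t s G ns Xs)
  | j'.+1 =>
      match s return
        tailmap N p m (t :: s) -> tailmap N p m (t :: dup t s j'.+1) -> Prop with
      | [::] => fun _ _ => True
      | t2 :: s2 => fun g G => forall n (X : 'M[spt t]_n) Z, sdom t _ X ->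
          @tdiff p j' t2 s2 n (tailat g X Z) (tailat G X Z)
      end
  end.

Section TwoSlots.
Variables (p m : nat) (t : slot R) (s : seq (slot R)).
Variable (G : tailmap N p m [:: t, dupslot t & s]).
Variables (ns : sizes s) (Xs : points ns).
Hypotheses (dXs : in_dom Xs) (G_multi : tmulti G).

Lemma tmulti_slotv2 n1 n2 (X1 : 'M[spt t]_n1) (X2 : 'M[spt t]_n2) Z :
  sdom t _ X1 -> sdom t _ X2 ->
  slinear (slotv2 G Xs X1 X2 Z) /\ (forall W, rgood (slotv2 G Xs X1 X2 Z W)).
Proof.
move=> dX1 dX2.
exact: (@tmulti_slotv _ _ _ _ (tailat G X1 Z) ns Xs n2 X2 (tmulti_tailat _ G_multi dX1)).
Qed.

Lemma tintw_sintwl : intertwines_tail G -> sintwl (sdom t) (slotv2 G Xs).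
Proof.
move=> /tintwP[G1 _] n n' n2 X X' X2 T Z W dX dX' dX2 TX; apply/funext => Zs.
by have /(congr1 (@^~ (W, Zs))) := G1 (n2, ns) (X2, Xs) (conj dX2 dXs) _ _ _ _ _ Z dX dX' TX.
Qed.

Lemma tintw_sintwr : intertwines_tail G -> sintwr (sdom t) (slotv2 G Xs).
Proof.
move=> /tintwP[_ G2] n1 n n' X1 X X' T Z W dX1 dX dX' TX.
by have /tintwP[/(_ _ _ dXs)/(_ n n' X X' T W dX dX' TX)] := G2 n1 X1 Z dX1.
Qed.
End TwoSlots.

End Tails.

(** * Matrix norms and right admissibility of open nc sets *)

Section Norms.
Variable R : realType.
Implicit Types (a : R[i]).

Definition cabs a : R := complex.Re `|a|.

Lemma cabsE a : `|a| = (cabs a)%:C.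
Proof. by rewrite /cabs normc_def. Qed.
Lemma cabs_ge0 a : 0 <= cabs a.
Proof. by rewrite /cabs normc_def sqrtr_ge0. Qed.
Lemma cabs_real (x : R) : 0 <= x -> cabs x%:C = x.
Proof. by move=> x0; apply: complexI; rewrite -cabsE ger0_norm // lecR. Qed.
Lemma cabs0 : cabs 0 = 0.
Proof. by apply: complexI; rewrite -cabsE normr0. Qed.

Section MatrixNorm.
Variables (W : admspace R) (p q : nat).
Hypotheses (p0 : (0 < p)%N) (q0 : (0 < q)%N).
Implicit Types A B : 'M[W]_(p, q).

Lemma mnormZ a A : mnorm (scmx a A) = cabs a * mnorm A.
Proof.
apply: complexI; rewrite rmorphM /= -cabsE.
exact: (adm_scale (mnormP W)).
Qed.
Lemma mnorm0 : mnorm (0 : 'M[W]_(p, q)) = 0.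
Proof. by rewrite -(scmx0l 0) mnormZ cabs0 mul0r. Qed.
Lemma mnormN A : mnorm (- A) = mnorm A.
Proof.
rewrite -[- A]scmx1 scmxNr -scmxNl mnormZ -[RHS]mul1r; congr (_ * _).
by apply: complexI; rewrite -cabsE normrN1.
Qed.
Lemma mnormD A B : mnorm (A + B) <= mnorm A + mnorm B.
Proof. exact: (adm_triangle (mnormP W)). Qed.
Lemma mnorm_ge0 A : 0 <= mnorm A.
Proof.
rewrite -(pmulr_rge0 _ (ltr0n _ 2)) mulr_natl mulr2n -{2}mnormN.
by rewrite -mnorm0 -(subrr A) mnormD.
Qed.
Lemma mnorm_sum I (s : seq I) (P : pred I) (A : I -> 'M[W]_(p, q)) :
  mnorm (\sum_(i <- s | P i) A i) <= \sum_(i <- s | P i) mnorm (A i).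
Proof.
elim/big_rec2: _ => [|i y x _ h]; first by rewrite mnorm0.
by rewrite (le_trans (mnormD _ _)) // lerD2l.
Qed.
Lemma mnorm_eq0 A : mnorm A = 0 -> A = 0.
Proof. exact: (adm_definite (mnormP W)). Qed.
End MatrixNorm.

(** The block diagonal point lies in the domain, and openness leaves room for a small multiple of
    the corner Z. *)
Lemma block_radiusP (V : admspace R) (Om : open_ncset V) n m (X : 'M[V]_n)
    (Y : 'M[V]_m) (Z : 'M[V]_(n, m)) : Om _ X -> Om _ Y ->
  let r := block_radius Om X Y Z in
  r != 0 /\ Om _ (block_mx X (scmx r Z) 0 Y).
Proof.
move=> dX dY; rewrite /block_radius;
apply: (@xgetPex _ 1 [set r : R[i] | r != 0 /\ Om _ (block_mx X (scmx r Z) 0 Y)]).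
have [e e0 He] := ncdom_open (ncdom_dsum dX dY).
have nm0 : (0 < n + m)%N by rewrite addn_gt0 (ncdom_size dX).
pose K := mnorm (block_mx 0 Z 0 0 : 'M[V]_(n + m)).
have K0 : 0 <= K by exact: mnorm_ge0.
(* The summand 1 keeps the denominator positive when Z is zero, and makes x K strictly smaller than
   e. *)
pose x : R := e / (K + 1).
have x0 : 0 < x by rewrite divr_gt0 // ltr_wpDl.
exists x%:C; split=> /=; first by rewrite fmorph_eq0 gt_eqF.
apply: He.
have -> : block_mx X (scmx x%:C Z) 0 Y - block_mx X 0 0 Y =
   scmx x%:C (block_mx 0 Z 0 0).
  apply/matrixP => i j; rewrite !mxE.
  by case: splitP => k _; rewrite !mxE; case: splitP => l _;
    rewrite !mxE ?subrr ?subr0 ?scaler0.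
rewrite mnormZ // cabs_real ?ltW // -/K /x -mulrA gtr_pMr // mulrC.
by rewrite ltr_pdivrMr ?mul1r ?ltrDl // ltr_wpDl.
Qed.
End Norms.

(** * The operators Delta on tails *)

Notation DeltaT j g := (@Delta_tail _ _ _ j _ _ _ g).

Section DeltaTail.
Variables (R : realType) (N : admspace R).
Implicit Types (p m n j : nat) (t : slot R) (s : seq (slot R)).

Lemma Delta_tail0E p m t s (g : tailmap N p m (t :: s)) ns (Xs : points ns) n1 n2
    (X1 : 'M[spt t]_n1) (X2 : 'M[spt t]_n2) Z W :
  slotv2 (DeltaT 0 g) Xs X1 X2 Z W =
  let r := block_radius (sdom t) X1 X2 W in
  r^-1 *: ract (slotv g Xs (block_mx X1 (scmx r W) 0 X2)
                  (rmx Z (prl_mx R[i] n1 n2))) (inr_mx R[i] n1 n2).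
Proof.
case: s g ns Xs => [|t2 s] g ns Xs; apply/funext => Zs /=.
  by rewrite /slotv2 /= rmx_prl; case: ns Xs Zs => -[] [].
by rewrite /slotv2 /= rmx_prl lmx_inr.
Qed.

Lemma tdiff_Delta p j t s m (g : tailmap N p m (t :: s)) :
  tmulti g -> intertwines_tail g -> tdiff g (DeltaT j g).
Proof.
elim: j t s m g => [|j IH] t s m g gM g_int.
  move=> ns Xs dXs n1 n2 X1 X2 S Z dX1 dX2; rewrite Delta_tail0E; cbv zeta.
  have [r0 dP] := block_radiusP (rmx X1 S - lmx S X2) dX1 dX2.
  apply: (@sintw_diff _ _ _ (sdom t) m _ (slotv g Xs)) => //.
  - exact: tintw_slotv.
  - by move=> n X dX; have [] := tmulti_slotv gM dX dXs.
  - by move=> n X Y dX; have [_] := tmulti_slotv gM dX dXs; apply.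
case: s g gM g_int => [|t2 s] g gM g_int //= n X Z dX.
apply: (IH t2 s n (tailat g X Z)); first exact: tmulti_tailat.
exact: tintw_tailat.
Qed.

(** A partial converse of [tdiff_Delta]: the difference formula determines [Delta]. Multilinearity
    of G gives the homogeneity by which r cancels. *)
Lemma tdiff_Delta_eq p j t s m (g : tailmap N p m (t :: s)) G :
  (j <= size s)%N -> tdiff g G -> tmulti g -> tmulti G -> intertwines_tail G ->
  teq (DeltaT j g) G.
Proof.
elim: j t s m g G => [|j IH] t s m g G.
  move=> _ gG gM GM G_int [n1 [n2 ns]] [X1 [X2 Xs]] [Z [W Zs]] /= [dX1 [dX2 dXs]].
  have /(congr1 (@^~ Zs)) := Delta_tail0E g Xs X1 X2 Z W.
  have [r0 dP] := block_radiusP W dX1 dX2.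
  rewrite /slotv2 /= => ->.
  have /(congr1 (@^~ Zs)) : _ = slotv2 G Xs X1 X2 Z W := sdiff_block
    (gG ns Xs dXs) (tintw_sintwl dXs G_int)
    (slinear0 (tmulti_slotv gM dX2 dXs).1)
    (slinearZ (tmulti_slotv2 dXs GM Z dX1 dX2).1 _ _) dX1 dX2 r0 dP.
  by [].
case: s g G => [|t2 s] g G //= js gG gM GM G_int [n ns] [X Xs] [Z Zs] [dX dXs].
apply: (IH t2 s n (tailat g X Z) (tailat G X Z)) => //; first exact: gG.
- exact: tmulti_tailat.
- exact: tmulti_tailat.
exact: (tintw_tailat (g := G)).
Qed.

(** The radius depends on the points and the domain only, so both sides evaluate at the same block
    matrix, and this matrix lies in the domain. *)
Lemma Delta_tail_congr p j t s m (g g' : tailmap N p m (t :: s)) :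
  teq g g' -> teq (DeltaT j g) (DeltaT j g').
Proof.
elim: j t s m g g' => [|j IH] t s m g g' gg'.
  move=> [n1 [n2 ns]] [X1 [X2 Xs]] [Z [W Zs]] /= [dX1 [dX2 dXs]].
  have [r0 dP] := block_radiusP W dX1 dX2.
  set P := block_mx X1 _ _ _ in dP.
  have e : slotv g Xs P = slotv g' Xs P.
    by apply/funext => Z'; apply/funext => Zs'; exact: (gg' (_, ns) (P, Xs) (Z', Zs') (conj dP dXs)).
  have := Delta_tail0E g Xs X1 X2 Z W.
  have := Delta_tail0E g' Xs X1 X2 Z W.
  cbv zeta; rewrite -/P e => <-.
  by move=> /(congr1 (@^~ Zs)).
case: s g g' gg' => [|t2 s] g g' gg' //= [n ns] [X Xs] [Z Zs] [dX dXs].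
by apply: IH => // ns' Xs' Zs' dXs'; exact: (gg' (n, ns') (X, Xs') (Z, Zs') (conj dX dXs')).
Qed.

(** This lemma and the next two carry the splitting of a later slot past the factors created by
    splitting an earlier one: inr on an argument, 1/r on the value, and prl on the value for the
    head slot. *)
Lemma Delta_tail_lmx_arg p j t s m m' (T : 'M[R[i]]_(m', m))
    (g : tailmap N p m' (t :: s)) ns Xs Zs :
  DeltaT j (fun (ns : sizes (t :: s)) Xs Zs => g ns Xs (lmx T Zs.1, Zs.2)) Xs Zs =
  DeltaT j g Xs (lmx T Zs.1, Zs.2) :> 'M[N]_(p, lastsize m (s := t :: dup t s j) ns).
Proof.
case: j ns Xs Zs => [|j]; case: s g => [|t2 s] g ns Xs Zs //=.
  by rewrite !rmx_prl lmx_rmx.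
by rewrite !rmx_prl lmx_rmx.
Qed.

Lemma Delta_tail_scmx p j t s m a (g : tailmap N p m (t :: s)) ns Xs Zs :
  (j <= size s)%N ->
  DeltaT j (fun (ns : sizes (t :: s)) Xs Zs => scmx a (g ns Xs Zs)) Xs Zs =
  scmx a (DeltaT j g Xs Zs) :> 'M[N]_(p, lastsize m (s := t :: dup t s j) ns).
Proof.
elim: j t s m g ns Xs Zs => [|j IH] t [|t2 s] m g ns Xs Zs //= js.
- by rewrite rmxZl !scmxA mulrC.
- by rewrite !scmxA mulrC.
- exact: (IH t2 s ns.1 (fun ns' Xs' Zs' => g (ns.1, ns') (Xs.1, Xs') (Zs.1, Zs'))).
Qed.

Lemma Delta_tail_lmx_val p p' j t s m (T : 'M[R[i]]_(p', p))
    (g : tailmap N p m (t :: s)) ns Xs Zs :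
  (j <= size s)%N ->
  DeltaT j (fun (ns : sizes (t :: s)) Xs Zs => lmx T (g ns Xs Zs)) Xs Zs =
  lmx T (DeltaT j g Xs Zs) :> 'M[N]_(p', lastsize m (s := t :: dup t s j) ns).
Proof.
elim: j t s m g ns Xs Zs => [|j IH] t [|t2 s] m g ns Xs Zs //= js.
- by rewrite lmxZr lmx_rmx.
- by rewrite lmxZr.
- exact: (IH t2 s ns.1 (fun ns' Xs' Zs' => g (ns.1, ns') (Xs.1, Xs') (Zs.1, Zs'))).
Qed.
End DeltaTail.

(** * Matrices over the ground field, and closure properties of multilinear maps *)

Lemma scmx_regular (C : comNzRingType) p q a (A : 'M[C^o]_(p, q)) :
  scmx a A = a *: (A : 'M[C]_(p, q)).
Proof. by apply/matrixP => i j; rewrite !mxE. Qed.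

Lemma rmx_regular (C : comNzRingType) p q r (A : 'M[C^o]_(p, q)) (T : 'M[C]_(q, r)) :
  rmx A T = (A : 'M[C]_(p, q)) *m T.
Proof.
by apply/matrixP => i j; rewrite !mxE; apply: eq_bigr => l _; rewrite mulrC.
Qed.

Section Multilinear.
Variables (R : realType) (N : admspace R).
Implicit Types (p q m : nat) (s : seq (slot R)).

Lemma multilinear_lin p p' q q' m s (ns : sizes s) (w : args m ns -> 'M[N]_(p, q))
    (h : 'M[N]_(p, q) -> 'M[N]_(p', q')) :
  (forall a x y, h (scmx a x + y) = scmx a (h x) + h y) ->
  multilinear w -> multilinear (fun Zs => h (w Zs)).
Proof.
move=> h_lin; elim: s m ns w => [|t s IH] m ns w //= [w1 w2]; split=> [a Z Z' Zs|Z].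
  by rewrite w1 h_lin.
exact: IH.
Qed.

Lemma multilinear0 p q m s (ns : sizes s) :
  multilinear (fun _ : args m ns => 0 : 'M[N]_(p, q)).
Proof.
elim: s m ns => [|t s IH] m ns //=; split=> [a Z Z' Zs|Z]; last exact: IH.
by rewrite scmx0r addr0.
Qed.

Lemma multilinearD p q m s (ns : sizes s) (w w' : args m ns -> 'M[N]_(p, q)) :
  multilinear w -> multilinear w' -> multilinear (fun Zs => w Zs + w' Zs).
Proof.
elim: s m ns w w' => [|t s IH] m ns w w' //= [w1 w2] [w1' w2'].
split=> [a Z Z' Zs|Z]; last exact: IH.
by rewrite w1 w1' scmxDr addrACA.
Qed.

Lemma multilinear_sum p q m s (ns : sizes s) I (r : seq I) (P : pred I)
    (w : I -> args m ns -> 'M[N]_(p, q)) :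
  (forall i, multilinear (w i)) ->
  multilinear (fun Zs => \sum_(i <- r | P i) w i Zs).
Proof.
move=> wM; elim: r => [|i r IH].
  by under eq_fun do rewrite big_nil; exact: multilinear0.
case Pi: (P i); under eq_fun do rewrite big_cons Pi.
  exact: multilinearD.
exact: IH.
Qed.

Lemma multilinear_tract p s (ns : sizes s) n' n (w : trow N p ns n')
    (T : 'M[R[i]]_(n', n)) :
  @multilinear R N p _ _ s ns w -> @multilinear R N p _ _ s ns (tract w T).
Proof.
case: s ns w => [|t s] ns w //= [w1 w2]; split=> [a Z Z' Zs|Z]; last exact: w2.
by rewrite lmx_linr w1.
Qed.

Lemma tract_lmx p p' s (ns : sizes s) n' n (A : 'M[R[i]]_(p', p)) (w : trow N p ns n')
    (T : 'M[R[i]]_(n', n)) :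
  tract (N := N) (p := p') (fun Zs => lmx A (w Zs)) T = fun Zs => lmx A (tract w T Zs).
Proof.
by case: s ns w => [|t s] ns w; apply/funext => Zs //=; rewrite lmx_rmx.
Qed.
End Multilinear.

(** * The head slot *)

Section Head.
Variables (R : realType) (s0 : slot R).
Implicit Types (s : seq (slot R)).

(** The head slot has no argument on its left. A left factor A on the value plays this role, as an
    argument over [R[i]^o]; condition (i) then has the form of (ii) and (iii), and the theory of one
    slot applies. The factor A = 1 recovers f. *)
Definition slotvh s (f : ncmap s0 s) (ns : sizes s) (Xs : points ns) m :
    srow (spt s0) R[i]^o m (trowmod (sarg s0) m ns) :=
  fun n X A Zs => lmx (A : 'M[R[i]]_(m, n)) (f n X ns Xs Zs).

Definition slotvh2 s (F : ncmap s0 (dupslot s0 :: s)) (ns : sizes s) (Xs : points ns)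
    m : srow2 (spt s0) R[i]^o m (trowmod (sarg s0) m ns) :=
  fun n1 n2 X1 X2 A W Zs =>
    lmx (A : 'M[R[i]]_(m, n1)) (F n1 X1 (n2, ns) (X2, Xs) (W, Zs)).

Arguments slotvh {s} f {ns} Xs m [n].
Arguments slotvh2 {s} F {ns} Xs m [n1 n2].

Definition hmulti s (f : ncmap s0 s) :=
  forall n0 (X0 : 'M[spt s0]_n0), sdom s0 _ X0 -> tmulti (f n0 X0).

Lemma hintw_slotvh s (f : ncmap s0 s) ns (Xs : points ns) m :
  intertwines_head f -> in_dom Xs -> sintw (sdom s0) (slotvh f Xs m).
Proof.
move=> f_int dXs n n' X X' T A dX dX' TX.
rewrite /ract /= /slotvh tract_lmx; apply/funext => Zs.
rewrite rmx_regular -lmxA; congr lmx.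
case: s f f_int ns Xs dXs Zs => [|t s] f f_int ns Xs dXs Zs.
  by case: ns Xs dXs Zs => -[] _ [] /=; apply: f_int.
exact: f_int.
Qed.

Lemma hmulti_slotvh s (f : ncmap s0 s) ns (Xs : points ns) m n (X : 'M[spt s0]_n) :
  hmulti f -> sdom s0 _ X -> in_dom Xs ->
  slinear (slotvh f Xs m X) /\ (forall A, rgood (slotvh f Xs m X A)).
Proof.
move=> fM dX dXs; split.
  by move=> a A A'; apply/funext => Zs; rewrite /slotvh scmx_regular lmx_linl.
move=> A; apply: multilinear_rgood.
apply: (multilinear_lin (h := lmx (A : 'M[R[i]]_(m, n)))); last exact: fM.
by move=> a x y; rewrite lmx_linr.
Qed.

Section HeadTwoSlots.
Variables (s : seq (slot R)) (F : ncmap s0 (dupslot s0 :: s)).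
Variables (ns : sizes s) (Xs : points ns) (m : nat).
Hypotheses (dXs : in_dom Xs) (F_multi : hmulti F).

Lemma hmulti_slotvh2 n1 n2 (X1 : 'M[spt s0]_n1) (X2 : 'M[spt s0]_n2) A :
  sdom s0 _ X1 -> sdom s0 _ X2 ->
  slinear (slotvh2 F Xs m X1 X2 A) /\
  (forall W, rgood (slotvh2 F Xs m X1 X2 A W)).
Proof.
move=> dX1 dX2.
have [F1 F2] := F_multi dX1
  (conj dX2 dXs : @in_dom R (dupslot s0 :: s) (n2, ns) (X2, Xs)).
split=> [a W W'|W].
  by apply/funext => Zs; rewrite /slotvh2 F1 lmx_linr.
apply: multilinear_rgood; apply: (multilinear_lin (h := lmx (A : 'M[R[i]]_(m, n1)))).
  by move=> a x y; rewrite lmx_linr.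
exact: F2.
Qed.

Lemma hintw_sintwl : intertwines_head F -> sintwl (sdom s0) (slotvh2 F Xs m).
Proof.
move=> F1 n n' n2 X X' X2 T A W dX dX' dX2 TX; apply/funext => Zs.
have dX2Xs : @in_dom R (dupslot s0 :: s) (n2, ns) (X2, Xs) by split.
by have /(congr1 (@^~ (W, Zs))) := hintw_slotvh F1 dX2Xs A dX dX' TX.
Qed.

Lemma hintw_sintwr :
  (forall n1 (X1 : 'M[spt s0]_n1), sdom s0 _ X1 -> intertwines_tail (@F n1 X1)) ->
  sintwr (sdom s0) (slotvh2 F Xs m).
Proof.
move=> F2 n1 n n' X1 X X' T A W dX1 dX dX' TX.
have e := tintw_slotv (F2 n1 X1 dX1) dXs W dX dX' TX.
rewrite /ract /= /slotvh2 tract_lmx; apply/funext => Zs.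
by congr lmx; exact: (congr1 (@^~ Zs) e).
Qed.
End HeadTwoSlots.

Definition ndiff j s : ncmap s0 s -> ncmap s0 (dup s0 s j) -> Prop :=
  match j return ncmap s0 s -> ncmap s0 (dup s0 s j) -> Prop with
  | 0%N => fun f F => forall ns (Xs : points ns) m, in_dom Xs ->
      sdiff (sdom s0) (slotvh f Xs m) (@slotvh2 s F ns Xs m)
  | j'.+1 =>
      match s return ncmap s0 s -> ncmap s0 (dup s0 s j'.+1) -> Prop with
      | [::] => fun _ _ => True
      | t :: s' => fun f F => forall n0 (X0 : 'M[spt s0]_n0), sdom s0 _ X0 ->
          tdiff (j := j') (f n0 X0) (F n0 X0)
      end
  end.

Lemma Delta_head0E s (f : ncmap s0 s) ns (Xs : points ns) m n1 n2
    (X1 : 'M[spt s0]_n1) (X2 : 'M[spt s0]_n2) A W :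
  slotvh2 (s := s) (Delta 0 f) Xs m X1 X2 A W =
  let r := block_radius (sdom s0) X1 X2 W in
  r^-1 *: ract (slotvh f Xs m (block_mx X1 (scmx r W) 0 X2)
                  (rmx A (prl_mx R[i] n1 n2))) (inr_mx R[i] n1 n2).
Proof.
cbv zeta; rewrite /ract /= /slotvh tract_lmx; apply/funext => Zs.
case: s f ns Xs Zs => [|t2 s] f ns Xs Zs.
  rewrite /slotvh2 /= rmx_regular lmxZr -lmxA.
  by case: ns Xs Zs => -[] [].
by rewrite /slotvh2 /= rmx_regular lmxZr lmxA lmx_inr.
Qed.

Lemma ndiff_Delta j s (f : ncmap s0 s) : nc_function f -> ndiff f (Delta j f).
Proof.
move=> [fM f_h f_t].
have {}fM : hmulti f by move=> n0 X0 dX0 ns X dX; apply: fM.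
case: j => [|j]; last first.
  case: s f fM f_h f_t => [|t s] f fM f_h f_t //= n0 X0 dX0.
  by apply: tdiff_Delta; [exact: fM | exact: f_t].
move=> ns Xs m dXs n1 n2 X1 X2 S A dX1 dX2; rewrite Delta_head0E; cbv zeta.
have [r0 dP] := block_radiusP (rmx X1 S - lmx S X2) dX1 dX2.
apply: (@sintw_diff _ _ _ (sdom s0) m _ (@slotvh s f ns Xs m)) => //.
- exact: hintw_slotvh.
- by move=> n X dX; have [] := hmulti_slotvh m fM dX dXs.
- by move=> n X Y dX; have [_] := hmulti_slotvh m fM dX dXs; apply.
Qed.

Lemma ndiff_Delta_eq j s (f : ncmap s0 s) F :
  (j <= size s)%N -> hmulti f -> ndiff f F -> nc_function F -> nc_eq (Delta j f) F.
Proof.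
move=> js fM fF [FM F_h F_t].
have {}FM : hmulti F by move=> n0 X0 dX0 ns X dX; apply: FM.
case: j js F fF FM F_h F_t => [|j] js F fF FM F_h F_t.
  move=> n1 X1 [n2 ns] [X2 Xs] [W Zs] dX1 [/= dX2 dXs].
  have [r0 dP] := block_radiusP W dX1 dX2.
  (* With the left factor 1, [slotvh2] is the function itself. *)
  have := Delta_head0E f Xs X1 X2 1%:M W; cbv zeta => e1.
  have := sdiff_block (fF ns Xs n1 dXs) (hintw_sintwl dXs F_h)
    (slinear0 (hmulti_slotvh n1 fM dX2 dXs).1)
    (slinearZ (hmulti_slotvh2 dXs FM (1%:M : 'M[R[i]^o]_n1) dX1 dX2).1 _ _) dX1 dX2 r0 dP.
  rewrite -e1 => /(congr1 (@^~ Zs)).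
  by rewrite /slotvh2 !lmx1.
case: s f fM js F fF FM F_h F_t => [|t s] f fM js F fF FM F_h F_t //.
move=> n0 X0 ns X Z dX0 dX.
apply: (tdiff_Delta_eq _ (fF n0 X0 dX0)) => //; [exact: fM|exact: FM|exact: F_t].
Qed.
End Head.
Arguments slotvh {R s0 s} f {ns} Xs m [n].
Arguments slotvh2 {R s0 s} F {ns} Xs m [n1 n2].

(** * Necessity of the closedness conditions *)

Section Closed.
Variables (R : realType) (N : admspace R).
Implicit Types (p m i j : nat) (t : slot R) (s : seq (slot R)).

Lemma tdiff_congr p j t s m (g : tailmap N p m (t :: s)) G G' :
  tdiff (j := j) g G -> teq G G' -> tdiff g G'.
Proof.
elim: j t s m g G G' => [|j IH] t s m g G G'.
  move=> gG GG' ns Xs dXs n1 n2 X1 X2 S Z dX1 dX2; rewrite (gG ns Xs) //.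
  apply/funext => Zs.
  exact: (GG' (n1, (n2, ns)) (X1, (X2, Xs)) (Z, (_, Zs)) (conj dX1 (conj dX2 dXs))).
case: s g G G' => [|t2 s] g G G' //= gG GG' n X Z dX.
apply: IH (gG n X Z dX) _ => ns Xs Zs dXs.
exact: (GG' (n, ns) (X, Xs) (Z, Zs) (conj dX dXs)).
Qed.

Definition tail_cast p m t s1 s2 (e : s1 = s2) (g : tailmap N p m (t :: s1)) :
    tailmap N p m (t :: s2) :=
  eq_rect s1 (fun u => tailmap N p m (t :: u)) g s2 e.

(** [dup_comm] is transparent and its inductive step is [f_equal (cons _)], so freezing the first
    slot peels one layer off the cast in the closedness condition. *)
Lemma tail_cast_cons p m t t2 s1 s2 (e : s1 = s2) (g : tailmap N p m [:: t, t2 & s1])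
    n (X : 'M[spt t]_n) Z :
  tailat (tail_cast (f_equal (cons t2) e) g) X Z = tail_cast e (tailat g X Z).
Proof. by case: _ / e. Qed.

Definition tclosed p i j t s m (le_ij : (i <= j)%N)
    (Fi : tailmap N p m (t :: dup t s i)) (Fj : tailmap N p m (t :: dup t s j)) :=
  teq (tail_cast (dup_comm t s le_ij) (DeltaT i Fj)) (DeltaT j.+1 Fi).

Lemma tclosed_tailat p i j t t2 s m (le_ij : (i.+1 <= j.+1)%N)
    (Fi : tailmap N p m (t :: dup t (t2 :: s) i.+1))
    (Fj : tailmap N p m (t :: dup t (t2 :: s) j.+1)) :
  tclosed le_ij Fi Fj <->
  forall n (X : 'M[spt t]_n) Z, sdom t _ X ->
    @tclosed p i j t2 s n le_ij (tailat Fi X Z) (tailat Fj X Z).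
Proof.
split=> [FF n X Z dX ns Xs Zs dXs | FF [n ns] [X Xs] [Z Zs] [dX dXs]].
  have := FF (n, ns) (X, Xs) (Z, Zs) (conj dX dXs).
  rewrite -[LHS]/(tailat _ X Z Xs Zs).
  by rewrite (tail_cast_cons (dup_comm t2 s (le_ij : (i <= j)%N))).
have := FF n X Z dX; rewrite /tclosed.
rewrite -(tail_cast_cons (dup_comm t2 s (le_ij : (i <= j)%N)) (DeltaT i.+1 Fj)).
by move=> /(_ ns Xs Zs dXs).
Qed.

(** There are three cases. For i = j = 0 the first or the second copy of one point is split again,
    and [sdiff_block_comm] compares the two. For i = 0 < j distinct slots are split, and the factors
    from slot 0 commute with the splitting of slot j. For 0 < i the first slot is frozen. *)
Lemma tclosed_Delta p i j t s m (le_ij : (i <= j)%N) (g : tailmap N p m (t :: s)) Fi Fj :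
  (j <= size s)%N -> tmulti g -> intertwines_tail g ->
  teq (DeltaT i g) Fi -> teq (DeltaT j g) Fj -> tmulti Fi -> intertwines_tail Fi ->
  tclosed le_ij Fi Fj.
Proof.
elim: i j t s m le_ij g Fi Fj => [|i IH] [|j] t s m le_ij g Fi Fj js gM g_int gi gj Fi_M Fi_int //.
- have gFi : tdiff g Fi by apply: tdiff_congr gi; apply: tdiff_Delta.
  (* Here i = j = 0, so [Fi] and [Fj] are both the difference of g in slot 0 and agree at points of
     the domains. *)
  have FF : teq Fj Fi by move=> ns X Z dX; rewrite -gi // -gj.
  rewrite /tclosed.
  move=> [n1 [n2 [n3 ns]]] [X1 [X2 [X3 Xs]]] [Z [W1 [W2 Zs]]] [dX1 [dX2 [dX3 dXs]]].
  have e0 := @Delta_tail_congr R N p 0 t (dupslot t :: s) m Fj Fi FF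
    (n1, (n2, (n3, ns))) (X1, (X2, (X3, Xs))) (Z, (W1, (W2, Zs)))
    (conj dX1 (conj dX2 (conj dX3 dXs))).
  rewrite [LHS]e0 {e0}.
  have [r0 dP] := block_radiusP W1 dX1 dX2.
  have [rho0 dQ] := block_radiusP W2 dX2 dX3.
  have /(congr1 (@^~ Zs)) := sdiff_block_comm Z (gFi ns Xs dXs)
    (tintw_sintwl dXs Fi_int) (tintw_sintwr dXs Fi_int)
    (fun n1 n2 X1 X2 Z d1 d2 => (tmulti_slotv2 dXs Fi_M Z d1 d2).1)
    (fun n X d => (tmulti_slotv gM d dXs).1)
    (fun n X Z d => (tmulti_slotv gM d dXs).2 Z)
    dX1 dX2 dX3 r0 rho0 dP dQ.
  have /(congr1 (@^~ (W2, Zs))) := Delta_tail0E (s := dupslot t :: s) Fi (X3, Xs) X1 X2 Z W1.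
  have /(congr1 (@^~ Zs)) := Delta_tail0E (tailat Fi X1 Z) Xs X2 X3 W1 W2.
  by move=> e2 e1 e3; exact: (etrans e1 (etrans e3 (esym e2))).
- case: s g Fi Fj js gM g_int gi gj Fi_M Fi_int => [|t2 s] g Fi Fj js gM g_int gi gj Fi_M Fi_int //.
  rewrite /tclosed.
  move=> [n1 [n2 ns]] [X1 [X2 Xs]] [Z [W Zs]] [dX1 [dX2 dXs]].
  have [r0 dP] := block_radiusP W dX1 dX2.
  have /(congr1 (@^~ Zs)) := Delta_tail0E Fj Xs X1 X2 Z W.
  move=> e; rewrite [LHS]e {e}.
  set r := block_radius _ _ _ _ in r0 dP *; set P := block_mx _ _ _ _ in dP *.
  have e1 := gj ((n1 + n2)%N, ns) (P, Xs)
    (rmx Z (prl_mx R[i] n1 n2), (lmx (inr_mx R[i] n1 n2) Zs.1, Zs.2)) (conj dP dXs).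
  transitivity (scmx r^-1 (DeltaT j (tailat g P (rmx Z (prl_mx R[i] n1 n2))) Xs
     (lmx (inr_mx R[i] n1 n2) Zs.1, Zs.2))).
    exact: (congr1 (scmx r^-1) (esym e1)).
  transitivity (DeltaT j (tailat (tailat Fi X1 Z) X2 W) Xs Zs); last by [].
  rewrite -(Delta_tail_lmx_arg (j := j)).
  refine (etrans (esym (@Delta_tail_scmx R N p j t2 s n2 r^-1
    (fun ns Xs Zs => tailat g P (rmx Z (prl_mx R[i] n1 n2)) Xs
       (lmx (inr_mx R[i] n1 n2) Zs.1, Zs.2)) ns Xs Zs js)) _).
  apply: (Delta_tail_congr (j := j)) => // ns' Xs' Zs' dXs'.
  have e2 := gi (n1, (n2, ns')) (X1, (X2, Xs')) (Z, (W, Zs')) (conj dX1 (conj dX2 dXs')).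
  have /(congr1 (@^~ Zs')) e3 := Delta_tail0E g Xs' X1 X2 Z W.
  exact: (etrans (esym e3) e2).
case: s g Fi Fj js gM g_int gi gj Fi_M Fi_int => [|t2 s] g Fi Fj js gM g_int gi gj Fi_M Fi_int //.
apply/tclosed_tailat => n X Z dX.
apply: (IH j t2 s n le_ij (tailat g X Z)) => //.
- exact: tmulti_tailat.
- exact: tintw_tailat.
- by move=> ns Xs Zs dXs; apply: (gi (n, ns) (X, Xs) (Z, Zs) (conj dX dXs)).
- by move=> ns Xs Zs dXs; apply: (gj (n, ns) (X, Xs) (Z, Zs) (conj dX dXs)).
- exact: tmulti_tailat.
- exact: tintw_tailat.
Qed.
End Closed.

Section HeadClosed.
Variables (R : realType) (s0 : slot R).
Implicit Types (s : seq (slot R)) (t : slot R).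

Lemma ndiff_congr j s (f : ncmap s0 s) F F' :
  ndiff (j := j) f F -> nc_eq F F' -> ndiff f F'.
Proof.
case: j F F' => [|j] F F'.
  move=> fF FF' ns Xs m dXs n1 n2 X1 X2 S A dX1 dX2; rewrite (fF ns Xs) //.
  apply/funext => Zs; congr lmx.
  exact: (FF' n1 X1 (n2, ns) (X2, Xs) (_, Zs) dX1 (conj dX2 dXs)).
case: s f F F' => [|t s] f F F' //= fF FF' n X dX.
apply: tdiff_congr (fF n X dX) _ => ns Xs Zs dXs.
exact: FF'.
Qed.

Lemma ncmap_cast_cons t s1 s2 (e : s1 = s2) (F : ncmap s0 (t :: s1)) n0
    (X0 : 'M[spt s0]_n0) :
  ncmap_cast (f_equal (cons t) e) F X0 = tail_cast e (F n0 X0).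
Proof. by case: _ / e. Qed.

Definition hclosed i j s (le_ij : (i <= j)%N) (Fi : ncmap s0 (dup s0 s i))
    (Fj : ncmap s0 (dup s0 s j)) :=
  nc_eq (ncmap_cast (dup_comm s0 s le_ij) (Delta i Fj)) (Delta j.+1 Fi).

Lemma hclosedP i j t s (le_ij : (i.+1 <= j.+1)%N)
    (Fi : ncmap s0 (dup s0 (t :: s) i.+1)) (Fj : ncmap s0 (dup s0 (t :: s) j.+1)) :
  hclosed le_ij Fi Fj <->
  forall n0 (X0 : 'M[spt s0]_n0), sdom s0 _ X0 ->
    @tclosed R (sarg s0) n0 i j t s n0 le_ij (Fi n0 X0) (Fj n0 X0).
Proof.
have e n0 (X0 : 'M[spt s0]_n0) :=
  ncmap_cast_cons (dup_comm t s (le_ij : (i <= j)%N)) (Delta i.+1 Fj) X0.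
split=> [FF n0 X0 dX0 ns Xs Zs dXs | FF n0 X0 ns Xs Zs dX0 dXs].
  have := FF n0 X0 ns Xs Zs dX0 dXs.
  by rewrite (e n0 X0).
rewrite (e n0 X0).
exact: (FF n0 X0 dX0 ns Xs Zs dXs).
Qed.

(** The same three cases as for tails, read with left factor 1 in the head slot. For i = 0 < j there
    is one more factor to move: prl on the value. *)
Lemma hclosed_Delta i j s (le_ij : (i <= j)%N) (f : ncmap s0 s) Fi Fj :
  (j <= size s)%N -> nc_function f ->
  nc_eq (Delta i f) Fi -> nc_eq (Delta j f) Fj -> nc_function Fi ->
  hclosed le_ij Fi Fj.
Proof.
move=> js f_nc gi gj; have [fM f_h f_t] := f_nc; move=> [Fi_M Fi_h Fi_t].
have {}fM : hmulti f by move=> n0 X0 dX0 ns X dX; apply: fM.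
have {}Fi_M : hmulti Fi by move=> n0 X0 dX0 ns X dX; apply: Fi_M.
case: i j le_ij js Fi Fj gi gj Fi_M Fi_h Fi_t => [|i] [|j] le_ij js Fi Fj gi gj Fi_M Fi_h Fi_t //.
- have fFi : ndiff f Fi := ndiff_congr (ndiff_Delta 0 f_nc) gi.
  move=> n1 X1 [n2 [n3 ns]] [X2 [X3 Xs]] [W1 [W2 Zs]] dX1 [dX2 [dX3 dXs]].
  have [r0 dP] := block_radiusP W1 dX1 dX2.
  have [rho0 dQ] := block_radiusP W2 dX2 dX3.
  have FF : slotvh2 (s := dupslot s0 :: s) (Delta_head Fj) (ns := (n3, ns)) (X3, Xs)
        n1 X1 X2 1%:M W1 (W2, Zs) =
      slotvh2 (s := dupslot s0 :: s) (Delta_head Fi) (ns := (n3, ns)) (X3, Xs)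
        n1 X1 X2 1%:M W1 (W2, Zs).
    rewrite /slotvh2 /=; congr (lmx _ (scmx _ (lmx _ _))).
    set P := block_mx _ _ _ _ in dP *.
    have dQ' : @in_dom R (dupslot s0 :: s) (n3, ns) (X3, Xs) by split.
    exact: etrans (esym (gj _ P _ (X3, Xs) (_, Zs) dP dQ')) (gi _ P _ (X3, Xs) (_, Zs) dP dQ').
  have /(congr1 (@^~ Zs)) := sdiff_block_comm (1%:M : 'M[R[i]^o]_n1) (fFi ns Xs n1 dXs)
    (hintw_sintwl dXs Fi_h) (hintw_sintwr dXs Fi_t)
    (fun n1 n2 X1 X2 Z d1 d2 => (hmulti_slotvh2 dXs Fi_M Z d1 d2).1)
    (fun n X d => (hmulti_slotvh n1 fM d dXs).1)
    (fun n X Z d => (hmulti_slotvh n1 fM d dXs).2 Z)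
    dX1 dX2 dX3 r0 rho0 dP dQ.
  have /(congr1 (@^~ (W2, Zs))) :=
    Delta_head0E (s := dupslot s0 :: s) Fi (X3, Xs) X1 X2 (1%:M : 'M[R[i]^o]_n1) W1.
  have /(congr1 (@^~ Zs)) := Delta_tail0E (Fi n1 X1) Xs X2 X3 W1 W2.
  move=> e2 e1 e3; move: FF; rewrite [X in _ = X]e1 => FF.
  have {e1 e3 FF} := etrans FF e3.
  rewrite /slotvh2 lmx1 => e4; refine (etrans e4 (etrans _ (esym e2))).
  by congr (scmx _ _); rewrite /ract /= tract_lmx lmx1.
- case: s f f_nc js f_h f_t fM Fi Fj gi gj Fi_M Fi_h Fi_t =>
    [|t2 s] f f_nc js f_h f_t fM Fi Fj gi gj Fi_M Fi_h Fi_t //.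
  move=> n1 X1 [n2 ns] [X2 Xs] [W Zs] dX1 [dX2 dXs].
  have [r0 dP] := block_radiusP W dX1 dX2.
  have e := Delta_head0E (s := t2 :: dup t2 s j) Fj Xs X1 X2 (1%:M : 'M[R[i]^o]_n1) W.
  have {}e := congr1 (@^~ Zs) e.
  refine (etrans (esym (lmx1 _)) (etrans e _)).
  move: e => _; cbv zeta; set r := block_radius _ _ _ _ in r0 dP *.
  set P := block_mx _ _ _ _ in dP *.
  have e1 := gj _ P ns Xs (lmx (inr_mx R[i] n1 n2) Zs.1, Zs.2) dP dXs.
  transitivity (scmx r^-1 (lmx (prl_mx R[i] n1 n2) (DeltaT j (f (n1 + n2)%N P) Xs
     (lmx (inr_mx R[i] n1 n2) Zs.1, Zs.2)))).
    refine (etrans _ (congr1 (scmx r^-1 \o lmx (prl_mx R[i] n1 n2)) (esym e1))).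
    by rewrite rmx_regular mul1mx.
  transitivity (DeltaT j (tailat (Fi n1 X1) X2 W) Xs Zs); last by [].
  rewrite -(Delta_tail_lmx_arg (j := j)).
  refine (etrans (congr1 (scmx r^-1) (esym (@Delta_tail_lmx_val R (sarg s0) _ n1 j t2 s
    n2 (prl_mx R[i] n1 n2) (fun ns Xs Zs => f (n1 + n2)%N P ns Xs
      (lmx (inr_mx R[i] n1 n2) Zs.1, Zs.2)) ns Xs Zs js))) _).
  refine (etrans (esym (@Delta_tail_scmx R (sarg s0) n1 j t2 s n2 r^-1
    (fun ns Xs Zs => lmx (prl_mx R[i] n1 n2) (f (n1 + n2)%N P ns Xs
       (lmx (inr_mx R[i] n1 n2) Zs.1, Zs.2))) ns Xs Zs js)) _).
  apply: (Delta_tail_congr (j := j)) => // ns' Xs' Zs' dXs'.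
  have e2 := gi n1 X1 (n2, ns') (X2, Xs') (W, Zs') dX1 (conj dX2 dXs').
  refine (etrans _ e2); rewrite /= -/r -/P.
  by rewrite lmx_inr.
case: s f f_nc js f_h f_t fM Fi Fj gi gj Fi_M Fi_h Fi_t =>
  [|t s] f f_nc js f_h f_t fM Fi Fj gi gj Fi_M Fi_h Fi_t //.
apply/hclosedP => n0 X0 dX0.
apply: (@tclosed_Delta R (sarg s0) n0 i j t s n0 le_ij (f n0 X0)) => //.
- exact: fM.
- exact: f_t.
- by move=> ns Xs Zs dXs; apply: (gi n0 X0 ns Xs Zs dX0 dXs).
- by move=> ns Xs Zs dXs; apply: (gj n0 X0 ns Xs Zs dX0 dXs).
- exact: Fi_M.
- exact: Fi_t.
Qed.
End HeadClosed.

(** * Integration *)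

Section OneSlotLinear.
Variables (C : fieldType) (V A : lmodType C) (m : nat) (E : rowmod C) (b : nat).
Variable Y : 'M[V]_b.+1.

(** Functions and arguments vary independently, so that linearity in F and linearity in Z are both
    instances. The same holds for [spread_lin]. *)
Lemma homotopy_lin a (F F' F'' : srow2 V A m E) n (X : 'M[V]_n) Z Z' Z'' :
  (forall W, F'' _ _ X Y Z'' W = a *: F _ _ X Y Z W + F' _ _ X Y Z' W) ->
  homotopy Y F'' X Z'' = a *: homotopy Y F X Z + homotopy Y F' X Z'.
Proof.
move=> FF; rewrite /homotopy scaler_sumr -big_split.
by apply: eq_bigr => c _; rewrite FF ract_linl.
Qed.

Lemma spread_lin a (K K' K'' : 'M[A]_(m, b.+1) -> E b.+1) n (Z Z' Z'' : 'M[A]_(m, n)) :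
  (forall T : 'M[C]_(n, b.+1),
     K'' (rmx Z'' T) = a *: K (rmx Z T) + K' (rmx Z' T)) ->
  spread K'' Z'' = a *: spread K Z + spread K' Z'.
Proof.
move=> KK; rewrite /spread scaler_sumr -big_split.
by apply: eq_bigr => c _; rewrite KK ract_linl.
Qed.
End OneSlotLinear.

Lemma trow_sumE (R : realType) (N : admspace R) p s (ns : sizes s) n I (r : seq I)
    (P : pred I) (g : I -> trowmod N p ns n) :
  \sum_(i <- r | P i) g i =
  (fun Zs => \sum_(i <- r | P i) (g i Zs : 'M[N]_(p, lastsize n ns))) :> trow N p ns n.
Proof. by apply/funext => Zs; elim/big_rec2: _ => //= i x y Pi <-. Qed.

Section Integral.
Variables (R : realType) (N : admspace R).
Implicit Types (p m i j : nat) (t : slot R) (s : seq (slot R)).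

(* A junk point when the domain is empty. *)
Definition basept (V : admspace R) (Om : open_ncset V) : {b : nat & 'M[V]_b.+1} :=
  if pselect (exists x : {b : nat & 'M[V]_b.+1}, Om _ (projT2 x)) is left ex
  then projT1 (cid ex) else existT _ 0%N (0 : 'M[V]_1).

(** A statement about values at domain points always supplies such an X, so the junk base point does
    no harm. *)
Lemma baseptP (V : admspace R) (Om : open_ncset V) n (X : 'M[V]_n) :
  Om _ X -> Om _ (projT2 (basept Om)).
Proof.
case: n X => [|n] X dX; first by have := ncdom_size dX.
rewrite /basept; case: pselect => [ex|[]]; first by case: cid.
by exists (existT _ n X).
Qed.

(** The sum of the overview in recursive form: f = h_0 F_0 + P_0 g, where g integrates the later F_j
    with the first slot frozen at Y. The inner match is written in place so that the recursive call
    is on a visible subterm of s; [tail_integral_rest] names it afterwards. *)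
Fixpoint tail_integral p m t s {struct s} :
    (forall j, tailmap N p m (t :: dup t s j)) -> tailmap N p m (t :: s) :=
  fun F n X Z =>
  let Y := projT2 (basept (sdom t)) in
  let K := match s return
      (forall j, tailmap N p m (t :: dup t s j)) -> forall ns : sizes s, points ns ->
      'M[sarg t]_(m, _) -> trowmod N p ns (projT1 (basept (sdom t))).+1 with
    | [::] => fun _ _ _ _ => 0
    | t2 :: s2 => fun F ns Xs Z' =>
        @tail_integral p _ t2 s2 (fun j => tailat (F j.+1) Y Z') ns Xs
    end F n.2 X.2 in
  (homotopy Y (@slotv2 R N p m t s (F 0%N) n.2 X.2) X.1 Z.1 + spread K Z.1) Z.2.

Definition tail_integral_rest p m t s : (forall j, tailmap N p m (t :: dup t s j)) ->
    forall ns : sizes s, points ns ->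
    'M[sarg t]_(m, _) -> trowmod N p ns (projT1 (basept (sdom t))).+1 :=
  match s return
    (forall j, tailmap N p m (t :: dup t s j)) -> forall ns : sizes s, points ns ->
    'M[sarg t]_(m, _) -> trowmod N p ns (projT1 (basept (sdom t))).+1 with
  | [::] => fun _ _ _ _ => 0
  | t2 :: s2 => fun F ns Xs Z' =>
      @tail_integral p _ t2 s2 (fun j => tailat (F j.+1) (projT2 (basept (sdom t))) Z') ns Xs
  end.

Lemma tail_integralE p m t s (F : forall j, tailmap N p m (t :: dup t s j)) ns (Xs : points ns)
    n (X : 'M[spt t]_n) Z :
  slotv (tail_integral F) Xs X Z =
  homotopy (projT2 (basept (sdom t))) (@slotv2 R N p m t s (F 0%N) ns Xs) X Z +
  spread (tail_integral_rest F Xs) Z.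
Proof. by case: s F ns Xs. Qed.

Lemma slotv2_lin p m t s a (F F' F'' : tailmap N p m [:: t, dupslot t & s])
    ns (Xs : points ns) n1 n2 (X1 : 'M[spt t]_n1) (X2 : 'M[spt t]_n2) Z :
  sdom t _ X1 -> sdom t _ X2 -> in_dom Xs ->
  teq F'' (fun ns X Z => scmx a (F ns X Z) + F' ns X Z) ->
  forall W, slotv2 F'' Xs X1 X2 Z W = a *: slotv2 F Xs X1 X2 Z W + slotv2 F' Xs X1 X2 Z W.
Proof.
move=> dX1 dX2 dXs FF W; apply/funext => Zs.
exact: (FF (n1, (n2, ns)) (X1, (X2, Xs)) (Z, (W, Zs)) (conj dX1 (conj dX2 dXs))).
Qed.

Lemma slotv2_linl p m t s (G : tailmap N p m [:: t, dupslot t & s]) ns (Xs : points ns)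
    n1 n2 (X1 : 'M[spt t]_n1) (X2 : 'M[spt t]_n2) a Z Z' W :
  tmulti G -> sdom t _ X1 -> sdom t _ X2 -> in_dom Xs ->
  slotv2 G Xs X1 X2 (scmx a Z + Z') W =
  a *: slotv2 G Xs X1 X2 Z W + slotv2 G Xs X1 X2 Z' W.
Proof.
move=> GM dX1 dX2 dXs; apply/funext => Zs.
by case: (GM (n1, (n2, ns)) (X1, (X2, Xs)) (conj dX1 (conj dX2 dXs))) => + _; apply.
Qed.

Lemma homotopy_slotv2_lin p m t s a (F F' F'' : tailmap N p m [:: t, dupslot t & s])
    ns (Xs : points ns) n b (X : 'M[spt t]_n) (Y : 'M[spt t]_b.+1) Z :
  sdom t _ X -> sdom t _ Y -> in_dom Xs ->
  teq F'' (fun ns X Z => scmx a (F ns X Z) + F' ns X Z) ->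
  homotopy Y (slotv2 F'' Xs) X Z =
  a *: homotopy Y (slotv2 F Xs) X Z + homotopy Y (slotv2 F' Xs) X Z.
Proof.
by move=> dX dY dXs FF; apply: homotopy_lin; apply: slotv2_lin.
Qed.

Lemma tail_integral_lin_step p m t s a (F F' F'' : forall j, tailmap N p m (t :: dup t s j)) :
  teq (F'' 0%N) (fun ns X Z => scmx a (F 0%N ns X Z) + F' 0%N ns X Z) ->
  (forall n (X : 'M[spt t]_n) ns (Xs : points ns), sdom t _ X -> in_dom Xs -> forall Z,
     tail_integral_rest F'' Xs Z = a *: tail_integral_rest F Xs Z + tail_integral_rest F' Xs Z) ->
  teq (tail_integral F'') (fun ns X Z => scmx a (tail_integral F X Z) + tail_integral F' X Z).
Proof.
move=> FF0 FFr [n ns] [X Xs] [Z Zs] [dX dXs].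
have e1 := homotopy_slotv2_lin Z dX (baseptP dX) dXs FF0.
have e2 : spread (tail_integral_rest F'' Xs) Z =
    a *: spread (tail_integral_rest F Xs) Z + spread (tail_integral_rest F' Xs) Z.
  by apply: spread_lin => T; apply: (FFr n X).
have := congr2 +%R e1 e2; rewrite -tail_integralE addrACA -scalerDr -!tail_integralE.
exact: (congr1 (@^~ Zs)).
Qed.

(** Linearity in the family. The argument Z' of a frozen slot enters the recursive call through the
    family, so this is what makes the integral linear in its arguments. *)
Lemma tail_integral_lin p m t s a (F F' F'' : forall j, tailmap N p m (t :: dup t s j)) :
  (forall j, (j <= size s)%N ->
     teq (F'' j) (fun ns X Z => scmx a (F j ns X Z) + F' j ns X Z)) ->
  teq (tail_integral F'') (fun ns X Z => scmx a (tail_integral F X Z) + tail_integral F' X Z).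
Proof.
elim: s m t F F' F'' => [|t2 s IH] m t F F' F'' FF;
  apply: tail_integral_lin_step (FF 0%N isT) _ => n X ns Xs dX dXs Z.
  by rewrite scaler0 addr0.
have dY := baseptP dX.
apply/funext => Zs; apply: IH => // j js ns' Xs' Zs' dXs'.
exact: (FF j.+1 js (_, ns') (_, Xs') (_, Zs') (conj dY dXs')).
Qed.

Section Closed.
Variables (p : nat).

Record closed_family m t s (F : forall j, tailmap N p m (t :: dup t s j)) : Prop := {
  cf_multi : forall j, (j <= size s)%N -> tmulti (F j);
  cf_intw : forall j, (j <= size s)%N -> intertwines_tail (F j);
  cf_closed : forall i j (le_ij : (i <= j)%N), (j <= size s)%N ->
    tclosed le_ij (F i) (F j)
}.

Lemma closed_family_tailat m t t2 s (F : forall j, tailmap N p m (t :: dup t (t2 :: s) j))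
    n (X : 'M[spt t]_n) Z :
  closed_family F -> sdom t _ X -> closed_family (fun j => tailat (F j.+1) X Z).
Proof.
move=> [FM Fi Fc] dX; split=> [j js|j js|i j le_ij js].
- by apply: tmulti_tailat => //; exact: (FM j.+1 js).
- by apply: tintw_tailat => //; exact: (Fi j.+1 js).
by have /tclosed_tailat := Fc i.+1 j.+1 le_ij js; apply.
Qed.

Lemma homotopy_multilinear m t s (F : tailmap N p m [:: t, dupslot t & s])
    ns (Xs : points ns) n (X : 'M[spt t]_n) Z b (Y : 'M[spt t]_b.+1) :
  tmulti F -> sdom t _ X -> sdom t _ Y -> in_dom Xs ->
  multilinear (homotopy Y (slotv2 F Xs) X Z : args n ns -> 'M[N]_(p, lastsize n ns)).
Proof.
move=> FM dX dY dXs; rewrite /homotopy trow_sumE.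
apply: multilinear_sum => a; apply: multilinear_tract.
by have [_ /(_ Z) [_]] := FM (n, (b.+1, ns)) (X, (Y, Xs)) (conj dX (conj dY dXs)); apply.
Qed.

Lemma tail_integral_multi_step m t s (F : forall j, tailmap N p m (t :: dup t s j)) :
  tmulti (F 0%N) ->
  (forall n (X : 'M[spt t]_n) ns (Xs : points ns), sdom t _ X -> in_dom Xs ->
     slinear (tail_integral_rest F Xs) /\
     forall Z, multilinear (tail_integral_rest F Xs Z : args _ ns -> 'M[N]_(p, lastsize _ ns))) ->
  tmulti (tail_integral F).
Proof.
move=> F0 Fr [n ns] [X Xs] [dX dXs]; have dY := baseptP dX.
have [F1 F2] := Fr n X ns Xs dX dXs; split=> [a Z Z' Zs|Z].
  have : slotv (tail_integral F) Xs X (scmx a Z + Z') =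
      a *: slotv (tail_integral F) Xs X Z + slotv (tail_integral F) Xs X Z'.
    rewrite !tail_integralE scalerDr addrACA; congr (_ + _).
      by apply: homotopy_lin => W; apply: slotv2_linl.
    by apply: spread_lin => T; rewrite rmx_linl F1.
  exact: (congr1 (@^~ Zs)).
rewrite -[X in multilinear X]/(slotv (tail_integral F) Xs X Z) tail_integralE.
apply: multilinearD; first exact: homotopy_multilinear.
rewrite /spread trow_sumE.
by apply: multilinear_sum => a; apply: multilinear_tract.
Qed.

Lemma tail_integral_multi m t s (F : forall j, tailmap N p m (t :: dup t s j)) :
  (forall j, (j <= size s)%N -> tmulti (F j)) -> tmulti (tail_integral F).
Proof.
elim: s m t F => [|t2 s IH] m t F FM; apply: (tail_integral_multi_step (FM 0%N isT)) =>
  n X ns Xs dX dXs.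
  by split=> [a Z Z'|Z]; [rewrite scaler0 addr0 | exact: multilinear0].
have dY := baseptP dX.
split=> [a Z Z'|Z].
  apply/funext => Zs; apply: tail_integral_lin => // j js ns' Xs' Zs' dXs'.
  have [+ _] := FM j.+1 js (_, ns') (_, Xs') (conj dY dXs').
  exact.
apply: IH => // j js; apply: tmulti_tailat => //; exact: (FM j.+1 js).
Qed.

Lemma tail_integral_rest_multi m t s (F : forall j, tailmap N p m (t :: dup t s j)) :
  (forall j, (j <= size s)%N -> tmulti (F j)) ->
  forall n (X : 'M[spt t]_n) ns (Xs : points ns), sdom t _ X -> in_dom Xs ->
  slinear (tail_integral_rest F Xs) /\
  forall Z, multilinear (tail_integral_rest F Xs Z : args _ ns -> 'M[N]_(p, lastsize _ ns)).
Proof.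
case: s F => [|t2 s] F FM n X ns Xs dX dXs.
  by split=> [a Z Z'|Z]; [rewrite scaler0 addr0 | exact: multilinear0].
have dY := baseptP dX.
split=> [a Z Z'|Z].
  apply/funext => Zs; apply: tail_integral_lin => // j js ns' Xs' Zs' dXs'.
  have [+ _] := FM j.+1 js (_, ns') (_, Xs') (conj dY dXs').
  exact.
apply: tail_integral_multi => // j js; apply: tmulti_tailat => //; exact: (FM j.+1 js).
Qed.
End Closed.
End Integral.

(** * Linearity of the difference formula *)

Section TdiffLinear.
Variables (R : realType) (N : admspace R).
Implicit Types (p m i j : nat) (t : slot R) (s : seq (slot R)).

Lemma tdiffD p j t s m (g g' : tailmap N p m (t :: s)) G G' :
  tdiff (j := j) g G -> tdiff g' G' ->
  tdiff (j := j) (fun ns X Z => g ns X Z + g' ns X Z) (fun ns X Z => G ns X Z + G' ns X Z).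
Proof.
elim: j t s m g g' G G' => [|j IH] t s m g g' G G'.
  move=> gG gG' ns Xs dXs n1 n2 X1 X2 S Z dX1 dX2.
  have := congr2 +%R (gG ns Xs dXs _ _ X1 X2 S Z dX1 dX2)
    (gG' ns Xs dXs _ _ X1 X2 S Z dX1 dX2).
  by rewrite addrACA -opprD -ractDl.
case: s g g' G G' => [|t2 s] g g' G G' //= gG gG' n X Z dX.
exact: (IH _ _ _ _ _ _ _ (gG n X Z dX) (gG' n X Z dX)).
Qed.

Lemma tdiff0 p j t s m :
  tdiff (j := j) (fun (ns : sizes (t :: s)) X (Z : args m ns) => 0 : 'M[N]_(p, _))
   (fun ns X Z => 0).
Proof.
elim: j t s m => [|j IH] t s m.
  move=> ns Xs dXs n1 n2 X1 X2 S Z dX1 dX2.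
  have e : ract (0 : trowmod N p ns n1) S - 0 = 0 by rewrite ract0l subr0.
  exact: e.
by case: s => [|t2 s] //= n X Z dX; apply: IH.
Qed.

Lemma tdiff_sum p j t s m (I : Type) (r : seq I) (g : I -> tailmap N p m (t :: s))
    (G : I -> tailmap N p m (t :: dup t s j)) :
  (forall c : I, tdiff (j := j) (g c) (G c)) ->
  tdiff (j := j) (fun ns X Z => \sum_(c <- r) g c ns X Z)
    (fun ns X Z => \sum_(c <- r) G c ns X Z).
Proof.
(* [tailmap] is a dependent function type with no sum of its own, so the pointwise sum is rewritten
   as an iterated pointwise addition, to which [tdiffD] applies. *)
have sumE s' (h : I -> tailmap N p m s') r' :
    (fun ns X Z => \sum_(c <- r') h c ns X Z) =
    foldr (fun c (h' : tailmap N p m s') ns X Z => h c ns X Z + h' ns X Z)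
      (fun ns X Z => 0) r'.
  elim: r' => [|c r' IH] /=; last rewrite -IH.
    by apply/functional_extensionality_dep => ns; apply/funext => X;
      apply/funext => Z; rewrite big_nil.
  by apply/functional_extensionality_dep => ns; apply/funext => X;
    apply/funext => Z; rewrite big_cons.
move=> gG; rewrite !sumE; elim: r => [|c r IH] /=; first exact: tdiff0.
exact: tdiffD.
Qed.

Lemma tdiff_arg p j t s m m' (T : 'M[R[i]]_(m', m)) (g : tailmap N p m' (t :: s)) G :
  tdiff (j := j) g G ->
  tdiff (j := j) (m := m) (fun ns X Z => g ns X (lmx T Z.1, Z.2))
    (fun ns X Z => G ns X (lmx T Z.1, Z.2)).
Proof.
case: j G => [|j] G.
  move=> gG ns Xs dXs n1 n2 X1 X2 S Z dX1 dX2.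
  have := gG ns Xs dXs n1 n2 X1 X2 S (lmx T Z) dX1 dX2.
  by rewrite -lmx_rmx.
by case: s g G => [|t2 s] g G //= gG n X Z dX; exact: (gG n X (lmx T Z) dX).
Qed.
End TdiffLinear.

(** * Difference formulas for the integral of a closed family of tails *)

Section Integration.
Variables (R : realType) (N : admspace R) (p : nat).
Implicit Types (m i j : nat) (t : slot R) (s : seq (slot R)).

Lemma tail_integral_tdiff0 m t s (F : forall j, tailmap N p m (t :: dup t s j)) :
  closed_family F -> tdiff (j := 0) (tail_integral F) (F 0%N).
Proof.
move=> [FM Fi Fc] ns Xs dXs n1 n2 X1 X2 S Z dX1 dX2.
have dY := baseptP dX1.
have [K1 K2] := tail_integral_rest_multi FM dX1 dXs.
rewrite !tail_integralE ractDl opprD addrACA spread_natural //; last first.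
  by move=> Z'; apply: multilinear_rgood; apply: K2.
rewrite subrr addr0.
pose F0 : tailmap N p m [:: t, dupslot t & s] := F 0%N.
have F0M : tmulti F0 := FM 0%N isT.
have F0i : intertwines_tail F0 := Fi 0%N isT.
(* By closedness for i = j = 0, the splittings of either copy of the point give the same G; these
   are the two hypotheses of the one-variable lemma. *)
pose G : tailmap N p m [:: t, dupslot t, dupslot t & s] := DeltaT 1 F0.
have G0 : tdiff (j := 0) F0 G.
  have E : teq (DeltaT 0 F0) G := Fc 0%N 0%N isT isT.
  exact: tdiff_congr (tdiff_Delta 0 F0M F0i) E.
have G1 : tdiff (j := 1) F0 G by exact: (tdiff_Delta 1 F0M F0i).
suff h : sdiff (sdom t) (homotopy (projT2 (basept (sdom t))) (slotv2 F0 Xs)) (slotv2 F0 Xs).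
  exact: h.
clear n1 n2 X1 X2 S Z dX1 dX2 K1 K2.
apply: (@sdiff_homotopy _ _ _ (sdom t) m (trowmod N p ns) _ _ (slotv2 F0 Xs)
  (fun n1 n2 n3 X1 X2 X3 Z W1 W2 Zs =>
   G (n1, (n2, (n3, ns))) (X1, (X2, (X3, Xs))) (Z, (W1, (W2, Zs))))) => //.
- by move=> n1 n2 X1 X2 Z' d1 d2; have [] := tmulti_slotv2 dXs F0M Z' d1 d2.
- by move=> n1 n2 X1 X2 Z' W d1 d2; have [_] := tmulti_slotv2 dXs F0M Z' d1 d2; apply.
- move=> n1 n2 n3 X1 X2 X3 S' Z' W d1 d2 d3; apply/funext => Zs.
  have := G0 (n3, ns) (X3, Xs) (conj d3 dXs) _ _ X1 X2 S' Z' d1 d2.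
  by move=> /(congr1 (@^~ (W, Zs))).
- move=> n1 n2 n3 X1 X2 X3 S' Z' W d1 d2 d3.
  exact: (G1 n1 X1 Z' d1 ns Xs dXs _ _ X2 X3 S' W d2 d3).
Qed.

(** Let i > 0 be a later slot. The difference of h_0 F_0 in slot i is h_0 G, where G is the
    difference of F_0 there. By closedness G is also the difference of F_i in slot 0, so h_0 G = F_i
    - P_0 F_i. By induction the part P_0 g contributes the missing P_0 F_i. *)
Lemma tail_integral_tdiff m t s (F : forall j, tailmap N p m (t :: dup t s j)) j :
  (j <= size s)%N -> closed_family F -> tdiff (j := j) (tail_integral F) (F j).
Proof.
elim: j m t s F => [|j IH] m t [|t2 s] F js Fcf //; try exact: tail_integral_tdiff0.
have [FM Fi Fc] := Fcf.
move=> n X Z dX; have dY := baseptP dX.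
set Y := projT2 _ in dY; set b := projT1 _ in Y dY.
pose F0 : tailmap N p m [:: t, dupslot t, t2 & s] := F 0%N.
pose Fj : tailmap N p m [:: t, t2 & dup t2 s j] := F j.+1.
(* The doubled slot 0 of F_0 shifts the later slots by one: slot [j.+1] of the family is slot [j.+2]
   of F_0. *)
pose G : tailmap N p m [:: t, dupslot t, t2 & dup t2 s j] := DeltaT j.+2 F0.
have G0 : tdiff (j := 0) Fj G.
  have E : teq (DeltaT 0 Fj) G := Fc 0%N j.+1 isT js.
  exact: tdiff_congr (tdiff_Delta 0 (FM j.+1 js) (Fi j.+1 js)) E.
have G1 : tdiff (j := j.+2) F0 G by exact: (tdiff_Delta j.+2 (FM 0%N isT) (Fi 0%N isT)).
(* H is h_0 G + P_0 F_i written out, in the shape of the integral below, so that the difference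
   formula can be checked term by term. *)
pose H : tailmap N p n (t2 :: dup t2 s j) := fun ns Xs Zs =>
  \sum_(a < n) tailat (tailat G X Z) Y (rmx X (colsel R[i] b a) - lmx (colsel R[i] b a) Y)
     Xs (lmx (rowsel R[i] b a) Zs.1, Zs.2) +
  \sum_(a < n) tailat Fj Y (rmx Z (colsel R[i] b a)) Xs (lmx (rowsel R[i] b a) Zs.1, Zs.2).
have HF : teq H (tailat Fj X Z).
  move=> ns Xs Zs dXs.
  have e := homotopy_sdiff dY (G0 ns Xs dXs) dX
    ((tmulti_slotv (FM j.+1 js) dX dXs).2 Z).
  have := congr1 (@^~ Zs) (esym (subrK (spread (slotv Fj Xs Y) Z) (slotv Fj Xs X Z))).
  rewrite -e /homotopy /spread !trow_sumE => e'.
  exact: (esym e').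
have -> : tailat (tail_integral F) X Z = fun ns Xs Zs =>
  \sum_(a < n) tailat (tailat F0 X Z) Y (rmx X (colsel R[i] b a) - lmx (colsel R[i] b a) Y)
     Xs (lmx (rowsel R[i] b a) Zs.1, Zs.2) +
  \sum_(a < n) tail_integral (fun j => tailat (F j.+1) Y (rmx Z (colsel R[i] b a)))
      Xs (lmx (rowsel R[i] b a) Zs.1, Zs.2).
  apply/functional_extensionality_dep => ns; apply/funext => Xs; apply/funext => Zs.
  have := congr1 (@^~ Zs) (tail_integralE F Xs X Z).
  rewrite /homotopy /spread !trow_sumE.
  exact.
apply: tdiff_congr HF; apply: tdiffD; apply: tdiff_sum => a.
  apply: (@tdiff_arg _ _ p j t2 s n b.+1 _ _ (tailat (tailat G X Z) Y _)).
  exact: (G1 n X Z dX b.+1 Y _ dY).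
apply: (@tdiff_arg _ _ p j t2 s n b.+1 _ _ (tailat Fj Y (rmx Z (colsel R[i] b a)))).
apply: (IH _ _ _ (fun j => tailat (F j.+1) Y (rmx Z (colsel R[i] b a)))) => //.
exact: closed_family_tailat.
Qed.
End Integration.

(** * From difference formulas to intertwinings *)

Section DiffNc.
Variables (R : realType).
Implicit Types (p m i j : nat) (t : slot R) (s : seq (slot R)).

Lemma tdiff_tintw (N : admspace R) p m t s (g : tailmap N p m (t :: s))
    (G : forall j, tailmap N p m (t :: dup t s j)) :
  (forall j, (j <= size s)%N -> tdiff (j := j) g (G j)) ->
  (forall j, (j <= size s)%N -> tmulti (G j)) -> intertwines_tail g.
Proof.
elim: s m t g G => [|t2 s IH] m t g G gG GM; apply/tintwP; split.
- move=> ns Xs dXs; apply: sdiff_sintw (gG 0%N isT ns Xs dXs) _ => n1 n2 X1 X2 Z d1 d2.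
  exact: slinear0 (tmulti_slotv2 dXs (GM 0%N isT) Z d1 d2).1.
- by [].
- move=> ns Xs dXs; apply: sdiff_sintw (gG 0%N isT ns Xs dXs) _ => n1 n2 X1 X2 Z d1 d2.
  exact: slinear0 (tmulti_slotv2 dXs (GM 0%N isT) Z d1 d2).1.
move=> n X Z dX; apply: (IH n t2 (tailat g X Z) (fun j => tailat (G j.+1) X Z)) => j js.
  exact: (gG j.+1 js n X Z dX).
by apply: tmulti_tailat => //; exact: (GM j.+1 js).
Qed.

Variable s0 : slot R.

Lemma hdiff_intw s (f : ncmap s0 s) F :
  ndiff (j := 0) f F -> hmulti F -> intertwines_head f.
Proof.
move=> fF FM.
have f_int ns (Xs : points ns) (dXs : in_dom Xs) n n' (X : 'M[spt s0]_n) (X' : 'M[spt s0]_n')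
    (T : 'M[R[i]]_(n', n))
    (dX : sdom s0 _ X) (dX' : sdom s0 _ X') (TX : lmx T X = rmx X' T) :
    (fun Zs => lmx T (f n X ns Xs Zs)) = tract (f n' X' ns Xs) T.
  have := sdiff_sintw (fF ns Xs n' dXs) _ (1%:M : 'M[R[i]^o]_n') dX dX' TX.
  rewrite /ract /= /slotvh tract_lmx rmx_regular mul1mx => ->.
    by apply/funext => Zs; rewrite lmx1.
  move=> n1 n2 X1 X2 A d1 d2.
  exact: slinear0 (hmulti_slotvh2 dXs FM A d1 d2).1.
case: s f F fF FM f_int => [|t s] f F fF FM f_int.
  move=> n n' X X' T dX dX' TX.
  exact: (congr1 (@^~ tt) (f_int tt tt I n n' X X' T dX dX' TX)).
move=> n n' X X' T ns Xs Zs dX dX' dXs TX.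
exact: (congr1 (@^~ Zs) (f_int ns Xs dXs n n' X X' T dX dX' TX)).
Qed.

Lemma ndiff_nc s (f : ncmap s0 s) (F : forall j, ncmap s0 (dup s0 s j)) :
  hmulti f -> (forall j, (j <= size s)%N -> ndiff (j := j) f (F j)) ->
  (forall j, (j <= size s)%N -> hmulti (F j)) -> nc_function f.
Proof.
move=> fM fF FM; split.
- by move=> n0 X0 ns X dX0; apply: fM.
- exact: hdiff_intw (fF 0%N isT) (FM 0%N isT).
move=> n0 X0 dX0; case: s f F fM fF FM => [|t s] f F fM fF FM //.
apply: (tdiff_tintw (G := fun j => F j.+1 n0 X0)) => j js.
  exact: (fF j.+1 js n0 X0 dX0).
exact: (FM j.+1 js n0 X0 dX0).
Qed.
End DiffNc.

(** * Integration with the head slot *)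

Section HeadIntegral.
Variables (R : realType) (s0 : slot R).
Implicit Types (p m i j : nat) (t : slot R) (s : seq (slot R)).

Lemma tdiff_lmx (N : admspace R) p p' j t s m (A : 'M[R[i]]_(p', p))
    (g : tailmap N p m (t :: s)) G :
  tdiff (j := j) g G ->
  tdiff (N := N) (p := p') (j := j) (fun ns X Z => lmx A (g ns X Z))
    (fun ns X Z => lmx A (G ns X Z)).
Proof.
elim: j t s m g G => [|j IH] t s m g G.
  move=> gG ns Xs dXs n1 n2 X1 X2 S Z dX1 dX2; apply/funext => Zs.
  have e := congr1 (@^~ Zs) (gG ns Xs dXs _ _ X1 X2 S Z dX1 dX2).
  have e' := congr1 (@^~ Zs) (tract_lmx A (slotv g Xs X1 Z) S).
  refine (etrans (congr1 (fun x => x - lmx A (slotv g Xs X2 (rmx Z S) Zs)) e') _).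
  by rewrite -lmxBr; exact: (congr1 (lmx A) e).
case: s g G => [|t2 s] g G //= gG n X Z dX.
exact: (IH _ _ _ _ _ (gG n X Z dX)).
Qed.

Section HintDef.
Variables (t2 : slot R) (s2 : seq (slot R)).
Local Notation s := (t2 :: s2).

Let Y := projT2 (basept (sdom s0)).
Let b := projT1 (basept (sdom s0)).

Definition nc_integral_rest (F : forall j, ncmap s0 (dup s0 s j)) m (ns : sizes s)
    (Xs : points ns) (A : 'M[R[i]^o]_(m, b.+1)) :
    trowmod (sarg s0) m ns b.+1 :=
  fun Zs => lmx (A : 'M[R[i]]_(m, b.+1))
    (@tail_integral R (sarg s0) b.+1 b.+1 t2 s2 (fun j => F j.+1 b.+1 Y) ns Xs Zs).

(** One more step of the recursion of [tail_integral], for the head slot, at the left factor A = 1.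
    Left multiplication commutes with h and P, which is why [nc_integralE] recovers the formula for
    every A. *)
Definition nc_integral (F : forall j, ncmap s0 (dup s0 s j)) : ncmap s0 s := fun n0 X0 ns Xs Zs =>
  (homotopy Y (slotvh2 (s := s) (F 0%N) Xs n0) X0 1%:M + spread (nc_integral_rest F Xs) 1%:M) Zs.

Lemma nc_integralE (F : forall j, ncmap s0 (dup s0 s j)) ns (Xs : points ns) m n
    (X : 'M[spt s0]_n) A :
  slotvh (nc_integral F) Xs m X A =
  homotopy Y (slotvh2 (s := s) (F 0%N) Xs m) X A + spread (nc_integral_rest F Xs) A.
Proof.
apply/funext => Zs.
rewrite /slotvh /nc_integral /homotopy /spread !trow_sumE.
transitivity ((\sum_(a < n) ract (slotvh2 (s := s) (F 0%N) Xs m X Y A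
    (rmx X (colsel R[i] b a) - lmx (colsel R[i] b a) Y)) (rowsel R[i] b a) Zs : 'M[sarg s0]_(m, _)) +
  (\sum_(a < n) ract (nc_integral_rest F Xs (rmx A (colsel R[i] b a))) (rowsel R[i] b a) Zs)); last by [].
refine (etrans (lmxDr _ _ _) _); rewrite !lmx_sumr.
congr (_ + _); apply: eq_bigr => a _.
  by rewrite /ract /= /slotvh2 !lmx1.
by rewrite /ract /= /nc_integral_rest lmxA !rmx_regular mul1mx.
Qed.
End HintDef.
End HeadIntegral.

Section HeadIntegration.
Variables (R : realType) (s0 t2 : slot R) (s2 : seq (slot R)).
Local Notation s := (t2 :: s2).
Variable F : forall j, ncmap s0 (dup s0 s j).
Hypothesis F_nc : forall j, (j <= size s)%N -> nc_function (@F j).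
Hypothesis F_closed : forall i j (le_ij : (i <= j)%N), (j <= size s)%N ->
  hclosed le_ij (@F i) (@F j).

Let Y := projT2 (basept (sdom s0)).
Let b := projT1 (basept (sdom s0)).
Let F0 : ncmap s0 (dupslot s0 :: s) := @F 0%N.

Lemma family_hmulti j : (j <= size s)%N -> hmulti (@F j).
Proof. by move=> /F_nc[FM _ _] n0 X0 dX0 ns X dX; apply: FM. Qed.

Lemma closed_family_head n0 (X0 : 'M[spt s0]_n0) : sdom s0 _ X0 ->
  @closed_family R (sarg s0) n0 n0 t2 s2 (fun j => @F j.+1 n0 X0).
Proof.
move=> dX0; split=> [j js|j js|i j le_ij js].
- exact: (@family_hmulti j.+1 js n0 X0 dX0).
- by have [_ _] := @F_nc j.+1 js; apply.
by have /hclosedP := @F_closed i.+1 j.+1 le_ij js; apply.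
Qed.

Lemma nc_integral_rest_multi m ns (Xs : points ns) : sdom s0 _ Y -> in_dom Xs ->
  slinear (nc_integral_rest F Xs (m := m)) /\
  forall A, multilinear (nc_integral_rest F Xs A : args _ ns -> 'M[sarg s0]_(m, lastsize _ ns)).
Proof.
move=> dY dXs; have [FM _ _] := closed_family_head dY; split=> [a A A'|A].
  by apply/funext => Zs; rewrite /nc_integral_rest scmx_regular lmx_linl.
apply: (multilinear_lin (h := lmx (A : 'M[R[i]]_(m, b.+1)))).
  by move=> a x y; rewrite lmx_linr.
exact: tail_integral_multi.
Qed.

Lemma nc_integral_multi : hmulti (nc_integral F).
Proof.
move=> n0 X0 dX0 ns Xs dXs; have dY : sdom s0 _ Y := baseptP dX0.
have [K1 K2] := nc_integral_rest_multi n0 dY dXs.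
have F0M : hmulti F0 := @family_hmulti 0%N isT.
apply: multilinearD.
  rewrite /homotopy trow_sumE; apply: multilinear_sum => a; apply: multilinear_tract.
  apply: (multilinear_lin (h := lmx (1%:M : 'M[R[i]]_n0))).
    by move=> c x y; rewrite lmx_linr.
  by have [_] := F0M n0 X0 dX0 (b.+1, ns) (Y, Xs) (conj dY dXs); apply.
by rewrite /spread trow_sumE; apply: multilinear_sum => a; apply: multilinear_tract.
Qed.

Lemma nc_integral_diff0 : ndiff (j := 0) (nc_integral F) F0.
Proof.
move=> ns Xs m dXs n1 n2 X1 X2 S A dX1 dX2.
have dY : sdom s0 _ Y := baseptP dX1.
have [K1 K2] := nc_integral_rest_multi m dY dXs.
rewrite !nc_integralE ractDl opprD addrACA spread_natural //; last first.
  by move=> Z'; apply: multilinear_rgood; apply: K2.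
rewrite subrr addr0.
have F0_nc : nc_function F0 := @F_nc 0%N isT.
have F0M : hmulti F0 := @family_hmulti 0%N isT.
pose G : ncmap s0 [:: dupslot s0, dupslot s0 & s] := Delta 1 F0.
have G0 : ndiff (j := 0) F0 G.
  have E : nc_eq (Delta 0 F0) G := @F_closed 0%N 0%N isT isT.
  exact: ndiff_congr (ndiff_Delta 0 F0_nc) E.
have G1 : ndiff (j := 1) F0 G by exact: (ndiff_Delta 1 F0_nc).
suff h : sdiff (sdom s0) (homotopy Y (slotvh2 F0 Xs m)) (slotvh2 F0 Xs m) by exact: h.
clear n1 n2 X1 X2 S A dX1 dX2 K1 K2.
apply: (@sdiff_homotopy _ _ _ (sdom s0) m (trowmod (sarg s0) m ns) _ _ (slotvh2 F0 Xs m)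
  (fun n1 n2 n3 X1 X2 X3 A W1 W2 Zs => lmx (A : 'M[R[i]]_(m, n1))
   (G n1 X1 (n2, (n3, ns)) (X2, (X3, Xs)) (W1, (W2, Zs))))) => //.
- by move=> n1 n2 X1 X2 A d1 d2; have [] := hmulti_slotvh2 dXs F0M A d1 d2.
- by move=> n1 n2 X1 X2 A W d1 d2; have [_] := hmulti_slotvh2 dXs F0M A d1 d2; apply.
- move=> n1 n2 n3 X1 X2 X3 S A W d1 d2 d3; apply/funext => Zs.
  have := G0 (n3, ns) (X3, Xs) m (conj d3 dXs) _ _ X1 X2 S A d1 d2.
  by move=> /(congr1 (@^~ (W, Zs))).
- move=> n1 n2 n3 X1 X2 X3 S A W d1 d2 d3; apply/funext => Zs.
  have e := congr1 (@^~ Zs) (G1 n1 X1 d1 ns Xs dXs _ _ X2 X3 S W d2 d3).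
  have e' := congr1 (@^~ Zs)
    (tract_lmx (A : 'M[R[i]]_(m, n1)) (slotv (@F0 n1 X1) Xs X2 W) S).
  refine (etrans (congr1 (fun x => x - lmx (A : 'M[R[i]]_(m, n1))
    (slotv (@F0 n1 X1) Xs X3 (rmx W S) Zs)) e') _).
  by rewrite -lmxBr; exact: (congr1 (lmx _) e).
Qed.

(** The cancellation of [tail_integral_tdiff] with the head as slot 0; with A = 1 the matrix S_a
    acts by left multiplication on the value. *)
Lemma nc_integral_diff j : (j <= size s)%N -> ndiff (j := j) (nc_integral F) (@F j).
Proof.
case: j => [|j] js; first exact: nc_integral_diff0.
move=> n X dX; have dY : sdom s0 _ Y := baseptP dX.
pose Fj : ncmap s0 (t2 :: dup t2 s2 j) := @F j.+1.
pose G : ncmap s0 [:: dupslot s0, t2 & dup t2 s2 j] := Delta j.+2 F0.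
have F0_nc : nc_function F0 := @F_nc 0%N isT.
have Fj_nc : nc_function Fj := @F_nc j.+1 js.
have FjM : hmulti Fj := @family_hmulti j.+1 js.
have G0 : ndiff (j := 0) Fj G.
  have E : nc_eq (Delta 0 Fj) G := @F_closed 0%N j.+1 isT js.
  exact: ndiff_congr (ndiff_Delta 0 Fj_nc) E.
have G1 : ndiff (j := j.+2) F0 G by exact: (ndiff_Delta j.+2 F0_nc).
pose H : tailmap (sarg s0) n n (t2 :: dup t2 s2 j) := fun ns Xs Zs =>
  \sum_(a < n) tailat (G n X) Y (rmx X (colsel R[i] b a) - lmx (colsel R[i] b a) Y)
     Xs (lmx (rowsel R[i] b a) Zs.1, Zs.2) +
  \sum_(a < n) lmx (colsel R[i] b a) (Fj b.+1 Y ns Xs (lmx (rowsel R[i] b a) Zs.1, Zs.2)).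
have HF : teq H (Fj n X).
  move=> ns Xs Zs dXs.
  have e := homotopy_sdiff dY (G0 ns Xs n dXs) dX
    ((hmulti_slotvh n FjM dX dXs).2 1%:M).
  have := congr1 (@^~ Zs) (esym (subrK (spread (slotvh Fj Xs n Y) 1%:M) (slotvh Fj Xs n X 1%:M))).
  rewrite -e /homotopy /spread !trow_sumE => e'.
  refine (esym (etrans (esym (lmx1 _)) (etrans e' _))).
  congr (_ + _); apply: eq_bigr => a _; rewrite /ract /= /slotvh2 /slotvh.
    exact: lmx1.
  by rewrite rmx_regular mul1mx.
have -> : nc_integral F X = fun ns Xs Zs =>
  \sum_(a < n) tailat (@F0 n X) Y (rmx X (colsel R[i] b a) - lmx (colsel R[i] b a) Y)
     Xs (lmx (rowsel R[i] b a) Zs.1, Zs.2) +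
  \sum_(a < n) lmx (colsel R[i] b a) (tail_integral (fun j => @F j.+1 b.+1 Y)
      Xs (lmx (rowsel R[i] b a) Zs.1, Zs.2)).
  apply/functional_extensionality_dep => ns; apply/funext => Xs; apply/funext => Zs.
  rewrite /nc_integral /homotopy /spread !trow_sumE.
  congr (_ + _); apply: eq_bigr => a _; rewrite /ract /= /slotvh2 /nc_integral_rest.
    exact: lmx1.
  by rewrite rmx_regular mul1mx.
apply: tdiff_congr HF; apply: tdiffD; apply: tdiff_sum => a.
  apply: (@tdiff_arg _ _ n j t2 s2 n b.+1 _ _ (tailat (G n X) Y _)).
  exact: (G1 n X dX b.+1 Y _ dY).
apply: (@tdiff_lmx _ _ _ _ j t2 s2 n _ _
  (fun ns Xs Zs => Fj b.+1 Y ns Xs (lmx (rowsel R[i] b a) Zs.1, Zs.2))).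
apply: (@tdiff_arg _ _ _ j t2 s2 n b.+1 _ _ (Fj b.+1 Y)).
apply: (@tail_integral_tdiff _ _ _ _ _ _ (fun j => @F j.+1 b.+1 Y)) => //.
exact: closed_family_head.
Qed.

Lemma nc_integral_nc : nc_function (nc_integral F).
Proof.
apply: (ndiff_nc (F := @F)); [exact: nc_integral_multi|exact: nc_integral_diff|exact: family_hmulti].
Qed.

Lemma nc_integral_Delta j : (j <= size s)%N -> nc_eq (Delta j (nc_integral F)) (@F j).
Proof.
move=> js; apply: ndiff_Delta_eq => //; [exact: nc_integral_multi|exact: nc_integral_diff|exact: F_nc].
Qed.
End HeadIntegration.

(** * Functions with vanishing differences *)

Section Constant.
Variables (R : realType) (N : admspace R).
Implicit Types (p m : nat) (t : slot R) (s : seq (slot R)).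

Definition entry_mx (V : lmodType R[i]) m n (a : 'I_m) (c : 'I_n) (w : V) : 'M[V]_(m, n) :=
  \matrix_(i, j) (if (i == a) && (j == c) then w else 0).

Lemma entry_mx_lin (V : lmodType R[i]) m n (a : 'I_m) (c : 'I_n) x (w w' : V) :
  entry_mx a c (x *: w + w') = scmx x (entry_mx a c w) + entry_mx a c w'.
Proof.
by apply/matrixP => i j; rewrite !mxE; case: ifP => // _; rewrite scaler0 addr0.
Qed.

Lemma rmx_colsel (V : lmodType R[i]) b m n (Z : 'M[V]_(m, n)) (c : 'I_n) :
  rmx Z (colsel R[i] b c) = \sum_(a < m) entry_mx a ord0 (Z a c).
Proof.
apply/matrixP => i j; rewrite summxE mxE (bigD1 c) //= big1 => [|l ne_lc]; last first.
  by rewrite mxE (negbTE ne_lc) scale0r.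
rewrite (bigD1 i) //= [X in _ = _ + X]big1 => [|a ne_ai]; last first.
  by rewrite mxE eq_sym (negbTE ne_ai).
by rewrite !mxE !eqxx !addr0 /=; case: eqP; rewrite ?scale1r ?scale0r.
Qed.

Lemma lmx_rowsel (V : lmodType R[i]) b m n (Z : 'M[V]_(m, n)) (c : 'I_m) i j :
  lmx (rowsel R[i] b c) Z i j = if i == ord0 then Z c j else 0.
Proof.
rewrite mxE (bigD1 c) //= big1 => [|l ne_lc]; last first.
  by rewrite mxE (negbTE ne_lc) andbF scale0r.
by rewrite mxE eqxx andbT addr0; case: eqP; rewrite ?scale1r ?scale0r.
Qed.

Lemma rmx_colselE (V : lmodType R[i]) b p m (v : 'M[V]_(p, m)) i (c : 'I_m) :
  rmx v (colsel R[i] b c) i ord0 = v i c.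
Proof.
rewrite mxE (bigD1 c) //= big1 => [|l ne_lc]; last first.
  by rewrite mxE (negbTE ne_lc) scale0r.
by rewrite mxE !eqxx scale1r addr0.
Qed.

Definition tentry p s (ns : sizes s) n (Zs : args n ns) i c (h : trow N p ns n) : N :=
  (h Zs : 'M[N]_(p, lastsize n ns)) i c.

(** The candidate for the multilinear form c. After the first slot the row index is 0, the only row
    that survives multiplication by a matrix T_a; the index a stays free so that the induction can
    start from a tail of any height. *)
Fixpoint corner_form p m s : tailmap N p m s -> 'I_p -> 'I_m -> vectors s -> N :=
  match s return tailmap N p m s -> 'I_p -> 'I_m -> vectors s -> N with
  | [::] => fun g i a _ => g tt tt tt i a
  | t :: s' => fun g i a w =>
      corner_form (tailat g (projT2 (basept (sdom t))) (entry_mx a ord0 w.1)) i ord0 w.2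
  end.

Fixpoint nonempty_doms s : Prop :=
  if s is t :: s' then (exists n, exists X : 'M[spt t]_n, sdom t _ X) /\ nonempty_doms s'
  else True.

Lemma in_dom_nonempty s (ns : sizes s) (X : points ns) : in_dom X -> nonempty_doms s.
Proof.
by elim: s ns X => //= t s IH ns X [dX dXs]; split; [exists ns.1, X.1|apply: IH dXs].
Qed.

Lemma corner_form_lin p m s x (g g' g'' : tailmap N p m s) i a ws :
  nonempty_doms s -> teq g'' (fun ns X Z => scmx x (g ns X Z) + g' ns X Z) ->
  corner_form g'' i a ws = x *: corner_form g i a ws + corner_form g' i a ws.
Proof.
elim: s m g g' g'' a ws => [|t s IH] m g g' g'' a ws /=.
  by move=> _ gg; rewrite gg // !mxE.
move=> [[n [X dX]] ds] gg; apply: IH => // ns Xs Zs dXs.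
exact: (gg (_, ns) (_, Xs) (_, Zs) (conj (baseptP dX) dXs)).
Qed.

Lemma corner_form0 p m s (g : tailmap N p m s) i a ws :
  nonempty_doms s -> teq g (fun ns X Z => 0) -> corner_form g i a ws = 0.
Proof.
move=> ds g0; have := corner_form_lin (x := -1) (g := g) (g' := g) (g'' := g) i a ws ds.
rewrite scaleN1r addNr; apply=> ns X Z dX.
by rewrite g0 // scmx0r addr0.
Qed.

Lemma corner_form_teq p m s (g g' : tailmap N p m s) i a ws :
  nonempty_doms s -> teq g g' -> corner_form g i a ws = corner_form g' i a ws.
Proof.
move=> ds gg; rewrite (corner_form_lin (x := 0) (g := g) (g' := g')) ?scale0r ?add0r //.
by move=> ns X Z dX; rewrite gg // scmx0l add0r.
Qed.

Lemma corner_form_sum p m s (I : Type) (r : seq I) (g : I -> tailmap N p m s) i a ws :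
  nonempty_doms s ->
  corner_form (fun ns X Z => \sum_(c <- r) g c ns X Z) i a ws = \sum_(c <- r) corner_form (g c) i a ws.
Proof.
move=> ds; elim: r => [|c r IH].
  by rewrite big_nil; apply: corner_form0 => // ns X Z dX; rewrite big_nil.
rewrite big_cons -IH -[X in X + _]scale1r; apply: corner_form_lin => // ns X Z dX.
by rewrite big_cons scmx1.
Qed.

Lemma corner_form_vmultilinear p m s (g : tailmap N p m s) i a :
  nonempty_doms s -> tmulti g -> vmultilinear (corner_form g i a).
Proof.
elim: s m g a => [|t s IH] m g a //= [[n [X dX]] ds] gM; have dY := baseptP dX.
split=> [x w w' ws|w]; last by apply: IH => //; apply: tmulti_tailat.
apply: corner_form_lin => // ns Xs Zs dXs.
have [+ _] := gM (_, ns) (_, Xs) (conj dY dXs).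
by move=> /(_ x (entry_mx a ord0 w) (entry_mx a ord0 w')); rewrite -entry_mx_lin; apply.
Qed.

Lemma amplify_entry_ext m t s (c c' : vectors (t :: s) -> N) (ns : sizes (t :: s))
    (Z : args m ns) a b : c =1 c' -> amplify_entry c Z a b = amplify_entry c' Z a b.
Proof. by move=> /funext ->. Qed.

Lemma amplify_entry_row m m' t s (c : vectors (t :: s) -> N) (ns : sizes (t :: s))
    (Z : 'M[sarg t]_(m, ns.1)) (Z' : 'M[sarg t]_(m', ns.1)) Zs a a' b :
  Z a =1 Z' a' ->
  amplify_entry (n := ns) c (m := m) (Z, Zs) a b = amplify_entry (n := ns) c (m := m') (Z', Zs) a' b.
Proof.
case: s c ns Z Z' Zs b => [|t2 s] c ns Z Z' Zs b ZZ /=; first by rewrite ZZ.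
by apply: eq_bigr => a1 _; rewrite ZZ.
Qed.

Lemma amplify_entry_sum m t s (I : Type) (r : seq I) (c : I -> vectors (t :: s) -> N)
    (ns : sizes (t :: s)) (Z : args m ns) a b :
  amplify_entry (fun ws => \sum_(k <- r) c k ws) Z a b =
  \sum_(k <- r) amplify_entry (c k) Z a b.
Proof.
elim: s t m c ns Z a b => [|t2 s IH] t m c ns Z a b //=.
rewrite exchange_big; apply: eq_bigr => a1 _.
exact: IH.
Qed.

Lemma amplify_entry_zero m t s (c : vectors (t :: s) -> N) (ns : sizes (t :: s))
    (Z : args m ns) a b :
  (forall ws, c (0, ws) = 0) -> (forall i, Z.1 a i = 0) -> amplify_entry c Z a b = 0.
Proof.
move=> c0 Z0; case: s c ns Z b c0 Z0 => [|t2 s] c ns Z b c0 Z0 /=; first by rewrite Z0.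
rewrite big1 // => a1 _; rewrite Z0.
have := amplify_entry_sum (I := nat) [::] (fun _ => fun ws => c (0, ws)) (ns := ns.2) Z.2 a1 b.
rewrite big_nil => <-; apply: amplify_entry_ext => ws.
by rewrite c0 big_nil.
Qed.

Definition tconst p m t s (g : tailmap N p m (t :: s)) :=
  forall j, (j <= size s)%N -> tdiff (j := j) g (fun ns X Z => 0).

(** When the differences vanish, S passes through the slot without intertwining anything, so X1 can
    be exchanged for the base point. *)
Lemma tconst_slotv p m t s (g : tailmap N p m (t :: s)) ns (Xs : points ns) n1 n2
    (X1 : 'M[spt t]_n1) (X2 : 'M[spt t]_n2) S Z :
  tconst g -> in_dom Xs -> sdom t _ X1 -> sdom t _ X2 ->
  ract (slotv g Xs X1 Z) S = slotv g Xs X2 (rmx Z S).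
Proof.
move=> gC dXs dX1 dX2; apply/eqP; rewrite -subr_eq0; apply/eqP.
exact: (gC 0%N isT ns Xs dXs n1 n2 X1 X2 S Z dX1 dX2).
Qed.

Lemma tconst_tailat p m t t2 s (g : tailmap N p m [:: t, t2 & s]) n (X : 'M[spt t]_n) Z :
  tconst g -> sdom t _ X -> tconst (tailat g X Z).
Proof. by move=> gC dX j js; apply: (gC j.+1 js n X Z dX). Qed.

(** Multiplication by T_a moves row a of the first argument to row 0 and kills all other rows, so
    only one term of the sum survives. *)
Lemma corner_formE p b t s (g : tailmap N p b.+1 (t :: s)) ns (Xs : points ns) n
    (Zs : args n ns) (a : 'I_n) i c :
  tmulti g -> in_dom Xs ->
  g ns Xs (lmx (rowsel R[i] b a) Zs.1, Zs.2) i c =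
    \sum_a' amplify_entry (corner_form g i a') (lmx (rowsel R[i] b a) Zs.1, Zs.2) a' c ->
  g ns Xs (lmx (rowsel R[i] b a) Zs.1, Zs.2) i c = amplify_entry (corner_form g i ord0) Zs a c.
Proof.
move=> gM dXs ->; have ds := in_dom_nonempty dXs.
rewrite (bigD1 ord0) //= big1 => [|a' ne_a']; last first.
  apply: amplify_entry_zero => [ws|k /=]; last by rewrite lmx_rowsel (negbTE ne_a').
  have [+ _] := corner_form_vmultilinear i a' ds gM.
  by move=> /(_ (-1) 0 0 ws); rewrite scaler0 addr0 scaleN1r addNr.
rewrite addr0; case: Zs => Z Zs; apply: amplify_entry_row => k /=.
by rewrite lmx_rowsel eqxx.
Qed.

(** Insert the sum of S_a T_a = I after the first argument. Each S_a goes left into it and moves the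
    point to Y, each T_a goes right, and the sum over a becomes the sum over an inner index of the
    amplification. In the last slot S_c alone selects column c. *)
Lemma tconstE p m t s (g : tailmap N p m (t :: s)) ns (Xs : points ns) Zs i c :
  tmulti g -> tconst g -> in_dom Xs ->
  g ns Xs Zs i c = \sum_a amplify_entry (corner_form g i a) Zs a c.
Proof.
elim: s t m g ns Xs Zs i c => [|t2 s IH] t m g.
  move=> [n []] [X []] [Z []] i c gM gC [dX _]; have dY := baseptP dX.
  have e := @tconst_slotv p m t [::] g tt tt _ _ X _
    (colsel R[i] (projT1 (basept (sdom t))) c) Z gC I dX dY.
  rewrite -[LHS](rmx_colselE (projT1 (basept (sdom t)))).
  refine (etrans (congr1 (@tentry p [::] tt _ tt i ord0) e) _); rewrite /tentry.
  have [gl _] := @tmulti_slotv R N p m t [::] g tt tt _ _ gM dY I.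
  rewrite rmx_colsel (slinear_sum gl) trow_sumE.
  exact: summxE.
move=> [n ns] [X Xs] [Z Zs] i c gM gC [dX dXs]; have dY := baseptP dX.
have ds := @in_dom_nonempty (t2 :: s) ns Xs dXs.
have [gl gg] := tmulti_slotv gM dX dXs.
have := congr1 (@tentry p (t2 :: s) ns n Zs i c)
  (sum_ract_sel (projT1 (basept (sdom t))) (gg Z)).
rewrite /tentry trow_sumE summxE => <-.
have [gYl _] := tmulti_slotv gM dY dXs.
transitivity (\sum_(a1 < n) amplify_entry
  (corner_form (tailat g (projT2 (basept (sdom t))) (rmx Z (colsel R[i] _ a1))) i ord0) Zs a1 c).
  apply: eq_bigr => a1 _; rewrite (tconst_slotv _ _ gC dXs dX dY).
  apply: (corner_formE (g := tailat g _ _)) => //; first exact: tmulti_tailat.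
  by apply: IH => //; [exact: tmulti_tailat|exact: tconst_tailat].
rewrite [RHS]exchange_big; apply: eq_bigr => a1 _.
rewrite -amplify_entry_sum; apply: amplify_entry_ext => ws.
rewrite rmx_colsel.
refine (etrans _ (@corner_form_sum p _ (t2 :: s) _ (index_enum 'I_m) (fun k =>
  tailat g (projT2 (basept (sdom t))) (entry_mx k ord0 (Z k a1))) i ord0 ws ds)).
apply: corner_form_teq => //.
move=> ns' Xs' Zs' dXs'.
have [gl' _] := tmulti_slotv gM dY dXs'.
have e := slinear_sum gl' (index_enum 'I_m) predT (fun k => entry_mx k ord0 (Z k a1)).
rewrite trow_sumE in e.
exact: (congr1 (fun h : @trow R N p (t2 :: s) ns' _ => h Zs') e).
Qed.
End Constant.

(** * Uniqueness up to a multilinear form *)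

Section Uniqueness.
Variables (R : realType).
Implicit Types (p m j : nat) (t : slot R) (s : seq (slot R)).

Lemma tdiffB (N : admspace R) p j t s m (g g' : tailmap N p m (t :: s)) G G' :
  tdiff (j := j) g G -> tdiff g' G' ->
  tdiff (j := j) (fun ns X Z => g ns X Z - g' ns X Z) (fun ns X Z => G ns X Z - G' ns X Z).
Proof.
elim: j t s m g g' G G' => [|j IH] t s m g g' G G'.
  move=> gG gG' ns Xs dXs n1 n2 X1 X2 S Z dX1 dX2.
  have e : ract (slotv g Xs X1 Z - slotv g' Xs X1 Z) S -
      (slotv g Xs X2 (rmx Z S) - slotv g' Xs X2 (rmx Z S)) =
      slotv2 (s := s) G Xs X1 X2 Z (rmx X1 S - lmx S X2) -
      slotv2 (s := s) G' Xs X1 X2 Z (rmx X1 S - lmx S X2).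
    rewrite ractBl -(gG ns Xs dXs) // -(gG' ns Xs dXs) //.
    by rewrite !opprB addrACA [RHS]addrACA [in RHS](addrC (- _)).
  exact: e.
case: s g g' G G' => [|t2 s] g g' G G' //= gG gG' n X Z dX.
exact: (IH _ _ _ _ _ _ _ (gG n X Z dX) (gG' n X Z dX)).
Qed.

Lemma vmultilinear0 (U : admspace R) s : vmultilinear (fun _ : vectors s => 0 : U).
Proof. by elim: s => [|t s IH] //=; split=> // *; rewrite scaler0 addr0. Qed.

Lemma ndiff_unique (s0 : slot R) t s (f f' : ncmap s0 (t :: s))
    (F : forall j, ncmap s0 (dup s0 (t :: s) j)) :
  hmulti f -> hmulti f' ->
  (forall j, (j <= size (t :: s))%N -> ndiff (j := j) f (F j)) ->
  (forall j, (j <= size (t :: s))%N -> ndiff (j := j) f' (F j)) ->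
  exists c : vectors (t :: s) -> sarg s0, vmultilinear c /\
    forall n0 (X0 : 'M[spt s0]_n0) ns (X : points ns) (Z : args n0 ns),
      sdom s0 _ X0 -> in_dom X ->
      f' n0 X0 ns X Z = f n0 X0 ns X Z + amplify c Z.
Proof.
move=> fM fM' fF fF'.
pose g : ncmap s0 (t :: s) := fun n0 X0 ns X Z => f' n0 X0 ns X Z - f n0 X0 ns X Z.
have gM : hmulti g.
  move=> n0 X0 dX0 ns X dX; apply: multilinearD; first exact: fM'.
  apply: (multilinear_lin (h := fun x => - x)); last exact: fM.
  by move=> a x y; rewrite opprD scmxNr.
pose Y := projT2 (basept (sdom s0)); pose b := projT1 (basept (sdom s0)).
have gC n0 (X0 : 'M[spt s0]_n0) : sdom s0 _ X0 -> tconst (g n0 X0).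
  move=> dX0 j js.
  apply: tdiff_congr (tdiffB (fF' j.+1 js n0 X0 dX0) (fF j.+1 js n0 X0 dX0)) _ => ns X Z _.
  by rewrite subrr.
(* The formula D_0 at Y and X0 with S = T_a, where the terms in F cancel: row a of g at X0 becomes
   row 0 of g at the base point. *)
have g0 n0 (X0 : 'M[spt s0]_n0) ns (X : points ns) (a : 'I_n0) Zs :
    sdom s0 _ X0 -> in_dom X ->
    lmx (rowsel R[i] b a) (g n0 X0 ns X Zs) =
    g b.+1 Y ns X (lmx (rowsel R[i] b a) Zs.1, Zs.2).
  move=> dX0 dX; have dY : sdom s0 _ Y := baseptP dX0.
  have e1 : forall h F0, ndiff (j := 0) h F0 -> lmx (rowsel R[i] b a) (h n0 X0 ns X Zs) =
    h b.+1 Y ns X (lmx (rowsel R[i] b a) Zs.1, Zs.2) -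
    F0 b.+1 Y (n0, ns) (X0, X) (rmx Y (rowsel R[i] b a) - lmx (rowsel R[i] b a) X0, Zs).
    move=> h F0 hF.
    have e := hF ns X b.+1 dX _ _ Y X0 (rowsel R[i] b a) 1%:M dY dX0.
    have {e} : lmx 1%:M (h b.+1 Y ns X (lmx (rowsel R[i] b a) Zs.1, Zs.2)) -
        lmx (rmx (1%:M : 'M[R[i]^o]_b.+1) (rowsel R[i] b a)) (h n0 X0 ns X Zs) =
        lmx 1%:M (F0 b.+1 Y (n0, ns) (X0, X)
          (rmx Y (rowsel R[i] b a) - lmx (rowsel R[i] b a) X0, Zs)).
      exact: (congr1 (fun k : @trow R (sarg s0) b.+1 (t :: s) ns n0 => k Zs) e).
    rewrite !lmx1 rmx_regular mul1mx => <-.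
    by rewrite opprB addrC subrK.
  by rewrite lmxBr (e1 f' _ (fF' 0%N isT)) (e1 f _ (fF 0%N isT)) opprB addrA subrK.
(* If some domain is empty, the base points may be junk, but then nothing is claimed and c = 0
   serves. *)
have [[n0 [X0 [ns [X [dX0 dX]]]]]|nX] := pselect (exists n0 (X0 : 'M[spt s0]_n0)
  (ns : sizes (t :: s)) (X : points ns), sdom s0 _ X0 /\ in_dom X); last first.
  exists (fun _ => 0); split; first exact: vmultilinear0.
  by move=> n0 X0 ns X Z dX0 dX; case: nX; exists n0, X0, ns, X.
have dY : sdom s0 _ Y := baseptP dX0.
exists (corner_form (g b.+1 Y) ord0 ord0); split.
  by apply: corner_form_vmultilinear; [exact: in_dom_nonempty dX|exact: gM].
clear n0 X0 ns X dX0 dX => n0 X0 ns X Z dX0 dX.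
apply/eqP; rewrite addrC -subr_eq; apply/eqP/matrixP => a c; rewrite [RHS]mxE.
have := congr1 (fun v : 'M[sarg s0]_(_, _) => v ord0 c) (g0 n0 X0 ns X a Z dX0 dX).
rewrite lmx_rowsel eqxx => e; refine (etrans e _).
apply: corner_formE => //; first exact: gM.
by apply: tconstE => //; [exact: gM|exact: gC].
Qed.
End Uniqueness.

(** * Analyticity *)

Section BlockColumns.
Variables (C : comNzRingType) (m : nat) (s : 'I_m -> nat).

Lemma tr_blockcol_mul a : (blockcol C s a)^T *m blockcol C s a = 1%:M.
Proof.
rewrite /blockcol tr_mxcol mul_mxrow_mxcol (bigD1 a) //= big1 => [|i ne_ia].
  by rewrite eqxx tr_pid_mx pid_mx_1 mulmx1 addr0.
by rewrite (negbTE ne_ia) mulmx0.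
Qed.

Lemma blockcol_sandwich a a' (S : 'M[C]_(s a', s a)) :
  (blockcol C s a')^T *m
    (blockcol C s a' *m S *m (blockcol C s a)^T *m blockcol C s a) = S.
Proof. by rewrite -!mulmxA tr_blockcol_mul mulmx1 mulmxA tr_blockcol_mul mul1mx. Qed.

Lemma sum_blockcol_tr : \sum_a blockcol C s a *m (blockcol C s a)^T = 1%:M.
Proof.
have e a : blockcol C s a *m (blockcol C s a)^T = \mxblock_(i, j)
    ((if i == a then pid_mx (s a) else 0 : 'M[C]_(s i, s a)) *m
     (if j == a then pid_mx (s a) else 0 : 'M[C]_(s j, s a))^T).
  by rewrite /blockcol tr_mxcol mul_mxcol_mxrow.
rewrite (eq_bigr _ (fun a _ => e a)).
rewrite -mxblock_sum -(mxdiagZ (p_ := s) (1 : C)) /mxdiag.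
apply: eq_mxblock => i j.
rewrite (bigD1 i) //= big1 => [|a ne_ai]; last first.
  by rewrite eq_sym (negbTE ne_ai) mul0mx.
rewrite eqxx pid_mx_1 mul1mx addr0 [j == i]eq_sym.
case: eqP => [ij|_]; last by rewrite trmx0.
by case: _ / ij; rewrite pid_mx_1 trmx1 conform_mx_id.
Qed.
End BlockColumns.

Lemma lmx_suml (C : comNzRingType) (V : lmodType C) p q r I (s : seq I) (P : pred I)
    (T : I -> 'M[C]_(p, q)) (X : 'M[V]_(q, r)) :
  lmx (\sum_(i <- s | P i) T i) X = \sum_(i <- s | P i) lmx (T i) X.
Proof.
apply: (big_morph (fun T => lmx T X)) => [S T'|]; last exact: lmx0l.
by rewrite -{1}(scale1r S) lmx_linl scmx1.
Qed.

Lemma rmx_sumr (C : comNzRingType) (V : lmodType C) p q r I (s : seq I) (P : pred I)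
    (T : I -> 'M[C]_(q, r)) (X : 'M[V]_(p, q)) :
  rmx X (\sum_(i <- s | P i) T i) = \sum_(i <- s | P i) rmx X (T i).
Proof.
apply: (big_morph (fun T => rmx X T)) => [S T'|]; last exact: rmx0r.
by rewrite -{1}(scale1r S) rmx_linr scmx1.
Qed.

(** * Boundedness of multiplication by scalar matrices *)

Section BoundedMultiplication.
Variables (R : realType) (W : admspace R).

Definition bounded_op p q p' q' (h : 'M[W]_(p, q) -> 'M[W]_(p', q')) :=
  exists2 K : R, 0 <= K & forall A, mnorm (h A) <= K * mnorm A.

Lemma bounded_opW p q p' q' (h : 'M[W]_(p, q) -> 'M[W]_(p', q')) :
  (0 < p)%N -> (0 < q)%N ->
  (exists K : R, forall A, mnorm (h A) <= K * mnorm A) -> bounded_op h.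
Proof.
move=> p0 q0 [K hK]; exists `|K| => // A; apply: le_trans (hK A) _.
by rewrite ler_wpM2r ?mnorm_ge0 // ler_norm.
Qed.

Lemma bounded_op_comp p q p' q' p'' q'' (h : 'M[W]_(p, q) -> 'M[W]_(p', q'))
    (h' : 'M[W]_(p', q') -> 'M[W]_(p'', q'')) :
  bounded_op h -> bounded_op h' -> bounded_op (h' \o h).
Proof.
move=> [K K0 hK] [K' K0' hK']; exists (K' * K); first exact: mulr_ge0.
by move=> A; apply: le_trans (hK' _) _; rewrite -mulrA ler_wpM2l.
Qed.

Lemma bounded_op_sum p q p' q' (I : finType) (h : I -> 'M[W]_(p, q) -> 'M[W]_(p', q')) :
  (0 < p)%N -> (0 < q)%N -> (0 < p')%N -> (0 < q')%N ->
  (forall i, bounded_op (h i)) -> bounded_op (fun A => \sum_i h i A).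
Proof.
move=> p0 q0 p0' q0' hb.
pose K i := projT1 (cid2 (hb i)).
have KP i : 0 <= K i /\ forall A, mnorm (h i A) <= K i * mnorm A.
  by rewrite /K; case: cid2.
exists (\sum_i K i); first by apply: sumr_ge0 => i _; have [] := KP i.
move=> A; apply: le_trans (mnorm_sum p0' q0' _ _ _) _.
by rewrite mulr_suml; apply: ler_sum => i _; have [_] := KP i.
Qed.

Lemma bounded_op_ext p q p' q' (h h' : 'M[W]_(p, q) -> 'M[W]_(p', q')) :
  h =1 h' -> bounded_op h -> bounded_op h'.
Proof. by move=> hh [K K0 hK]; exists K => // A; rewrite -hh. Qed.

Lemma injection_bounded m (s : 'I_m -> nat) a b : (forall i, 0 < s i)%N ->
  bounded_op (fun A => lmx (blockcol _ s a) (rmx A (blockcol _ s b)^T)).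
Proof.
by move=> s0; apply: bounded_opW => //; apply: (adm_injection (mnormP W)).
Qed.

Lemma size_sum_gt0 m (s : 'I_m -> nat) (a : 'I_m) : (forall i, 0 < s i)%N ->
  (0 < \sum_i s i)%N.
Proof. by move=> s0; rewrite (bigD1 a) //= addn_gt0 s0. Qed.

Lemma projection_bounded m (s : 'I_m -> nat) a b : (forall i, 0 < s i)%N ->
  bounded_op (fun A => lmx (blockcol _ s a)^T (rmx A (blockcol _ s b))).
Proof.
move=> s0; apply: bounded_opW; try exact: size_sum_gt0 a s0.
exact: (adm_projection (mnormP W)).
Qed.

Lemma bounded_op_scmx p q p' q' (h : 'M[W]_(p, q) -> 'M[W]_(p', q')) a :
  (0 < p')%N -> (0 < q')%N -> bounded_op h -> bounded_op (fun A => scmx a (h A)).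
Proof.
move=> p0 q0 [K K0 hK]; exists (cabs a * K); first by rewrite mulr_ge0 ?cabs_ge0.
by move=> A; rewrite mnormZ // -mulrA ler_wpM2l ?cabs_ge0.
Qed.

Lemma lmx_mx11 p q (u : 'M[R[i]]_(p, 1)) (c : 'M[R[i]]_1) (x : 'M[W]_(1, q)) :
  lmx (u *m c) x = scmx (c 0 0) (lmx u x).
Proof. by rewrite {1}(mx11_scalar c) mul_mx_scalar lmxZl. Qed.

Lemma rmx_mx11 p q (v : 'M[R[i]]_(1, q)) (c : 'M[R[i]]_1) (x : 'M[W]_(p, 1)) :
  rmx x (c *m v) = scmx (c 0 0) (rmx x v).
Proof. by rewrite {1}(mx11_scalar c) mul_scalar_mx rmxZr. Qed.

(* Cutting a square matrix into 1 x 1 blocks reduces to multiplication by scalars. *)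
Lemma square_mul_bounded n (S T : 'M[R[i]]_n) : (0 < n)%N ->
  bounded_op (fun A : 'M[W]_n => lmx S (rmx A T)).
Proof.
(* The axioms speak of matrices whose size is a sum of block sizes; n equals the sum of n ones, but
   not by conversion. *)
suff h n' (s := fun _ : 'I_n => 1%N) : n' = (\sum_i s i)%N -> forall S T : 'M[R[i]]_n',
    (0 < n')%N -> bounded_op (fun A : 'M[W]_n' => lmx S (rmx A T)).
  by apply: h; rewrite sum1_card card_ord.
move=> ->{n'} {}S {}T n0; have s0 i : (0 < s i)%N by [].
pose E (a : 'I_n) : 'M[R[i]]_(_, 1) := blockcol R[i] s a.
(* u x v is the combination with coefficients u_a v_b of the injections of the 1 x 1 block x. *)
have rank1 (u : 'M[R[i]]_(\sum_i s i, 1)) (v : 'M[R[i]]_(1, \sum_i s i)) :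
    bounded_op (fun x : 'M[W]_1 => lmx u (rmx x v)).
  have e (x : 'M[W]_1) : \sum_a \sum_b scmx (((E a)^T *m u) 0 0 * (v *m E b) 0 0)
      (lmx (E a) (rmx x (E b)^T)) = lmx u (rmx x v).
    rewrite -[u in RHS]mul1mx -[v in RHS]mulmx1 -(sum_blockcol_tr _ s).
    rewrite mulmx_suml lmx_suml; apply: eq_bigr => a _.
    rewrite mulmx_sumr rmx_sumr lmx_sumr; apply: eq_bigr => b _.
    by rewrite -mulmxA lmx_mx11 mulmxA rmx_mx11 lmxZr scmxA.
  apply: (bounded_op_ext e).
  do 2 (apply: bounded_op_sum => // ?); apply: bounded_op_scmx => //.
  exact: injection_bounded.
have e (A : 'M[W]_(\sum_i s i)) : \sum_a \sum_b lmx (S *m E a)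
    (rmx (lmx (E a)^T (rmx A (E b))) ((E b)^T *m T)) = lmx S (rmx A T).
  rewrite -[S in RHS]mulmx1 -[T in RHS]mul1mx -(sum_blockcol_tr _ s).
  rewrite mulmx_sumr lmx_suml; apply: eq_bigr => a _.
  rewrite mulmx_suml rmx_sumr lmx_sumr; apply: eq_bigr => b _.
  by rewrite -(lmx_rmx (E a)^T) rmxA lmxA !mulmxA.
apply: (bounded_op_ext e).
do 2 (apply: bounded_op_sum => // ?).
exact: bounded_op_comp (projection_bounded _ _ s0) (rank1 _ _).
Qed.

(** The axioms relate a rectangular block only to a square matrix containing it. So A is placed into
    a square matrix with block sizes p, q, p', q', multiplied there by square matrices that move it
    to the block (p', q'), and projected out. *)
Lemma mul_bounded p q p' q' (S : 'M[R[i]]_(p', p)) (T : 'M[R[i]]_(q, q')) :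
  (0 < p)%N -> (0 < q)%N -> (0 < p')%N -> (0 < q')%N ->
  bounded_op (fun A : 'M[W]_(p, q) => lmx S (rmx A T)).
Proof.
move=> p0 q0 p0' q0'.
pose s (i : 'I_4) := nth 0%N [:: p; q; p'; q'] i.
have s0 i : (0 < s i)%N by rewrite /s; case: i => -[|[|[|[|]]]].
pose a := @Ordinal 4 0 isT; pose b := @Ordinal 4 1 isT.
pose a' := @Ordinal 4 2 isT; pose b' := @Ordinal 4 3 isT.
pose E := blockcol R[i] s.
have h1 := injection_bounded a b s0.
have h2 := square_mul_bounded (E a' *m S *m (E a)^T) (E b *m T *m (E b')^T)
  (size_sum_gt0 a s0).
have h3 := projection_bounded a' b' s0.
apply: bounded_op_ext (bounded_op_comp h1 (bounded_op_comp h2 h3)) => A /=.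
rewrite -!lmx_rmx !lmxA !rmxA.
exact: (congr2 (fun (U : 'M[R[i]]_(s a', s a)) (V : 'M[R[i]]_(s b, s b')) => lmx U (rmx A V))
  (blockcol_sandwich (a' := a') (a := a) S) (blockcol_sandwich (a' := b) (a := b') T)).
Qed.

Lemma lmx_bounded p q p' (S : 'M[R[i]]_(p', p)) :
  (0 < p)%N -> (0 < q)%N -> (0 < p')%N -> bounded_op (fun A : 'M[W]_(p, q) => lmx S A).
Proof.
move=> p0 q0 p0'; apply: bounded_op_ext (mul_bounded S 1%:M p0 q0 p0' q0) => A.
by rewrite rmx1.
Qed.

Lemma rmx_bounded p q q' (T : 'M[R[i]]_(q, q')) :
  (0 < p)%N -> (0 < q)%N -> (0 < q')%N -> bounded_op (fun A : 'M[W]_(p, q) => rmx A T).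
Proof.
move=> p0 q0 q0'; apply: bounded_op_ext (mul_bounded 1%:M T p0 q0 p0 q0') => A.
by rewrite lmx1.
Qed.
End BoundedMultiplication.

(** * Norms of multilinear maps *)

Section MultilinearBounds.
Variables (R : realType).
Implicit Types (p q m n : nat) (s : seq (slot R)).

Fixpoint args_norm m s : forall ns : sizes s, args m ns -> R :=
  match s return forall ns : sizes s, args m ns -> R with
  | [::] => fun _ _ => 1
  | t :: s' => fun ns Z => mnorm Z.1 * @args_norm ns.1 s' ns.2 Z.2
  end.

Fixpoint pos_sizes s : sizes s -> Prop :=
  match s return sizes s -> Prop with
  | [::] => fun _ => True
  | t :: s' => fun ns => (0 < ns.1)%N /\ @pos_sizes s' ns.2
  end.

Lemma in_dom_pos s (ns : sizes s) (X : points ns) : in_dom X -> pos_sizes ns.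
Proof.
elim: s ns X => //= t s IH ns X [dX dXs]; split; last exact: IH dXs.
exact: ncdom_size dX.
Qed.

Lemma args_norm_ge0 m s (ns : sizes s) (Z : args m ns) :
  (0 < m)%N -> pos_sizes ns -> 0 <= args_norm Z.
Proof.
elim: s m ns Z => //= t s IH m ns Z m0 [n0 ns0].
by rewrite mulr_ge0 ?mnorm_ge0 //; apply: IH.
Qed.

Lemma unit_args_norm m s (ns : sizes s) (Z : args m ns) : unit_args Z -> args_norm Z = 1.
Proof. by elim: s m ns Z => //= t s IH m ns Z [-> /IH ->]; rewrite mulr1. Qed.

Lemma lastsize_pos m s (ns : sizes s) : (0 < m)%N -> pos_sizes ns -> (0 < lastsize m ns)%N.
Proof. by elim: s m ns => //= t s IH m ns m0 [n0 ns0]; apply: IH. Qed.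

Variable N : admspace R.

(** A bound in terms of the product of the norms of all arguments. Unlike [opnorm] it refers to no
    unit vectors, so it passes directly to sums, products with matrices and frozen arguments. *)
Definition mbound p q m s (ns : sizes s) (w : args m ns -> 'M[N]_(p, q)) (M : R) :=
  forall Z, mnorm (w Z) <= M * args_norm Z.

Lemma mbound_opnorm p q m s (ns : sizes s) (w : args m ns -> 'M[N]_(p, q)) (M : R) :
  0 <= M -> mbound w M -> (opnorm w <= M%:E)%E.
Proof.
move=> M0 wM; apply: ge_ereal_sup => _ [->|[Z Z1 <-]]; rewrite lee_fin //.
by rewrite -[M]mulr1 -(unit_args_norm Z1).
Qed.

(** The arguments are scaled to norm 1 one after the other. An argument of norm 0 is zero by
    definiteness, and there w vanishes by linearity. *)
Lemma opnorm_mbound p q m s (ns : sizes s) (w : args m ns -> 'M[N]_(p, q)) (M : R) :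
  (0 < p)%N -> (0 < q)%N -> (0 < m)%N -> pos_sizes ns -> multilinear w ->
  (opnorm w <= M%:E)%E -> mbound w M.
Proof.
move=> p0 q0 m0 ns0 wL wM.
(* This uses the value 0 adjoined to the set under the supremum. *)
have M0 : 0 <= M.
  by rewrite -lee_fin; apply: le_trans wM; apply: ereal_sup_ubound; left.
have : forall Z, unit_args Z -> mnorm (w Z) <= M.
  move=> Z Z1; rewrite -lee_fin; apply: le_trans wM.
  by apply: ereal_sup_ubound; right; exists Z.
move: wL => {wM}; elim: s m m0 ns ns0 w => [|t s IH] m m0 ns ns0 w wL wM Z.
  by rewrite mulr1; apply: wM.
case: Z => Z Zs; case: ns0 => n0 ns0 /=.
have [Z0|Z_neq0] := eqVneq (mnorm Z) 0.
  rewrite (mnorm_eq0 m0 n0 Z0) mnorm0 // mul0r mulr0.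
  have := wL.1 (-1) 0 0 Zs; rewrite scmx0r addr0 scmxNl scmx1 addNr => ->.
  by rewrite mnorm0.
have c0 : 0 < mnorm Z by rewrite lt_def Z_neq0 mnorm_ge0.
have wU U : mnorm U = 1 -> mnorm (w (U, Zs)) <= M * args_norm Zs.
  move=> U1; apply: (IH _ n0 _ ns0 (fun Zs => w (U, Zs))); first exact: wL.2.
  by move=> Zs' Zs1; apply: wM.
have -> : w (Z, Zs) = scmx (mnorm Z)%:C (w (scmx ((mnorm Z)^-1)%:C Z, Zs)).
  have := wL.1 (mnorm Z)%:C (scmx ((mnorm Z)^-1)%:C Z) 0 Zs.
  rewrite addr0 scmxA -rmorphM /= mulfV // scmx1 => ->.
  rewrite -[RHS]addr0; congr (_ + _).
  by have := wL.1 (-1) 0 0 Zs; rewrite scmx0r addr0 scmxNl scmx1 addNr => ->.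
rewrite mnormZ // cabs_real ?mnorm_ge0 // [leRHS]mulrCA ler_pM2l //; apply: wU.
by rewrite mnormZ // cabs_real ?invr_ge0 ?mnorm_ge0 // mulVf.
Qed.

Lemma mboundD p q m s (ns : sizes s) (w w' : args m ns -> 'M[N]_(p, q)) M M' :
  (0 < p)%N -> (0 < q)%N -> mbound w M -> mbound w' M' ->
  mbound (fun Z => w Z + w' Z) (M + M').
Proof.
move=> p0 q0 wM wM' Z; rewrite mulrDl.
by apply: le_trans (mnormD p0 q0 _ _) _; apply: lerD.
Qed.

Lemma mbound_sum p q m s (ns : sizes s) I (r : seq I) (w : I -> args m ns -> 'M[N]_(p, q)) M :
  (0 < p)%N -> (0 < q)%N -> (forall i, mbound (w i) (M i)) ->
  mbound (fun Z => \sum_(i <- r) w i Z) (\sum_(i <- r) M i).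
Proof.
move=> p0 q0 wM Z; rewrite mulr_suml.
by apply: le_trans (mnorm_sum p0 q0 _ _ _) _; apply: ler_sum => i _; apply: wM.
Qed.

Lemma mboundW p q m s (ns : sizes s) (w : args m ns -> 'M[N]_(p, q)) M M' :
  (0 < m)%N -> pos_sizes ns -> M <= M' -> mbound w M -> mbound w M'.
Proof.
move=> m0 ns0 MM wM Z; apply: le_trans (wM Z) _.
by rewrite ler_wpM2r // args_norm_ge0.
Qed.

(** K depends on T and the sizes only; the local bounds rest on this uniformity in w. *)
Lemma tract_mbound p s (ns : sizes s) n' n (T : 'M[R[i]]_(n', n)) :
  (0 < p)%N -> (0 < n')%N -> (0 < n)%N -> pos_sizes ns ->
  exists2 K : R, 0 <= K & forall (w : trow N p ns n') M, 0 <= M ->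
    @mbound p _ _ s ns w M -> @mbound p _ _ s ns (tract w T) (K * M).
Proof.
case: s ns => [|t s] ns p0 n0' n0 ns0.
  have [K K0 hK] := rmx_bounded N (p := p) T p0 n0' n0.
  exists K => // w M M0 wM Z /=.
  apply: le_trans (hK _) _; by rewrite -!mulrA ler_wpM2l.
case: ns0 => n10 ns0.
have [K K0 hK] := lmx_bounded (sarg t) (q := ns.1) T n0 n10 n0'.
exists K => // w M M0 wM [Z Zs] /=.
apply: le_trans (wM _) _; rewrite /= mulrA mulrA ler_wpM2r ?args_norm_ge0 //.
by rewrite mulrC [leRHS]mulrAC ler_wpM2r.
Qed.
End MultilinearBounds.

(** * Local boundedness of the integral *)

Section LocalBounds.
Variables (R : realType) (N : admspace R).
Implicit Types (p m n j : nat) (t : slot R) (s : seq (slot R)).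

Lemma sum_tract_mbound (I : finType) p s (ns : sizes s) b n
    (T : I -> 'M[R[i]]_(b, n)) :
  (0 < p)%N -> (0 < b)%N -> (0 < n)%N -> pos_sizes ns ->
  exists2 K : I -> R, (forall c, 0 <= K c) &
    forall (w : I -> trowmod N p ns b) (M : I -> R), (forall c, 0 <= M c) ->
    (forall c, @mbound _ N p _ _ s ns (w c) (M c)) ->
    @mbound _ N p _ _ s ns (\sum_c ract (w c) (T c)) (\sum_c K c * M c).
Proof.
move=> p0 b0 n0 ns0; pose K c := projT1 (cid2 (tract_mbound N (T c) p0 b0 n0 ns0)).
have KP c : 0 <= K c /\ forall w M, 0 <= M -> @mbound _ N p _ _ s ns w M ->
    @mbound _ N p _ _ s ns (tract w (T c)) (K c * M).
  by rewrite /K; case: cid2.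
exists K => [c|w M M0 wM]; first by have [] := KP c.
rewrite trow_sumE; apply: mbound_sum => // [|c]; first exact: lastsize_pos.
by have [_] := KP c; apply.
Qed.

Lemma spread_mbound (A : admspace R) p s (ns : sizes s) m b n :
  (0 < p)%N -> (0 < m)%N -> (0 < n)%N -> pos_sizes ns ->
  exists2 K : R, 0 <= K & forall (k : 'M[A]_(m, b.+1) -> trowmod N p ns b.+1) M,
    0 <= M -> (forall Z, @mbound _ N p _ _ s ns (k Z) (M * mnorm Z)) ->
    forall Z : 'M[A]_(m, n), @mbound _ N p _ _ s ns (spread k Z) (K * M * mnorm Z).
Proof.
move=> p0 m0 n0 ns0.
have [K K0 hK] := sum_tract_mbound (rowsel R[i] b (n := n)) p0
  (ltn0Sn b) n0 ns0.
pose L c := projT1 (cid2 (rmx_bounded A (colsel R[i] b (n := n) c) m0 n0 (ltn0Sn b))).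
have LP c : 0 <= L c /\ forall Z : 'M[A]_(m, n),
    mnorm (rmx Z (colsel R[i] b c)) <= L c * mnorm Z.
  by rewrite /L; case: cid2.
exists (\sum_c K c * L c) => [|k M M0 kM Z].
  by apply: sumr_ge0 => c _; rewrite mulr_ge0 //; have [] := LP c.
have := hK (fun c => k (rmx Z (colsel R[i] b c))) (fun c => L c * (M * mnorm Z)).
rewrite -mulrA mulr_suml; under [X in _ -> _ -> mbound _ X]eq_bigr do rewrite mulrA.
apply=> c; have [L0 hL] := LP c.
  by rewrite !mulr_ge0 ?mnorm_ge0.
apply: mboundW (kM _) => //; rewrite mulrCA.
by rewrite ler_wpM2l.
Qed.

(** The inserted argument X S_c - S_c Y is affine in X with constant term fixed by Y, hence the
    factor [mnorm X + 1]. *)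
Lemma homotopy_mbound (V : admspace R) p s (ns : sizes s) b n (Y : 'M[V]_b.+1) :
  (0 < p)%N -> (0 < n)%N -> pos_sizes ns ->
  exists2 K : R, 0 <= K & forall (k : 'M[V]_(n, b.+1) -> trowmod N p ns b.+1) M,
    0 <= M -> (forall W, @mbound _ N p _ _ s ns (k W) (M * mnorm W)) ->
    forall X : 'M[V]_n, @mbound _ N p _ _ s ns
      (\sum_c ract (k (rmx X (colsel R[i] b c) - lmx (colsel R[i] b c) Y))
                   (rowsel R[i] b c)) (K * M * (mnorm X + 1)).
Proof.
move=> p0 n0 ns0.
have [K K0 hK] := sum_tract_mbound (rowsel R[i] b (n := n)) p0
  (ltn0Sn b) n0 ns0.
pose L c := projT1 (cid2 (rmx_bounded V (colsel R[i] b (n := n) c) n0 n0 (ltn0Sn b))).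
have LP c : 0 <= L c /\ forall Z : 'M[V]_n,
    mnorm (rmx Z (colsel R[i] b c)) <= L c * mnorm Z.
  by rewrite /L; case: cid2.
pose L' c := L c + mnorm (lmx (colsel R[i] b c) Y : 'M[V]_(n, b.+1)).
have L'0 c : 0 <= L' c by rewrite addr_ge0 ?mnorm_ge0 //; have [] := LP c.
exists (\sum_c K c * L' c) => [|k M M0 kM X].
  by apply: sumr_ge0 => c _; rewrite mulr_ge0.
have X0 : 0 <= mnorm X by exact: mnorm_ge0.
have := hK (fun c => k (rmx X (colsel R[i] b c) - lmx (colsel R[i] b c) Y))
  (fun c => L' c * (M * (mnorm X + 1))).
rewrite -mulrA mulr_suml; under [X in _ -> _ -> mbound _ X]eq_bigr do rewrite mulrA.
apply=> c.
  by rewrite !mulr_ge0 // addr_ge0.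
apply: mboundW (kM _) => //; rewrite mulrCA ler_wpM2l //.
apply: le_trans (mnormD n0 (ltn0Sn b) _ _) _; rewrite mnormN //.
have [L0 hL] := LP c.
rewrite mulrDr mulr1 mulrDl; apply: lerD.
  by apply: le_trans (hL X) _; rewrite lerDl mulr_ge0 ?mnorm_ge0.
by rewrite lerDr.
Qed.

(* The parameter [a : T], of size [nu a], collects the arguments fixed so far; the bounds
   have to be uniform in them. *)
Definition tail_bounded (T : Type) (nu : T -> R) p m s (g : T -> tailmap N p m s) :=
  forall ns (Y : points ns), in_dom Y -> exists2 e : R, 0 < e & exists2 M : R, 0 <= M &
    forall X, in_dom X -> close_points (fun _ => e) X Y ->
    forall a, mbound (g a ns X) (M * nu a).

Lemma close_points_le d d' s (ns : sizes s) (X Y : points ns) :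
  (forall j, (j < size s)%N -> d j <= d' j) -> close_points d X Y -> close_points d' X Y.
Proof.
elim: s ns X Y d d' => //= t s IH ns X Y d d' dd [XY XYs]; split.
  exact: lt_le_trans XY (dd 0%N isT).
by apply: (IH _ _ _ (fun j => d j.+1)) => // j js; apply: dd.
Qed.

Lemma mnorm_near (V : admspace R) p q (X Y : 'M[V]_(p, q)) e :
  (0 < p)%N -> (0 < q)%N -> mnorm (X - Y) < e -> mnorm X <= mnorm Y + e.
Proof.
move=> p0 q0 XY; rewrite -[X in mnorm X](subrK Y) addrC.
by apply: le_trans (mnormD p0 q0 _ _) _; rewrite lerD2l ltW.
Qed.

Lemma tail_integral_bounded_step (T : Type) (nu : T -> R) p m t s
    (F : T -> forall j, tailmap N p m (t :: dup t s j)) :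
  (0 < p)%N -> (0 < m)%N -> (forall a, 0 <= nu a) ->
  tail_bounded nu (fun a => F a 0%N) ->
  (forall n (X : 'M[spt t]_n) ns (Ys : points ns), sdom t _ X -> in_dom Ys ->
     exists2 e : R, 0 < e & exists2 M : R, 0 <= M &
     forall Xs, in_dom Xs -> close_points (fun _ => e) Xs Ys ->
     forall a Z, @mbound _ N p _ _ s ns (tail_integral_rest (F a) Xs Z) (M * (nu a * mnorm Z))) ->
  tail_bounded nu (fun a => tail_integral (F a)).
Proof.
move=> p0 m0 nu0 FB FR [n ns] [Y' Ys] [dY' dYs].
have dY := baseptP dY'; have n0 : (0 < n)%N := ncdom_size dY'.
have ns0 := in_dom_pos dYs.
set Y := projT2 _ in dY; set b := projT1 _ in Y dY.
have [e0 e00 [M0 M00 F0]] := FB (n, (b.+1, ns)) (Y', (Y, Ys)) (conj dY' (conj dY dYs)).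
have [e1 e10 [M1 M10 F1]] := FR n Y' ns Ys dY' dYs.
have [K0 K00 hK0] := homotopy_mbound (ns := ns) Y p0 n0 ns0.
have [K1 K10 hK1] := spread_mbound (ns := ns) (sarg t) b p0 m0 n0 ns0.
exists (Num.min e0 e1); first by rewrite lt_min e00.
have B0 : 0 <= mnorm Y' + e0 + 1.
  by rewrite !addr_ge0 ?mnorm_ge0 // ltW.
(* Near Y' the norm of X is at most [mnorm Y' + e0], which controls the factor [mnorm X + 1] of the
   homotopy; the second term bounds the spread part. *)
exists (K0 * M0 * (mnorm Y' + e0 + 1) + K1 * M1); first by rewrite addr_ge0 ?mulr_ge0.
move=> [X Xs] [dX dXs] [XY XYs] a [Z Zs] /=.
have Z0 : 0 <= mnorm Z by exact: mnorm_ge0.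
have nuZ0 : 0 <= nu a * mnorm Z by rewrite mulr_ge0.
have Zs0 : 0 <= args_norm Zs by exact: args_norm_ge0.
rewrite -[X in mnorm X]/(slotv (tail_integral (F a)) Xs X Z Zs) tail_integralE.
have {F0} F0 W : @mbound _ N p _ _ s ns (slotv2 (F a 0%N) Xs X Y Z W)
    (M0 * (nu a * mnorm Z) * mnorm W).
  move=> Zs'; have := F0 (X, (Y, Xs)) (conj dX (conj dY dXs)) _ a (Z, (W, Zs')).
  rewrite /= !mulrA; apply; split=> /=.
    by apply: lt_le_trans XY _; rewrite ge_min lexx.
  split=> /=; first by rewrite subrr mnorm0.
  by apply: close_points_le XYs => j _; rewrite ge_min lexx.
have B1 := hK0 _ _ (mulr_ge0 M00 nuZ0) F0 X Zs.
have {F1} F1 Z' : @mbound _ N p _ _ s ns (tail_integral_rest (F a) Xs Z') (M1 * nu a * mnorm Z').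
  by rewrite -mulrA; apply: F1 => //; apply: close_points_le XYs => j _; rewrite ge_min lexx orbT.
have B2 := hK1 _ _ (mulr_ge0 M10 (nu0 a)) F1 Z Zs.
apply: le_trans (mnormD p0 (lastsize_pos n0 ns0) _ _) _.
rewrite [leRHS](_ : _ = K0 * (M0 * (nu a * mnorm Z)) * (mnorm Y' + e0 + 1) * args_norm Zs +
  K1 * (M1 * nu a) * mnorm Z * args_norm Zs); last by ring.
apply: lerD; last exact: B2.
apply: le_trans B1 _; rewrite ler_wpM2r // ler_wpM2l ?mulr_ge0 // lerD2r.
apply: mnorm_near => //; apply: lt_le_trans XY _.
by rewrite ge_min lexx.
Qed.

Lemma tail_integral_bounded (T : Type) (nu : T -> R) p m t s
    (F : T -> forall j, tailmap N p m (t :: dup t s j)) :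
  (0 < p)%N -> (0 < m)%N -> (forall a, 0 <= nu a) ->
  (forall j, (j <= size s)%N -> tail_bounded nu (fun a => F a j)) ->
  tail_bounded nu (fun a => tail_integral (F a)).
Proof.
elim: s T nu p m t F => [|t2 s IH] T nu p m t F p0 m0 nu0 FB;
  apply: (tail_integral_bounded_step p0 m0 nu0 (FB 0%N isT)) => n X ns Ys dX dYs.
  exists 1 => //; exists 0 => // Xs dXs _ a Z Zs.
  rewrite mul0r mul0r; rewrite -[X in mnorm X]/(0 : 'M[N]_(p, lastsize _ ns)).
  by rewrite mnorm0.
have dY := baseptP dX.
set Y := projT2 _ in dY; set b := projT1 _ in Y dY.
(* The argument of the slot frozen at Y joins the parameter, and its norm joins the size of the
   parameter. *)
have FB' j : (j <= size s)%N -> tail_bounded (fun a : T * 'M[sarg t]_(m, b.+1) =>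
    nu a.1 * mnorm a.2) (fun a => tailat (F a.1 j.+1) Y a.2).
  move=> js ns' Ys' dYs'.
  have [e e0 [M M0 FM]] := FB j.+1 js (b.+1, ns') (Y, Ys') (conj dY dYs').
  exists e => //; exists M => // Xs dXs XY a Zs.
  have := FM (Y, Xs) (conj dY dXs) _ a.1 (a.2, Zs).
  rewrite /= !mulrA; apply; split=> //=.
  by rewrite subrr mnorm0.
have [e e0 [M M0 h]] := IH _ _ p b.+1 t2
  (fun (a : T * 'M[sarg t]_(m, b.+1)) j => tailat (F a.1 j.+1) Y a.2) p0 (ltn0Sn b)
  (fun a => mulr_ge0 (nu0 a.1) (mnorm_ge0 m0 (ltn0Sn b) a.2)) FB' ns Ys dYs.
exists e => //; exists M => // Xs dXs XY a Z.
exact: (h Xs dXs XY (a, Z)).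
Qed.
End LocalBounds.

Section HeadLocalBounds.
Variables (R : realType) (s0 : slot R).
Implicit Types (s : seq (slot R)).

Lemma min_radius (d : nat -> R) k : (forall j, 0 < d j) ->
  exists2 e : R, 0 < e & forall j, (j < k)%N -> e <= d j.
Proof.
move=> d0; elim: k => [|k [e e0 he]]; first by exists 1.
exists (Num.min e (d k)); first by rewrite lt_min e0 d0.
move=> j; rewrite ltnS leq_eqVlt => /orP[/eqP ->|jk]; rewrite ge_min ?lexx ?orbT //.
by rewrite he.
Qed.

Lemma locally_bounded_mbound s (F : ncmap s0 s) : hmulti F -> locally_bounded F ->
  forall n0 (Y0 : 'M[spt s0]_n0) ns (Y : points ns), sdom s0 _ Y0 -> in_dom Y ->
  exists2 e : R, 0 < e & exists2 M : R, 0 <= M &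
  forall X0 (X : points ns), sdom s0 _ X0 -> in_dom X -> mnorm (X0 - Y0) < e ->
    close_points (fun _ => e) X Y -> mbound (F n0 X0 ns X) M.
Proof.
move=> FM FB n0 Y0 ns Y dY0 dY.
have [d [d0 [M hM]]] := FB n0 Y0 ns Y dY0 dY.
have [e e0 he] := min_radius (size s).+1 d0.
exists e => //; exists `|M| => // X0 X dX0 dX XY0 XY.
have n0_gt0 := ncdom_size dX0; have ns_gt0 := in_dom_pos dX.
apply: (mboundW n0_gt0 ns_gt0 (ler_norm M)).
apply: opnorm_mbound => //; [exact: lastsize_pos|exact: FM|].
apply: hM => //; first by apply: lt_le_trans XY0 _; apply: he.
by apply: close_points_le XY => j js; apply: he.
Qed.

Variables (t2 : slot R) (s2 : seq (slot R)).
Local Notation s := (t2 :: s2).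

Lemma nc_integral_locally_bounded (F : forall j, ncmap s0 (dup s0 s j)) :
  (forall j, (j <= size s)%N -> hmulti (F j)) ->
  (forall j, (j <= size s)%N -> locally_bounded (F j)) ->
  locally_bounded (nc_integral F).
Proof.
move=> FM FB n0 Y0' ns Ys dY0' dYs.
have dY := baseptP dY0'; have n0_gt0 := ncdom_size dY0'; have ns_gt0 := in_dom_pos dYs.
set Y := projT2 _ in dY; set b := projT1 _ in Y dY.
pose F0 : ncmap s0 (dupslot s0 :: s) := F 0%N.
have [e0 e00 [M0 M00 hF0]] := @locally_bounded_mbound _ F0 (FM 0%N isT) (FB 0%N isT)
  n0 Y0' (b.+1, ns) (Y, Ys) dY0' (conj dY dYs).
(* No argument precedes the head, so the parameter is trivial and has size 1. *)
have FT j : (j <= size s2)%N ->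
    tail_bounded (fun _ : unit => 1) (fun _ : unit => F j.+1 b.+1 Y).
  move=> js ns' Ys' dYs'.
  have [e e1 [M M1 hM]] := locally_bounded_mbound (FM j.+1 js) (FB j.+1 js) dY dYs'.
  exists e => //; exists M => // Xs dXs XY _; rewrite mulr1; apply: hM => //.
  by rewrite subrr mnorm0.
have [e1 e10 [M1 M10 hF1]] := tail_integral_bounded (F := fun _ j => F j.+1 b.+1 Y)
  (ltn0Sn b) (ltn0Sn b) (fun _ : unit => ler01) FT dYs.
have [K0 K00 hK0] := homotopy_mbound (sarg s0) Y n0_gt0 n0_gt0 ns_gt0.
have [K1 K10 hK1] := sum_tract_mbound (sarg s0) (rowsel R[i] b (n := n0)) n0_gt0
  (ltn0Sn b) n0_gt0 ns_gt0.
have ls_gt0 := @lastsize_pos R b.+1 s ns isT ns_gt0.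
pose L c := projT1 (cid2 (lmx_bounded (sarg s0)
  (rmx (1%:M : 'M[R[i]^o]_n0) (colsel R[i] b c)) (ltn0Sn b) ls_gt0 n0_gt0)).
have LP c : 0 <= L c /\ forall Z : 'M[sarg s0]_(b.+1, lastsize b.+1 ns),
    mnorm (lmx (rmx (1%:M : 'M[R[i]^o]_n0) (colsel R[i] b c)) Z) <= L c * mnorm Z.
  by rewrite /L; case: cid2.
pose e := Num.min e0 e1.
exists (fun _ => e); split; first by move=> _; rewrite lt_min e00.
have B0 : 0 <= mnorm Y0' + e0 + 1.
  by rewrite !addr_ge0 ?mnorm_ge0 // ltW.
exists (K0 * M0 * (mnorm Y0' + e0 + 1) + \sum_c K1 c * (L c * M1)) => X0 Xs dX0 dXs XY0 XY.
apply: mbound_opnorm.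
  rewrite addr_ge0 ?mulr_ge0 //; apply: sumr_ge0 => c _.
  by rewrite !mulr_ge0 //; have [] := LP c.
apply: mboundD => //.
  apply: (mboundW (M := K0 * M0 * (mnorm X0 + 1))) => //.
    rewrite ler_wpM2l ?mulr_ge0 // lerD2r.
    apply: mnorm_near => //; apply: lt_le_trans XY0 _.
    by rewrite ge_min lexx.
  apply: (hK0 (fun W => slotvh2 F0 Xs n0 X0 Y 1%:M W)) => // W Zs.
  rewrite /slotvh2 lmx1 -mulrA.
  apply: (hF0 X0 (Y, Xs) dX0 (conj dY dXs) _ _ (W, Zs)).
    by apply: lt_le_trans XY0 _; rewrite ge_min lexx.
  split; first by rewrite subrr mnorm0.
  by apply: close_points_le XY => j _; rewrite ge_min lexx.
apply: hK1 => c; first by rewrite mulr_ge0 //; have [] := LP c.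
move=> Zs; rewrite /nc_integral_rest.
have [L0 hL] := LP c; apply: le_trans (hL _) _; rewrite -mulrA ler_wpM2l //.
rewrite -[M1]mulr1; apply: hF1 => //.
by apply: close_points_le XY => j _; rewrite ge_min lexx orbT.
Qed.
End HeadLocalBounds.

(** * Telescoping along a line *)

Section Telescope.
Variables (R : realType) (N : admspace R).
Implicit Types (p m j : nat) (t : slot R) (s : seq (slot R)).

Fixpoint dup_sizes j t s : sizes (t :: s) -> sizes (t :: dup t s j) :=
  match j return sizes (t :: s) -> sizes (t :: dup t s j) with
  | 0%N => fun n => (n.1, (n.1, n.2))
  | j'.+1 => match s return sizes (t :: s) -> sizes (t :: dup t s j'.+1) with
    | [::] => id
    | t2 :: s2 => fun n => (n.1, @dup_sizes j' t2 s2 n.2)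
    end
  end.

(** The mixed points of the telescope: those of X up to slot j, those of Y from slot j on. *)
Fixpoint dup_points j t s : forall n : sizes (t :: s), points n -> points n ->
    points (@dup_sizes j t s n) :=
  match j return forall n : sizes (t :: s), points n -> points n ->
    points (@dup_sizes j t s n) with
  | 0%N => fun n X Y => (X.1, (Y.1, Y.2))
  | j'.+1 => match s return forall n : sizes (t :: s), points n -> points n ->
      points (@dup_sizes j'.+1 t s n) with
    | [::] => fun n X Y => X
    | t2 :: s2 => fun n X Y => (X.1, @dup_points j' t2 s2 n.2 X.2 Y.2)
    end
  end.

(* The argument inserted by [dup] is taken from the list [D] of directions. *)
Fixpoint insert_arg p j t s m : forall (n : sizes (t :: s)), points n ->
    (args m (@dup_sizes j t s n) -> 'M[N]_(p, lastsize m (@dup_sizes j t s n))) ->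
    args m n -> 'M[N]_(p, lastsize m n) :=
  match j return forall (n : sizes (t :: s)), points n ->
    (args m (@dup_sizes j t s n) -> 'M[N]_(p, lastsize m (@dup_sizes j t s n))) ->
    args m n -> 'M[N]_(p, lastsize m n) with
  | 0%N => fun n D w Z => w (Z.1, (D.1, Z.2))
  | j'.+1 => match s return forall (n : sizes (t :: s)), points n ->
      (args m (@dup_sizes j'.+1 t s n) -> 'M[N]_(p, lastsize m (@dup_sizes j'.+1 t s n))) ->
      args m n -> 'M[N]_(p, lastsize m n) with
    | [::] => fun n D w => w
    | t2 :: s2 => fun n D w Z =>
        @insert_arg p j' t2 s2 n.1 n.2 D.2 (fun Zs => w (Z.1, Zs)) Z.2
    end
  end.

Lemma in_dom_dup j t s (n : sizes (t :: s)) (X Y : points n) :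
  in_dom X -> in_dom Y -> in_dom (dup_points j X Y).
Proof.
elim: j t s n X Y => [|j IH] t [|t2 s] n X Y //= [dX dXs] [dY dYs]; split=> //.
exact: (IH t2 s n.2).
Qed.

Fixpoint zero_points s : forall n : sizes s, points n :=
  match s return forall n : sizes s, points n with
  | [::] => fun _ => tt
  | t :: s' => fun n => (0, @zero_points s' n.2)
  end.

Lemma line_zero c s (n : sizes s) (Y : points n) : line c Y (zero_points n) = Y.
Proof.
elim: s n Y => [|t s IH] n Y //=.
by case: Y => Y Ys /=; rewrite scmx0r addr0 IH.
Qed.

(** The mixed points move on a line themselves, with direction zero from the second copy of slot j
    on; so the Lipschitz estimate along lines applies to F_j at them. *)
Lemma dup_points_line c j t s (n : sizes (t :: s)) (Y D : points n) :
  dup_points j (line c Y D) Y =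
  line c (dup_points j Y Y) (dup_points j D (zero_points n)).
Proof.
elim: j t s n Y D => [|j IH] t [|t2 s] n Y D //=.
- by rewrite scmx0r addr0.
- by rewrite !scmx0r !addr0 line_zero; case: Y => Y [Y2 Ys].
- by congr (_, _); apply: (IH t2 s n.2).
Qed.

Lemma insert_arg_lin p j t s m (n : sizes (t :: s)) (D : points n) a w w' w'' Z :
  (forall Z, w'' Z = scmx a (w Z) + w' Z) ->
  @insert_arg p j t s m n D w'' Z = scmx a (insert_arg D w Z) + insert_arg D w' Z.
Proof.
elim: j t s m n D w w' w'' Z => [|j IH] t [|t2 s] m n D w w' w'' Z ww //=.
by apply: IH => Zs; apply: ww.
Qed.

Lemma insert_arg_multilinear p j t s m (n : sizes (t :: s)) (D : points n) w :
  multilinear w -> multilinear (@insert_arg p j t s m n D w).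
Proof.
elim: j t s m n D w => [|j IH] t [|t2 s] m n D w //=.
- by move=> [w1 w2]; split=> [*|Z] //; apply: w1.
- move=> [w1 w2]; split=> [*|Z]; first exact: w1.
  by have [_] := w2 Z; apply.
- move=> [w1 w2]; split=> [a Z Z' Zs|Z]; last exact: (IH t2 s n.1 n.2).
  by apply: insert_arg_lin => Zs'; apply: w1.
Qed.

Lemma insert_arg_mbound p j t s m (n : sizes (t :: s)) (D : points n) :
  (0 < m)%N -> pos_sizes n -> exists2 K : R, 0 <= K & forall w M, 0 <= M ->
    mbound w M -> mbound (@insert_arg p j t s m n D w) (K * M).
Proof.
elim: j t s m n D => [|j IH] t [|t2 s] m n D m0 n0.
- exists (mnorm D.1); first by apply: mnorm_ge0; case: n0.
  move=> w M M0 wM [Z []]; have := wM (Z, (D.1, tt)).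
  by rewrite /= [leRHS](_ : _ = mnorm D.1 * M * (mnorm Z * 1)) //; ring.
- exists (mnorm D.1); first by apply: mnorm_ge0; case: n0.
  move=> w M M0 wM [Z Zs]; have := wM (Z, (D.1, Zs)).
  by rewrite /= [leRHS](_ : _ = mnorm D.1 * M * (mnorm Z * (mnorm Zs.1 * args_norm Zs.2))) //;
    ring.
- by exists 1 => // w M M0 wM; rewrite mul1r.
have [K K0 hK] := IH t2 s n.1 n.2 D.2 n0.1 n0.2.
exists K => // w M M0 wM [Z Zs].
have := hK (fun Zs => w (Z, Zs)) (M * mnorm Z).
rewrite /mbound => /(_ _ _ Zs) h.
apply: le_trans (h _ _) _.
- by rewrite mulr_ge0 // mnorm_ge0 //; case: n0.
- by move=> Zs'; rewrite -mulrA; apply: (wM (Z, Zs')).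
by rewrite /= [leRHS](_ : _ = K * (M * mnorm Z) *
  (@args_norm R n.1 (t2 :: s) n.2 Zs)) //=; ring.
Qed.

(** Change the points one slot at a time. For S = I the difference formula inserts the increment c
    D^j into F_j, and linearity takes c out. *)
Lemma tdiff_telescope p t s m (g : tailmap N p m (t :: s))
    (G : forall j, tailmap N p m (t :: dup t s j)) (n : sizes (t :: s)) (Y D : points n) c Z :
  (forall j, (j <= size s)%N -> tdiff (j := j) g (G j)) ->
  (forall j, (j <= size s)%N -> tmulti (G j)) ->
  in_dom Y -> in_dom (line c Y D) ->
  g n (line c Y D) Z - g n Y Z = scmx c (\sum_(j < (size s).+1)
    insert_arg D (G j _ (dup_points j (line c Y D) Y)) Z).
Proof.
have step0 t' s' m' (g' : tailmap N p m' (t' :: s')) G' n' (X1 Y1 D1 : 'M[spt t']_n')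
    (ns' : sizes s') (Ys : points ns') Z1 Zs :
    tdiff (j := 0) g' G' -> tmulti G' -> sdom t' _ X1 -> sdom t' _ Y1 -> in_dom Ys ->
    X1 = Y1 + scmx c D1 ->
    g' (n', ns') (X1, Ys) (Z1, Zs) - g' (n', ns') (Y1, Ys) (Z1, Zs) =
    scmx c (slotv2 (s := s') G' Ys X1 Y1 Z1 D1 Zs).
  move=> gG' GM' dX dY dYs XY.
  have := gG' ns' Ys dYs _ _ X1 Y1 1%:M Z1 dX dY.
  have e : X1 - Y1 = scmx c D1 by rewrite XY addrC addKr.
  rewrite ract1 !rmx1 lmx1 e.
  rewrite (slinearZ (tmulti_slotv2 dYs GM' Z1 dX dY).1).
  by move=> /(congr1 (@^~ Zs)).
elim: s t m g G n Y D Z => [|t2 s IH] t m g G [n ns] [Y Ys] [D Ds] [Z Zs] gG GM [dY dYs] [dX dXs].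
  rewrite big_ord1; move: ns Y Ys D Ds Z Zs dY dYs dX dXs => [] Y [] D [] Z [] dY _ dX _.
  exact: (step0 t [::] m g (G 0%N) n _ Y D tt tt Z tt (gG 0%N isT) (GM 0%N isT) dX dY I).
rewrite -(subrKA (g (n, ns) (Y + scmx c D, Ys) (Z, Zs))).
rewrite (step0 t (t2 :: s) m g (G 0%N) n _ Y D ns Ys Z Zs (gG 0%N isT) (GM 0%N isT) dX dY dYs) //.
have := IH t2 n (tailat g (Y + scmx c D) Z) (fun j => tailat (G j.+1) (Y + scmx c D) Z)
  ns Ys Ds Zs (fun j js => gG j.+1 js n _ Z dX)
  (fun j js => tmulti_tailat _ (GM j.+1 js) dX) dYs dXs.
move=> e; rewrite [X in X + _ = _]e -scmxDr [in RHS]big_ord_recl addrC.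
by [].
Qed.
End Telescope.

(** * Limits at a punctured zero in terms of real radii *)

Section PuncturedLimits.
Variable R : realType.

Lemma near_dnbhs0P (P : R[i] -> Prop) :
  (\forall c \near (0 : (R[i] : numFieldType))^', P c) <->
  exists2 e : R, 0 < e & forall c, c != 0 -> cabs c < e -> P c.
Proof.
rewrite near_withinE; split=> [/nbhs_normP[e /= e0 he]|[e e0 he]].
  (* The radius of a ball is an element of [R[i]]; being positive, it is real. *)
  have [Ie Re] : complex.Im e = 0 /\ 0 < complex.Re e.
    by move: e0; rewrite ltcE /= => /andP[/eqP].
  have eE : e = (complex.Re e)%:C by apply/eqP; rewrite eq_complex /= Ie !eqxx.
  exists (complex.Re e) => // c c0 ce; apply: he => //.
  have : (cabs c)%:C < (complex.Re e)%:C by rewrite ltcR.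
  by rewrite -eE -cabsE -(normrN c) -(sub0r c).
apply/nbhs_normP; exists e%:C => /=; first by rewrite ltcR.
move=> c ce c0; apply: he => //; rewrite -ltcR -cabsE -(normrN c) -(sub0r c).
exact: ce.
Qed.

Lemma cvg_dnbhs0P (h : R[i] -> \bar R) : (forall c, 0 <= h c)%E ->
  (h c @[c --> (0 : (R[i] : numFieldType))^'] --> 0%E) <->
  forall e : R, 0 < e -> exists2 d : R, 0 < d & forall c, c != 0 -> cabs c < d ->
    (h c <= e%:E)%E.
Proof.
move=> h0; split=> [hh e e0|hh A [d /= d0 dA]].
  have /hh /near_dnbhs0P[d d0 dh] : nbhs 0%E [set x : \bar R | (x <= e%:E)%E].
    apply/nbhs_normP; exists e => //= r /=.
    by rewrite sub0r normrN lee_fin => /ltW; apply: le_trans; rewrite ler_norm.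
  by exists d => // c c0 cd; exact: dh c c0 cd.
(* The estimate is a weak inequality and the ball is open, hence the half. *)
have [d' d'0 dh] := hh (d / 2) (divr_gt0 d0 (ltr0n _ 2)).
apply/near_dnbhs0P; exists d' => // c c0 cd.
suff : A (h c) by [].
have := dh c c0 cd; have := h0 c.
case: (h c) => [r| |] //; rewrite !lee_fin => r0 rd.
apply: dA => /=; rewrite sub0r normrN ger0_norm //.
by apply: le_lt_trans rd _; rewrite ltr_pdivrMr // ltr_pMr // ltr1n.
Qed.
End PuncturedLimits.

(** * Lipschitz estimates along lines *)

Section LineEstimates.
Variables (R : realType).
Implicit Types (s : seq (slot R)).

Lemma ncdom_line (V : admspace R) (Om : open_ncset V) n (X D : 'M[V]_n) : Om _ X ->
  exists2 e : R, 0 < e & forall c, cabs c < e -> Om _ (X + scmx c D).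
Proof.
move=> dX; have [e e0 he] := ncdom_open dX; have n0 := ncdom_size dX.
have D0 : 0 < mnorm D + 1 by rewrite ltr_wpDl // mnorm_ge0.
exists (e / (mnorm D + 1)); first exact: divr_gt0.
move=> c; rewrite ltr_pdivlMr // => ce; apply: he.
rewrite addrC addKr mnormZ //; apply: le_lt_trans ce.
by rewrite ler_wpM2l ?cabs_ge0 // lerDl.
Qed.

Lemma in_dom_line s (ns : sizes s) (X D : points ns) : in_dom X ->
  exists2 e : R, 0 < e & forall c, cabs c < e -> in_dom (line c X D).
Proof.
elim: s ns X D => [|t s IH] ns X D; first by exists 1.
move=> [dX dXs]; have [e e0 he] := ncdom_line D.1 dX.
have [e' e0' he'] := IH _ _ D.2 dXs.
exists (Num.min e e'); first by rewrite lt_min e0.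
by move=> c; rewrite lt_min => /andP[ce ce']; split; [apply: he|apply: he'].
Qed.

Lemma close_points_refl (d : nat -> R) s (ns : sizes s) (X : points ns) :
  (forall j, 0 < d j) -> in_dom X -> close_points d X X.
Proof.
elim: s d ns X => //= t s IH d ns X d0 [dX dXs]; split; last exact: IH.
by rewrite subrr mnorm0 // (ncdom_size dX).
Qed.

Section Operators.
Variables (N : admspace R) (p q m : nat) (s : seq (slot R)) (ns : sizes s).
Implicit Types w : args m ns -> 'M[N]_(p, q).

Lemma multilinear_scmx a w : multilinear w -> multilinear (fun Z => scmx a (w Z)).
Proof.
by apply: multilinear_lin => x y z; rewrite scmxDr !scmxA mulrC.
Qed.

Lemma multilinearB w w' : multilinear w -> multilinear w' ->
  multilinear (fun Z => w Z - w' Z).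
Proof.
move=> wL wL'; apply: multilinearD => //.
by apply: (multilinear_lin (h := -%R)) wL' => x y z; rewrite opprD scmxNr.
Qed.

Hypotheses (p0 : (0 < p)%N) (q0 : (0 < q)%N).

Lemma mbound_scmx a w M : mbound w M -> mbound (fun Z => scmx a (w Z)) (cabs a * M).
Proof. by move=> wM Z; rewrite mnormZ // -mulrA ler_wpM2l ?cabs_ge0. Qed.

Lemma mboundB w w' M M' : mbound w M -> mbound w' M' ->
  mbound (fun Z => w Z - w' Z) (M + M').
Proof.
by move=> wM wM'; apply: mboundD => // Z; rewrite mnormN.
Qed.
End Operators.

Variable s0 : slot R.

(* The Gateaux derivative is not assumed bounded: it is the difference of a
   quotient, bounded by local boundedness, and of an operator of norm at most 1. *)
Lemma line_lipschitz s (F : ncmap s0 s) : hmulti F -> analytic F ->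
  forall n0 (Y0 D0 : 'M[spt s0]_n0) ns (Y D : points ns), sdom s0 _ Y0 -> in_dom Y ->
  exists2 e : R, 0 < e & exists2 K : R, 0 <= K & forall c, c != 0 -> cabs c < e ->
    mbound (fun Z => F n0 (Y0 + scmx c D0) ns (line c Y D) Z - F n0 Y0 ns Y Z)
      (K * cabs c).
Proof.
move=> FM [FB FG] n0 Y0 D0 ns Y D dY0 dY.
have n0_gt0 := ncdom_size dY0; have ns_gt0 := in_dom_pos dY.
have ls_gt0 := lastsize_pos n0_gt0 ns_gt0.
have [D' D'L /cvg_dnbhs0P hD'] := FG n0 Y0 D0 ns Y D dY0 dY.
have [|d d0 hd] := hD' _ 1 ltr01.
  by move=> c; apply: ereal_sup_ubound; left.
have [e1 e10 he1] := ncdom_line D0 dY0; have [e2 e20 he2] := in_dom_line D dY.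
pose e := Num.min d (Num.min e1 e2).
have e0 : 0 < e by rewrite !lt_min d0 e10.
have FL c : cabs c < e -> multilinear (F n0 (Y0 + scmx c D0) ns (line c Y D)).
  by rewrite !lt_min => /and3P[_ c1 c2]; apply: FM; [apply: he1|apply: he2].
have hw c : c != 0 -> cabs c < e -> mbound (fun W => scmx c^-1
    (F n0 (Y0 + scmx c D0) ns (line c Y D) W - F n0 Y0 ns Y W) - D' W) 1.
  move=> c0 ce; apply: opnorm_mbound => //.
    apply: multilinearB => //; apply: multilinear_scmx; apply: multilinearB.
      exact: FL.
    exact: FM.
  by apply: hd => //; move: ce; rewrite lt_min => /andP[].
have Fbd X0 X : sdom s0 _ X0 -> in_dom X -> exists2 M : R, 0 <= M & mbound (F n0 X0 ns X) M.
  move=> dX0 dX; have [r r0 [M M0 hM]] := locally_bounded_mbound FM FB dX0 dX.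
  exists M => //; apply: hM => //; first by rewrite subrr mnorm0.
  exact: close_points_refl.
(* One fixed nonzero step inside the radius is enough: the quotient at a bounds D'. *)
pose a : R[i] := (e / 2)%:C.
have a0 : a != 0 by rewrite fmorph_eq0 gt_eqF // divr_gt0.
have ae : cabs a < e.
  by rewrite cabs_real ?divr_ge0 1?ltW // ltr_pdivrMr // ltr_pMr // ltr1n.
have [M1 M10 hM1] : exists2 M : R, 0 <= M &
    mbound (F n0 (Y0 + scmx a D0) ns (line a Y D)) M.
  by move: (ae); rewrite !lt_min => /and3P[_ c1 c2]; apply: Fbd; [apply: he1|apply: he2].
have [M2 M20 hM2] := Fbd Y0 Y dY0 dY.
pose M' := cabs a^-1 * (M1 + M2) + 1.
have D'b : mbound D' M'.
  have := mboundB n0_gt0 ls_gt0 (mbound_scmx n0_gt0 ls_gt0 a^-1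
    (mboundB n0_gt0 ls_gt0 hM1 hM2)) (hw a a0 ae).
  by move=> h Z; have := h Z; rewrite opprB addrC subrK.
exists e => //; exists (1 + M') => [|c c0 ce Z].
  by rewrite !addr_ge0 // mulr_ge0 ?cabs_ge0 // addr_ge0.
have := mbound_scmx n0_gt0 ls_gt0 c (mboundD n0_gt0 ls_gt0 (hw c c0 ce) D'b) Z.
by rewrite subrK scmxA mulfV // scmx1 [cabs c * _]mulrC.
Qed.
End LineEstimates.

(** * Gateaux differentiability from the difference formulas *)

Section GateauxDiff.
Variables (R : realType) (s0 t2 : slot R) (s2 : seq (slot R)).
Local Notation s := (t2 :: s2).

Lemma ndiff_gateaux (f : ncmap s0 s) (F : forall j, ncmap s0 (dup s0 s j)) :
  (forall j, (j <= size s)%N -> ndiff (j := j) f (F j)) ->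
  (forall j, (j <= size s)%N -> hmulti (F j)) ->
  (forall j, (j <= size s)%N -> analytic (F j)) ->
  gateaux_differentiable f.
Proof.
move=> fF FM FA n0 Y0 D0 ns Y D dY0 dY.
have n0_gt0 := ncdom_size dY0; have ns_gt0 := in_dom_pos dY.
have ls_gt0 := lastsize_pos n0_gt0 ns_gt0.
pose F0 : ncmap s0 (dupslot s0 :: s) := F 0%N.
have F0M : hmulti F0 := FM 0%N isT.
have jP (j : 'I_(size s2).+1) : (j < size s)%N by [].
pose T (j : 'I_(size s2).+1) c :
    args n0 ns -> 'M[sarg s0]_(n0, lastsize n0 ns) :=
  @insert_arg R (sarg s0) n0 j t2 s2 n0 ns D
    (F j.+1 n0 (Y0 + scmx c D0) _ (dup_points j (line c Y D) Y)).
pose T0 c (Z : args n0 ns) := F0 n0 (Y0 + scmx c D0) (n0, ns) (Y0, Y) (D0, Z).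
(* By telescoping, the difference quotient at c is the sum of all [T j c] and [T0 c]; the derivative
   is this sum at c = 0. *)
pose DD Z := \sum_j T j 0 Z + T0 0 Z.
have [e1 e10 he1] := ncdom_line D0 dY0; have [e2 e20 he2] := in_dom_line D dY.
have line0 u (nu : sizes u) (X E : points nu) : line 0 X E = X.
  by elim: u nu X E => [|t u IH] nu X E //=; rewrite scmx0l addr0 IH; case: X.
have Y00 : Y0 + scmx 0 D0 = Y0 by rewrite scmx0l addr0.
exists DD.
  apply: multilinearD.
    apply: multilinear_sum => j; apply: insert_arg_multilinear.
    by apply: (FM j.+1 (jP j)); rewrite ?Y00 ?line0 //; apply: in_dom_dup.
  have dY0' : sdom s0 _ (Y0 + scmx 0 D0) by rewrite Y00.
  by have [_] := F0M n0 _ dY0' (n0, ns) (Y0, Y) (conj dY0 dY); apply.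
have quot c : c != 0 -> cabs c < Num.min e1 e2 -> forall Z,
    scmx c^-1 (f n0 (Y0 + scmx c D0) ns (line c Y D) Z - f n0 Y0 ns Y Z) - DD Z =
    \sum_j (T j c Z - T j 0 Z) + (T0 c Z - T0 0 Z).
  move=> c0; rewrite lt_min => /andP[/he1 dX0 /he2 dX] Z.
  rewrite -[X in scmx c^-1 X](subrKA (f n0 (Y0 + scmx c D0) ns Y Z)).
  have -> := tdiff_telescope (G := fun j => F j.+1 n0 (Y0 + scmx c D0)) Z
    (fun j js => fF j.+1 js n0 _ dX0) (fun j js => FM j.+1 js n0 _ dX0) dY dX.
  have -> : f n0 (Y0 + scmx c D0) ns Y Z - f n0 Y0 ns Y Z = scmx c (T0 c Z).
    have := congr1 (fun k : trow (sarg s0) n0 ns n0 => k Z)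
      (fF 0%N isT ns Y n0 dY _ _ _ _ 1%:M 1%:M dX0 dY0).
    have eX : Y0 + scmx c D0 - Y0 = scmx c D0 by rewrite addrC addKr.
    rewrite ract1 !rmx1 lmx1 eX.
    rewrite (slinearZ (hmulti_slotvh2 (Xs := Y) dY F0M (1%:M : 'M[R[i]^o]_n0) dX0 dY0).1).
    move=> e; have {e} : lmx 1%:M (f n0 (Y0 + scmx c D0) ns Y Z) -
      lmx 1%:M (f n0 Y0 ns Y Z) = scmx c (lmx 1%:M (T0 c Z)) := e.
    by rewrite !lmx1.
  by rewrite -scmxDr scmxA mulVf // scmx1 /DD opprD addrACA sumrB.
have Tlip j : exists2 e : R, 0 < e & exists2 K : R, 0 <= K & forall c, c != 0 ->
    cabs c < e -> mbound (fun Z => T j c Z - T j 0 Z) (K * cabs c).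
  have [e e0 [K K0 hK]] := line_lipschitz (FM j.+1 (jP j)) (FA j.+1 (jP j)) D0
    (dup_points j D (zero_points ns)) dY0 (in_dom_dup j dY dY).
  have [K' K'0 hK'] := insert_arg_mbound (sarg s0) n0 j D n0_gt0 ns_gt0.
  exists e => //; exists (K' * K); first exact: mulr_ge0.
  move=> c c0 ce; have := hK' _ _ (mulr_ge0 K0 (cabs_ge0 c)) (hK c c0 ce).
  move=> h Z; rewrite -(mulrA K' K (cabs c)); move: (h Z) => {h}.
  rewrite (@insert_arg_lin _ _ _ _ _ _ _ _ _ (-1) (F j.+1 n0 Y0 _ (dup_points j Y Y))
    (F j.+1 n0 (Y0 + scmx c D0) _ (dup_points j (line c Y D) Y))).
    by rewrite /T Y00 line0 scmxNl scmx1 addrC.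
  by move=> Z'; rewrite dup_points_line scmxNl scmx1 addrC.
have [e3 e30 [K3 K30 hK3]] : exists2 e : R, 0 < e & exists2 K : R, 0 <= K &
    forall c, c != 0 -> cabs c < e -> mbound (fun Z => T0 c Z - T0 0 Z) (K * cabs c).
  (* In [T0] only the first point moves, so the other directions are zero; the inserted argument D0
     contributes its norm to the constant. *)
  have [e e0 [K K0 hK]] := @line_lipschitz R s0 _ F0 F0M (FA 0%N isT) n0 Y0 D0 (n0, ns)
    (Y0, Y) (@zero_points R (dupslot s0 :: s) (n0, ns)) dY0 (conj dY0 dY).
  exists e => //; exists (K * mnorm D0); first by rewrite mulr_ge0 ?mnorm_ge0.
  move=> c c0 ce Z; have := hK c c0 ce (D0, Z).
  rewrite line_zero /T0 Y00 => h; apply: le_trans h _.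
  rewrite -[@args_norm _ n0 (dupslot s0 :: s) (n0, ns) (D0, Z)]/(mnorm D0 * args_norm Z).
  rewrite mulrA.
  by rewrite -(mulrA K) [cabs c * _]mulrC (mulrA K).
pose e' j := projT1 (cid2 (Tlip j)).
have eP j : 0 < e' j /\ exists2 K : R, 0 <= K & forall c, c != 0 ->
    cabs c < e' j -> mbound (fun Z => T j c Z - T j 0 Z) (K * cabs c).
  by rewrite /e'; case: cid2.
pose K' j := projT1 (cid2 (eP j).2).
have KP j : 0 <= K' j /\ forall c, c != 0 ->
    cabs c < e' j -> mbound (fun Z => T j c Z - T j 0 Z) (K' j * cabs c).
  by rewrite /K'; case: cid2.
have [e4 e40 he4] := min_radius (d := fun k => e' (inord k)) (size s2).+1
  (fun k => (eP (inord k)).1).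
apply/cvg_dnbhs0P => [c|e e0]; first by apply: ereal_sup_ubound; left.
pose K := \sum_j K' j + K3.
have K0 : 0 <= K by rewrite addr_ge0 // sumr_ge0 // => j _; have [] := KP j.
have K10 : 0 < K + 1 by rewrite ltr_wpDl.
(* The radii e1, e2 keep the line in the domains, and e3, e4 make the Lipschitz estimates valid. The
   last one turns the bound K |c| into e; the summand 1 avoids a division by zero. *)
exists (Num.min (Num.min e1 e2) (Num.min e3 (Num.min e4 (e / (K + 1))))).
  by rewrite !lt_min e10 e20 e30 e40 divr_gt0.
move=> c c0; rewrite lt_min => /andP[ce12]; rewrite !lt_min => /and3P[ce3 ce4 ceK].
have -> : (fun W => scmx c^-1 (f n0 (Y0 + scmx c D0) ns (line c Y D) W - f n0 Y0 ns Y W)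
    - DD W) = fun Z => \sum_j (T j c Z - T j 0 Z) + (T0 c Z - T0 0 Z).
  by apply/funext => Z; apply: quot.
apply: mbound_opnorm; first exact: ltW.
apply: (mboundW (M := \sum_j K' j * cabs c + K3 * cabs c)) => //.
  rewrite -mulr_suml -mulrDl -/K.
  rewrite ltr_pdivlMr // in ceK; apply: le_trans (ltW ceK).
  by rewrite mulrC ler_wpM2l ?cabs_ge0 // lerDl.
apply: mboundD => //; last exact: hK3.
apply: mbound_sum => // j; have [_] := KP j; apply=> //.
apply: lt_le_trans ce4 _; have := he4 j (ltn_ord j).
by rewrite inord_val.
Qed.
End GateauxDiff.

Theorem theorem3p5 (R : realType) (k : nat) (s0 : slot R) (s : seq (slot R))
    (k_ge1 : (1 <= k)%N) (size_s : size s = k)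
    (F : forall j : 'I_k.+1, ncmap s0 (dup s0 s j))
    (F_nc : forall j : 'I_k.+1, nc_function (F j))
    (F_analytic : forall j : 'I_k.+1, analytic (F j)) :
  ((exists f : ncmap s0 s,
      [/\ nc_function f, analytic f &
          forall j : 'I_k.+1, nc_eq (Delta j f) (F j)])
   <->
   (forall (i j : 'I_k.+1) (le_ij : (i <= j)%N),
      nc_eq (ncmap_cast (dup_comm s0 s le_ij) (Delta i (F j)))
            (Delta j.+1 (F i))))
  /\
  (forall f f' : ncmap s0 s,
     [/\ nc_function f, analytic f &
         forall j : 'I_k.+1, nc_eq (Delta j f) (F j)] ->
     [/\ nc_function f', analytic f' &
         forall j : 'I_k.+1, nc_eq (Delta j f') (F j)] ->
     exists c : vectors s -> sarg s0,
       vmultilinear c /\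
       forall n0 (X0 : 'M[spt s0]_n0) (n : sizes s) (X : points n)
              (Z : args n0 n),
         sdom s0 _ X0 -> in_dom X ->
         f' n0 X0 n X Z = (f n0 X0 n X Z + amplify c Z)%R).
Proof.
subst k; case: s k_ge1 F F_nc F_analytic => [//|t2 s2] _ F F_nc F_an.
set s := t2 :: s2 in F F_nc F_an *.
(* The recursion over slots uses families indexed by [nat], so F is extended by zero beyond k. *)
pose F' (j : nat) : ncmap s0 (dup s0 s j) :=
  if pselect (j < (size s).+1)%N is left lt_j then F (Ordinal lt_j)
  else fun _ _ _ _ _ => 0%R.
have F'E (j : 'I_(size s).+1) : F' j = F j.
  rewrite /F'; case: pselect => [lt_j|[]]; last exact: ltn_ord.
  by case: j lt_j => j lt_j lt_j'; rewrite (bool_irrelevance lt_j' lt_j).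
have F'_nc j : (j <= size s)%N -> nc_function (F' j).
  rewrite -ltnS => lt_j; have := F_nc (Ordinal lt_j); by rewrite -F'E.
have F'_an j : (j <= size s)%N -> analytic (F' j).
  rewrite -ltnS => lt_j; have := F_an (Ordinal lt_j); by rewrite -F'E.
have F'_multi j : (j <= size s)%N -> hmulti (F' j).
  by move=> /F'_nc[FM _ _] n0 X0 dX0 ns X dX; apply: FM.
have diff f : nc_function f -> (forall j : 'I_(size s).+1, nc_eq (Delta j f) (F j)) ->
    forall j, (j <= size s)%N -> ndiff f (F' j).
  move=> f_nc fF j; rewrite -ltnS => lt_j.
  have := fF (Ordinal lt_j); rewrite -F'E.
  exact: ndiff_congr (ndiff_Delta j f_nc).
have multi (f : ncmap s0 s) : nc_function f -> hmulti f.
  by move=> [fM _ _] n0 X0 dX0 ns X dX; apply: fM.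
split; last first.
  move=> f f' [f_nc _ fF] [f'_nc _ f'F].
  exact: ndiff_unique (multi f f_nc) (multi f' f'_nc) (diff f f_nc fF) (diff f' f'_nc f'F).
split=> [[f [f_nc _ fF]] i j le_ij|F_closed].
  by apply: (@hclosed_Delta R s0 i j s le_ij f) => //; rewrite -ltnS ltn_ord.
have F'_closed i j (le_ij : (i <= j)%N) : (j <= size s)%N -> hclosed le_ij (F' i) (F' j).
  move=> le_j; have lt_j : (j < (size s).+1)%N by [].
  have lt_i : (i < (size s).+1)%N by apply: leq_ltn_trans le_ij lt_j.
  have := F_closed (Ordinal lt_i) (Ordinal lt_j) le_ij.
  by rewrite -!F'E.
exists (nc_integral F'); split.
- exact: nc_integral_nc.
- split.
    by apply: nc_integral_locally_bounded => // j js; have [] := F'_an j js.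
  apply: ndiff_gateaux F'_multi F'_an => j js.
  exact: nc_integral_diff.
- by move=> j; rewrite -F'E; apply: nc_integral_Delta => //; rewrite -ltnS ltn_ord.
Qed.
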